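(* Let $d=1$, $1\leq p,\theta\leq\infty$, $r>\max\{1/p,1/2\}$. Then, for $m\in\mathbb{N}$, $$ e_m(B^{r}_{p,\theta})_{B_{\infty,1}}\asymp m^{-r+\left(\frac{1}{p}-\frac{1}{2}\right)_+}, $$ where $a_+=\max\{a,0\}$.
   Context: $\mathbb{T}=[0,2\pi)$; $L_p(\mathbb{T})$ is the space of $2\pi$-periodic functions with norm $\|f\|_p=\big((2\pi)^{-1}\int_{\mathbb{T}}|f|^p\big)^{1/p}$ ($1\le p<\infty$), $\|f\|_\infty=\operatorname{ess\,sup}|f|$. For $h\in\mathbb{R}$, $\Delta_{h}f(x)=f(x+h)-f(x)$, $\Delta^k_{h}=\Delta_{h}\Delta^{k-1}_{h}$, and $\omega_k(f,t)_p=\sup_{|h|\le t}\|\Delta^k_{h}f\|_p$. For $r>0$, $1\le p,\theta\le\infty$ and a fixed integer $k>r$, the Nikol'skii–Besov space $B^r_{p,\theta}$ consists of $f\in L_p(\mathbb{T})$ with finite norm $\|f\|_{B^r_{p,\theta}}=\|f\|_p+\big(\int_0^\infty (t^{-r}\omega_k(f,t)_p)^\theta\,\frac{dt}{t}\big)^{1/\theta}$ for $\theta<\infty$, and $\|f\|_p+\sup_{t>0}t^{-r}\omega_k(f,t)_p$ for $\theta=\infty$; the class $B^r_{p,\theta}$ denotes its unit ball. Let $V_l(t)=l^{-1}\sum_{k=l}^{2l-1}D_k(t)$ with $D_k(t)=\sum_{|j|\le k}e^{ijt}$ be the de la Vallée-Poussin kernel and $V_l(f)=f*V_l$. Set $\sigma_0(f)=V_1(f)$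 and $\sigma_s(f)=V_{2^s}(f)-V_{2^{s-1}}(f)$ for $s\in\mathbb{N}$. $B_{\infty,1}$ is the space of $f\in L_\infty(\mathbb{T})$ with $\|f\|_{B_{\infty,1}}:=\sum_{s\ge0}\|\sigma_s(f)\|_\infty<\infty$. For $f\in B_{\infty,1}$, $e_m(f)_{B_{\infty,1}}=\inf_{\Theta_m}\inf_{c_k}\|f-\sum_{k\in\Theta_m}c_ke^{ikx}\|_{B_{\infty,1}}$, where $\Theta_m$ ranges over sets of $m$ integers and $c_k\in\mathbb{C}$; for a class $F$, $e_m(F)_{B_{\infty,1}}=\sup_{f\in F}e_m(f)_{B_{\infty,1}}$. The notation $a(m)\asymp b(m)$ means there are constants $0<C_1<C_2$ independent of $m$ with $C_1a(m)\le b(m)\le C_2a(m)$ for all $m\in\mathbb{N}$. *)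

(* Defs.v *)
From HB Require Import structures.
From mathcomp Require Import all_boot all_order all_algebra.
From mathcomp Require Import all_classical all_reals all_analysis.
From mathcomp Require Import complex.

Set Implicit Arguments.
Unset Strict Implicit.
Unset Printing Implicit Defensive.
Import Order.TTheory GRing.Theory Num.Theory.
Import numFieldNormedType.Exports.
Local Open Scope classical_set_scope.
Local Open Scope ring_scope.

Section Defs.
Variable R : realType.

Lemma torus_itv_measurable : measurable (`[0%R, 2 * pi[ : set R).
Proof. exact: measurable_itv. Qed.

Lemma inv2pi_ge0 : (0 : R) <= (2 * pi)^-1.
Proof. by rewrite invr_ge0 mulr_ge0 // ltW // pi_gt0. Qed.

Definition inv2pi_nng : {nonneg R} := NngNum inv2pi_ge0.

Definition torus_measure :=
  mscale inv2pi_nng (mrestr (@lebesgue_measure R) torus_itv_measurable).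


Definition cabs (z : R[i]) : \bar R := (ComplexField.Normc.normc z)%:E.

Definition Tnorm (p : \bar R) (g : R -> R[i]) : \bar R :=
  Lnorm torus_measure p (fun x => cabs (g x)).

Definition einv (p : \bar R) : R :=
  match p with r%:E => r^-1 | _ => 0 end.

Definition periodic2pi (f : R -> R[i]) := forall x, f (x + 2 * pi) = f x.

Definition cmeasurable (f : R -> R[i]) :=
  measurable_fun setT (fun x => complex.Re (f x)) /\
  measurable_fun setT (fun x => complex.Im (f x)).

Definition in_Lp (p : \bar R) (f : R -> R[i]) :=
  periodic2pi f /\ cmeasurable f /\ (Tnorm p f < +oo)%E.

Definition Delta (h : R) (f : R -> R[i]) : R -> R[i] := fun x => f (x + h) - f x.
Definition Deltak (k : nat) (h : R) (f : R -> R[i]) := iter k (Delta h) f.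

Definition omega (k : nat) (p : \bar R) (f : R -> R[i]) (t : R) : \bar R :=
  ereal_sup [set Tnorm p (Deltak k h f) | h in [set h : R | `|h| <= t]].

(* Nikol'skii-Besov norm (with fixed k > r) *)
Definition besov_norm (k : nat) (r : R) (p theta : \bar R) (f : R -> R[i])
    : \bar R :=
  (Tnorm p f +
   match theta with
   | th%:E =>
       (\int[@lebesgue_measure R]_(t in `]0%R, +oo[)
          ((((t `^ (- r))%:E * omega k p f t) `^ th) * (t^-1)%:E)) `^ th^-1
   | +oo => ereal_sup [set ((t `^ (- r))%:E * omega k p f t) | t in `]0%R, +oo[]
   | -oo => 0
   end)%E.

Definition besov_class (k : nat) (r : R) (p theta : \bar R) : set (R -> R[i]) :=
  [set f | in_Lp p f /\ (besov_norm k r p theta f <= 1)%E].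

Definition expi (n : int) (x : R) : R[i] :=
  Complex (cos (n%:~R * x)) (sin (n%:~R * x)).

Definition dirichlet (k : nat) (t : R) : R[i] :=
  \sum_(j < (2 * k).+1) expi (j%:Z - k%:Z) t.

Definition vallee_poussin (l : nat) (t : R) : R[i] :=
  (l%:R)^-1 * \sum_(l <= k < 2 * l) dirichlet k t.

Definition conv (f g : R -> R[i]) (x : R) : R[i] :=
  Complex (Rintegral torus_measure setT (fun t => complex.Re (f (x - t) * g t)))
          (Rintegral torus_measure setT (fun t => complex.Im (f (x - t) * g t))).

Definition VP (l : nat) (f : R -> R[i]) := conv f (vallee_poussin l).

Definition sigma_blk (s : nat) (f : R -> R[i]) : R -> R[i] :=
  match s with
  | 0 => VP 1 f
  | s'.+1 => fun x => VP (2 ^ s) f x - VP (2 ^ s') f x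
  end.

Definition Binf1_norm (f : R -> R[i]) : \bar R :=
  (\sum_(s <oo) Tnorm +oo%E (sigma_blk s f))%E.

Definition em_fun (m : nat) (f : R -> R[i]) : \bar R :=
  ereal_inf [set y | exists (Theta : seq int) (c : int -> R[i]),
     [/\ uniq Theta, size Theta = m &
         y = Binf1_norm (fun x => f x - \sum_(k <- Theta) c k * expi k x)]].

Definition em_class (m : nat) (F : set (R -> R[i])) : \bar R :=
  ereal_sup [set em_fun m f | f in F].

End Defs.

(* Main.v *)
(** Upper bound.  Put [gam p = (1/p - 1/2)_+] and [r' = r - gam p > 1/2].
    Testing a difference [Delta_h^k f], [h ~ 2^-s], against its own Fourier
    sum shows that the coefficients of [f] on the frequencies [~ 2^s] have l2
    norm [O(2^(-s r'))].  A trigonometric polynomial of degree [2^u] with l2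
    norm [rho] is approximated uniformly, with error [O((1 + v) 2^(v/2) rho)],
    by [O(2^(u-v))] exponentials: a derandomised choice of exponentials
    minimises an exponential potential over an equidistant grid, so that the
    error is large only on few grid points; the part interpolating these
    large values has much smaller l2 norm and is treated again.  Letting [v]
    grow slightly faster than linearly in the block index and summing over
    the dyadic blocks gives the upper bound.

    Lower bound.  A polynomial with coefficients of modulus at least 1 on
    [2^s >= 2 m] frequencies of one dyadic block keeps, after removal of [m]
    exponentials, half of its coefficients, and Parseval bounds the sup norm
    of the block from below.  The polynomials are Rudin-Shapiro polynomials
    for [p >= 2] and translates of de la Vallee-Poussin kernels for [p < 2]. *)
Require Import Defs.
From HB Require Import structures.
From mathcomp Require Import all_boot all_order all_algebra.
From mathcomp Require Import all_classical all_reals all_analysis.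
From mathcomp Require Import complex measurable_realfun ess_sup_inf.
From mathcomp Require Import ring lra zify.
Import Order.TTheory GRing.Theory Num.Theory.
Import numFieldNormedType.Exports.
Set Implicit Arguments.
Unset Strict Implicit.
Unset Printing Implicit Defensive.
Local Open Scope ring_scope.

(** * Complex exponentials and equidistant grids *)

Section complex_exponentials.
Variable R : realType.
Local Notation C := R[i].
Local Notation normc := ComplexField.Normc.normc.

(** The hypothesis on [r] amounts to r' > 1/2, and this strict gap pays for everything. Giving block
    n + d the level v = d + d/q leaves it about 2^(n - d/q) exponentials, about q 2^n in all, while
    the error 2^(v/2) 2^(-(n + d) r') still decays geometrically in d once 1/q < 2 r' - 1. The
    obstacle is a logarithm. Controlling a random sum at all of the roughly 2^u grid points at once
    would cost a power of u and spoil the order for the first blocks above n. Tolerating large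
    values at few grid points replaces u by v, the logarithm of the ratio between degree and number
    of terms, and the factor 1 + v is absorbed by the geometric decay. A general f enters only
    through its Fourier coefficients, since [Binf1_norm] sees nothing but the polynomials
    [sigma_blk s f]. Sup and L1 bounds are obtained on grids with more points than twice the degree:
    there Parseval is exact, and the de la Vallee-Poussin kernel, a difference of two squared
    moduli, is within its reach. *)

Lemma normc_ge0 (z : C) : 0 <= normc z.
Proof. by case: z => a b; rewrite /= sqrtr_ge0. Qed.

Lemma sqr_normcE (z : C) : normc z ^+ 2 = complex.Re z ^+ 2 + complex.Im z ^+ 2.
Proof. by case: z => a b /=; rewrite sqr_sqrtr // addr_ge0 // sqr_ge0. Qed.

Lemma sqr_normcC (z : C) : (normc z ^+ 2)%:C%C = z * z^*%C.
Proof.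
rewrite sqr_normcE; case: z => a b /=; apply/eqP; rewrite eq_complex /=.
by apply/andP; split; apply/eqP; ring.
Qed.

Lemma normc_sum (I : Type) (r : seq I) (P : pred I) (F : I -> C) :
  normc (\sum_(i <- r | P i) F i) <= \sum_(i <- r | P i) normc (F i).
Proof.
elim/big_ind2: _ => [|x a y b xa yb|//]; first by rewrite ComplexField.Normc.normc0.
exact: le_trans (le_normcD _ _) (lerD xa yb).
Qed.

Lemma normc_real (x : R) : normc x%:C%C = `|x|.
Proof. by rewrite /= expr0n addr0 sqrtr_sqr. Qed.

Lemma normc_conj (z : C) : normc z^*%C = normc z.
Proof. by case: z => a b /=; rewrite sqrrN. Qed.

Lemma Re_le_normc (z : C) : `|complex.Re z| <= normc z.
Proof.
rewrite -(ler_pXn2r (n := 2)) ?nnegrE ?normc_ge0 // sqr_normcE.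
by rewrite real_normK ?num_real // lerDl sqr_ge0.
Qed.

Lemma Im_le_normc (z : C) : `|complex.Im z| <= normc z.
Proof.
rewrite -(ler_pXn2r (n := 2)) ?nnegrE ?normc_ge0 // sqr_normcE.
by rewrite real_normK ?num_real // lerDr sqr_ge0.
Qed.

Lemma normc_leD (z : C) : normc z <= `|complex.Re z| + `|complex.Im z|.
Proof.
rewrite -(ler_pXn2r (n := 2)) ?nnegrE ?normc_ge0 ?addr_ge0 // sqr_normcE.
rewrite sqrrD !real_normK ?num_real // -addrA [_ *+ 2 + _]addrC addrA lerDl.
by rewrite mulrn_wge0 // mulr_ge0.
Qed.

Lemma normc_sub (x y : C) : normc (x - y) <= normc x + normc y.
Proof. by rewrite -(normcN y); exact: le_normcD. Qed.

Lemma normc_nat (n : nat) : normc (n%:R : C) = n%:R.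
Proof. by rewrite (normcMn 1) ComplexField.Normc.normc1. Qed.

Lemma expiD (m n : int) (x : R) : expi (m + n) x = expi m x * expi n x.
Proof.
rewrite /expi intrD mulrDl cosD sinD; apply/eqP; rewrite eq_complex /=.
by apply/andP; split; apply/eqP; ring.
Qed.

Lemma expi_add (n : int) (x y : R) : expi n (x + y) = expi n x * expi n y.
Proof.
rewrite /expi mulrDr cosD sinD; apply/eqP; rewrite eq_complex /=.
by apply/andP; split; apply/eqP; ring.
Qed.

Lemma expi0 (x : R) : expi 0 x = 1.
Proof. by rewrite /expi mul0r cos0 sin0. Qed.

Lemma expi_at0 (n : int) : expi n (0 : R) = 1.
Proof. by rewrite /expi mulr0 cos0 sin0. Qed.

Lemma expi_conj (n : int) (x : R) : (expi n x)^*%C = expi (- n) x.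
Proof. by rewrite /expi /= rmorphN mulNr cosN sinN. Qed.

Lemma expi_opp (n : int) (x : R) : expi n (- x) = expi (- n) x.
Proof. by rewrite /expi rmorphN mulNr mulrN. Qed.

Lemma normc_expi (n : int) (x : R) : normc (expi n x) = 1.
Proof. by rewrite /= cos2Dsin2 sqrtr1. Qed.

Lemma expi_prodM (n : int) (x : R) : expi n x * expi (- n) x = 1.
Proof. by rewrite -expiD subrr expi0. Qed.

Lemma expiMn (n : int) (x : R) (j : nat) : expi n (x *+ j) = expi n x ^+ j.
Proof. by elim: j => [|j ih]; rewrite ?mulr0n ?expi_at0 // mulrS expi_add ih exprS. Qed.

Lemma expi_2pi (n : int) : expi n (2 * pi : R) = 1.
Proof.
have h (k : nat) : expi k (2 * pi : R) = 1.
  rewrite /expi -[k%:~R]/(k%:R) mulr_natl [2 * pi]mulr_natl -[_ *+ k]add0r.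
  by rewrite (periodicn (@cosD2pi _)) (periodicn (@sinD2pi _)) cos0 sin0.
case: n => k; first exact: h.
by rewrite NegzE -expi_conj h conjc1.
Qed.

Lemma expiD2pi (n : int) (x : R) : expi n (x + 2 * pi) = expi n x.
Proof. by rewrite expi_add expi_2pi mulr1. Qed.

Lemma cos_lt1 (x : R) : 0 < x < 2 * pi -> cos x < 1.
Proof.
move=> /andP[x0 x2]; have -> : x = (x / 2) *+ 2 by rewrite -mulr_natr mulfVK.
rewrite cos_mulr2n cos2sin2.
suff : 0 < sin (x / 2) by move=> /(exprn_gt0 2); lra.
by apply: sin_gt0_pi; apply/andP; split; lra.
Qed.

Definition grid (M j : nat) : R := (2 * pi / M%:R) *+ j.

(** A geometric sum whose ratio is an M-th root of unity; [|n| < M] keeps its angle strictly inside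
    a full turn, so for nonzero n the ratio is not 1. *)
Lemma sum_expi_grid (M : nat) (n : int) : (0 < M)%N -> (`|n| < M)%N ->
  \sum_(j < M) expi n (grid M j) = (if n == 0 then M%:R else 0) :> C.
Proof.
move=> M0 nM; have [->|n0] := eqVneq n 0.
  by under eq_bigr do rewrite expi0; rewrite sumr_const card_ord.
under eq_bigr do rewrite expiMn.
set z := expi _ _.
have z1 : z - 1 != 0.
  rewrite subr_eq0; apply/eqP => /(congr1 (@complex.Re R)) /= h.
  have : cos (`|n|%:R * (2 * pi / M%:R) : R) < 1.
    have M1 : (0 : R) < M%:R by rewrite ltr0n.
    have P0 : (0 : R) < 2 * pi by rewrite mulr_gt0 ?pi_gt0.
    apply: cos_lt1; rewrite mulrA; apply/andP; split.
      by rewrite divr_gt0 // mulr_gt0 // ltr0n absz_gt0.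
    by rewrite ltr_pdivrMr // [ltRHS]mulrC ltr_pM2r // ltr_nat.
  rewrite natr_absz intr_norm; move: h; rewrite -cos_norm normrM.
  rewrite [`|2 * pi / _|]ger0_norm ?divr_ge0 ?mulr_ge0 ?pi_ge0 //.
  by move=> ->; rewrite ltxx.
apply: (mulfI z1); rewrite mulr0 -subrX1 -expiMn.
suff -> : (2 * pi / M%:R) *+ M = 2 * pi :> R by rewrite expi_2pi subrr.
by rewrite -mulr_natr mulfVK // pnatr_eq0 -lt0n.
Qed.

End complex_exponentials.

(** * Trigonometric polynomials and discrete Fourier analysis *)

Section trigonometric_polynomials.
Variable R : realType.
Local Notation C := R[i].
Local Notation normc := ComplexField.Normc.normc.

(** The frequencies come in the order of [dirichlet], as a duplicate-free list that can be compared
    with the frequency lists of [em_fun]. *)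
Definition zr (D : nat) : seq int := [seq j%:Z - D%:Z | j <- iota 0 (2 * D).+1].

Lemma mem_zr (D : nat) (n : int) : (n \in zr D) = (`|n| <= D)%N.
Proof.
apply/mapP/idP => [[j]|nD]; first by rewrite mem_iota => jD ->; lia.
by exists (absz (n + D%:Z)); [rewrite mem_iota|]; lia.
Qed.

Lemma uniq_zr (D : nat) : uniq (zr D).
Proof. by rewrite map_inj_uniq ?iota_uniq // => i j; lia. Qed.

Lemma size_zr (D : nat) : size (zr D) = (2 * D).+1.
Proof. by rewrite size_map size_iota. Qed.

Lemma sum_uniq_sub (I : eqType) (V : zmodType) (s s' : seq I) (F : I -> V) :
  uniq s -> uniq s' -> {subset s <= s'} ->
  (forall i, i \in s' -> i \notin s -> F i = 0) ->
  \sum_(i <- s') F i = \sum_(i <- s) F i.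
Proof.
move=> us us' ss F0; rewrite (bigID (mem s)) /= [X in _ + X]big1_seq ?addr0.
  rewrite -big_filter; apply: perm_big; apply: uniq_perm => //.
    exact: filter_uniq.
  by move=> i; rewrite mem_filter; case: (boolP (i \in s)) => // /ss ->.
by move=> i /andP[i1 i2]; exact: F0.
Qed.

Lemma sum_zr_widen (V : zmodType) (D D' : nat) (F : int -> V) : (D <= D')%N ->
  (forall n, (D < `|n|)%N -> F n = 0) -> \sum_(n <- zr D') F n = \sum_(n <- zr D) F n.
Proof.
move=> DD' F0; apply: sum_uniq_sub; rewrite ?uniq_zr //.
  by move=> n; rewrite !mem_zr => /leq_trans; apply.
by move=> n _; rewrite mem_zr -ltnNge; exact: F0.
Qed.

Lemma sum_zr_delta (V : zmodType) (D : nat) (F : int -> V) (n : int) :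
  (forall k, (D < `|k|)%N -> F k = 0) -> (forall k, k != n -> F k = 0) ->
  \sum_(k <- zr D) F k = F n.
Proof.
move=> F0 Fn; have [nD|nD] := boolP (n \in zr D).
  by rewrite (bigD1_seq n) ?uniq_zr //= big1 ?addr0.
rewrite big1_seq => [|k /andP[_ kD]]; last by rewrite Fn //; apply: contraNneq nD => <-.
by rewrite F0 // ltnNge -mem_zr.
Qed.

Lemma sum_zr_opp (V : zmodType) (D : nat) (F : int -> V) :
  \sum_(n <- zr D) F (- n) = \sum_(n <- zr D) F n.
Proof.
rewrite -(big_map -%R predT F); apply: perm_big; apply: uniq_perm.
- by rewrite map_inj_uniq ?uniq_zr //; exact: oppr_inj.
- exact: uniq_zr.
move=> n; rewrite mem_zr; apply/mapP/idP => [[k]|nD].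
  by rewrite mem_zr => kD ->; rewrite abszN.
by exists (- n); rewrite ?opprK // mem_zr abszN.
Qed.

(** Coefficients are total functions of the frequency and D merely truncates them; under [bandlim]
    the same c can be summed at any larger degree, so that polynomials of different degrees are
    added without reindexing. *)
Definition tp (D : nat) (c : int -> C) (x : R) : C := \sum_(n <- zr D) c n * expi n x.

Definition bandlim (D : nat) (c : int -> C) := forall n, (D < `|n|)%N -> c n = 0.

Lemma tp_widen D D' c x : (D <= D')%N -> bandlim D c -> tp D' c x = tp D c x.
Proof. by move=> DD' h; apply: sum_zr_widen => // n /h ->; rewrite mul0r. Qed.

Lemma eq_tp D c d x : c =1 d -> tp D c x = tp D d x.
Proof. by move=> h; apply: eq_bigr => n _; rewrite h. Qed.

Lemma tpD D c d x : tp D (fun n => c n + d n) x = tp D c x + tp D d x.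
Proof. by rewrite -big_split; apply: eq_bigr => n _; rewrite mulrDl. Qed.

Lemma tpB D c d x : tp D (fun n => c n - d n) x = tp D c x - tp D d x.
Proof. by rewrite -sumrB; apply: eq_bigr => n _; rewrite mulrBl. Qed.

Lemma tpZ D a c x : tp D (fun n => a * c n) x = a * tp D c x.
Proof. by rewrite /tp mulr_sumr; apply: eq_bigr => n _; rewrite mulrA. Qed.

Lemma tp0 D x : tp D (fun=> 0) x = 0.
Proof. by rewrite /tp big1 // => n _; rewrite mul0r. Qed.

Lemma tp_D2pi D c x : tp D c (x + 2 * pi) = tp D c x.
Proof. by apply: eq_bigr => n _; rewrite expiD2pi. Qed.

Lemma tp_shift D c x h : tp D c (x + h) = tp D (fun n => c n * expi n h) x.
Proof. by apply: eq_bigr => n _; rewrite expi_add mulrAC mulrA. Qed.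

Lemma tp_opp D c x : tp D c (- x) = tp D (fun n => c (- n)) x.
Proof.
rewrite /tp -(sum_zr_opp D (fun n => c n * _)).
by apply: eq_bigr => n _; rewrite expi_opp opprK.
Qed.

Lemma conj_tp D c x : (tp D c x)^*%C = \sum_(n <- zr D) (c n)^*%C * expi (- n) x.
Proof.
by rewrite /tp (rmorph_sum (@conjc R)); apply: eq_bigr => n _; rewrite rmorphM /= -expi_conj.
Qed.

Lemma normc_tp D c x : normc (tp D c x) <= \sum_(n <- zr D) normc (c n).
Proof.
apply: le_trans (normc_sum _ _ _) _; apply: ler_sum => n _.
by rewrite ComplexField.Normc.normcM normc_expi mulr1.
Qed.

Lemma sum_expi_gridB (M : nat) (n : int) (x : R) : (`|n| < M)%N ->
  \sum_(j < M) expi n (x - grid R M j) = (if n == 0 then M%:R else 0).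
Proof.
move=> nM; under eq_bigr do rewrite expi_add expi_opp.
rewrite -mulr_sumr sum_expi_grid ?abszN ?(leq_ltn_trans _ nM) // oppr_eq0.
by case: eqP => [->|_]; rewrite ?mulr0 // expi0 mul1r.
Qed.

(** No aliasing occurs because two frequencies differ by at most 2 D < M. The free offset x is what
    later allows convolutions, and averages over all translates of the grid. *)
Lemma tp_orth (M D : nat) c d x : (2 * D < M)%N ->
  \sum_(j < M) tp D c (x - grid R M j) * (tp D d (x - grid R M j))^*%C =
  M%:R * \sum_(n <- zr D) c n * (d n)^*%C.
Proof.
move=> DM; transitivity (\sum_(n <- zr D) \sum_(m <- zr D)
    c n * (d m)^*%C * \sum_(j < M) expi (n - m) (x - grid R M j)).
  under eq_bigr do rewrite conj_tp big_distrlr /=.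
  rewrite exchange_big /=; apply: eq_bigr => n _.
  rewrite exchange_big /=; apply: eq_bigr => m _.
  rewrite mulr_sumr; apply: eq_bigr => j _.
  by rewrite expiD; ring.
rewrite mulr_sumr big_seq [RHS]big_seq; apply: eq_bigr => n nD.
rewrite (bigD1_seq n) ?uniq_zr //= [X in _ + X]big1_seq ?addr0.
  by rewrite sum_expi_gridB ?subrr ?eqxx 1?mulrC //; lia.
move=> m /andP[mn mD]; rewrite sum_expi_gridB.
  by rewrite subr_eq0 eq_sym (negbTE mn) mulr0.
by move: nD mD; rewrite !mem_zr; lia.
Qed.

Lemma tp_parseval (M D : nat) c x : (2 * D < M)%N ->
  \sum_(j < M) normc (tp D c (x - grid R M j)) ^+ 2 =
  M%:R * \sum_(n <- zr D) normc (c n) ^+ 2.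
Proof.
move=> DM; apply: (@complexI R); rewrite rmorphM rmorph_nat !rmorph_sum /=.
under eq_bigr do rewrite sqr_normcC.
by under [in RHS]eq_bigr do rewrite sqr_normcC; rewrite tp_orth.
Qed.

Definition dft (M : nat) (y : nat -> C) (n : int) : C :=
  M%:R^-1 * \sum_(j < M) y j * expi n (- grid R M j).

Lemma natC_neq0 (M : nat) : (0 < M)%N -> (M%:R : C) != 0.
Proof. by rewrite pnatr_eq0 lt0n. Qed.

Lemma dft_tp (M D : nat) c (n : int) : bandlim D c -> (`|n| + D < M)%N ->
  dft M (fun j => tp D c (grid R M j)) n = c n.
Proof.
move=> cD nM; have M0 : (0 < M)%N by exact: leq_ltn_trans nM.
apply: (mulfI (natC_neq0 M0)); rewrite mulrA divff ?natC_neq0 // mul1r.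
under eq_bigr do rewrite mulr_suml.
rewrite exchange_big /=.
transitivity (\sum_(k <- zr D) c k * (if k == n then M%:R else 0)).
  rewrite big_seq [RHS]big_seq; apply: eq_bigr => k; rewrite mem_zr => kD.
  transitivity (c k * \sum_(j < M) expi (k - n) (grid R M j)).
    rewrite mulr_sumr; apply: eq_bigr => j _.
    by rewrite expiD expi_opp mulrA.
  by rewrite sum_expi_grid // ?subr_eq0 //; lia.
rewrite (@sum_zr_delta _ _ _ n) ?eqxx 1?mulrC //.
- by move=> k /cD ->; rewrite mul0r.
- by move=> k /negbTE ->; rewrite mulr0.
Qed.

(** Discrete convolution theorem: a bound for the grid average of a kernel becomes a sup bound for
    the multiplier v. *)
Lemma tp_conv (M L : nat) (y : nat -> C) (v : int -> C) x :
  M%:R^-1 * \sum_(j < M) y j * tp L v (x - grid R M j) =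
  tp L (fun n => v n * dft M y n) x.
Proof.
rewrite /tp /dft; under eq_bigr do rewrite mulr_sumr.
rewrite exchange_big /= mulr_sumr; apply: eq_bigr => n _.
rewrite mulrCA -mulrA; congr (_ * _); rewrite mulr_sumr mulr_suml.
by apply: eq_bigr => j _; rewrite expi_add; ring.
Qed.

Lemma sqr_normcB (a b : C) :
  normc (a - b) ^+ 2 = normc a ^+ 2 + normc b ^+ 2 - 2 * complex.Re (a * b^*%C).
Proof. by rewrite !sqr_normcE; case: a => a1 a2; case: b => b1 b2 /=; ring. Qed.

(** Expand the nonnegative sum of [|y j - T(x_j)|^2], where T is built from the discrete
    coefficients: the cross term and the energy of T coincide. *)
Lemma dft_bessel (M L : nat) (y : nat -> C) : (2 * L < M)%N ->
  M%:R * \sum_(n <- zr L) normc (dft M y n) ^+ 2 <= \sum_(j < M) normc (y j) ^+ 2.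
Proof.
move=> LM; have M0 : (0 < M)%N by exact: leq_ltn_trans LM.
pose T := tp L (dft M y); pose X := \sum_(n <- zr L) normc (dft M y n) ^+ 2.
have : 0 <= \sum_(j < M) normc (y j - T (grid R M j)) ^+ 2.
  by apply: sumr_ge0 => j _; rewrite sqr_ge0.
under eq_bigr do rewrite sqr_normcB.
rewrite sumrB big_split /= -mulr_sumr.
have -> : \sum_(j < M) complex.Re (y j * (T (grid R M j))^*%C) = M%:R * X.
  rewrite -[LHS](raddf_sum (@complex.Re R : Rcomplex R -> R)) -[RHS]/(complex.Re (M%:R * X)%:C%C).
  congr complex.Re; rewrite rmorphM rmorph_nat /X rmorph_sum /= mulr_sumr.
  under eq_bigr do rewrite conj_tp mulr_sumr.
  rewrite exchange_big /=; apply: eq_bigr => n _.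
  rewrite sqr_normcC {2}/dft -mulrA mulVKf ?natC_neq0 // mulr_suml.
  by apply: eq_bigr => j _; rewrite expi_opp; ring.
(* [tp_parseval] samples at [x - grid]; reflecting the coefficients turns this into samples at the
   grid points themselves. *)
have -> : \sum_(j < M) normc (T (grid R M j)) ^+ 2 = M%:R * X.
  rewrite /X -(sum_zr_opp L (fun n => normc (dft M y n) ^+ 2)).
  rewrite -(tp_parseval (fun n => dft M y (- n)) 0 LM).
  by apply: eq_bigr => j _; rewrite -tp_opp sub0r opprK.
rewrite -/X; lra.
Qed.

End trigonometric_polynomials.

(** * The de la Vallee-Poussin kernel and its uniform boundedness *)

Section vallee_poussin_kernel.
Variable R : realType.
Local Notation C := R[i].
Local Notation normc := ComplexField.Normc.normc.

Lemma dirichletE k (x : R) : dirichlet k x = \sum_(n <- zr k) expi n x.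
Proof. by rewrite /dirichlet big_map -[(2 * k).+1 in RHS]subn0 -/(index_iota 0 _) big_mkord. Qed.

(** The trapezoidal multiplier of the kernel: 1 up to l, then linear down to 0 at 2 l. The real
    version carries the inequalities, [vc] is its complex copy. *)
Definition vcr (l : nat) (n : int) : R :=
  l%:R^-1 * \sum_(l <= k < 2 * l) (`|n| <= k)%N%:R.

Definition vc (l : nat) (n : int) : C := (vcr l n)%:C%C.

Lemma vcr_ge0 l n : 0 <= vcr l n.
Proof. by rewrite mulr_ge0 ?invr_ge0 ?ler0n // sumr_ge0. Qed.

Lemma vcr_le1 l n : vcr l n <= 1.
Proof.
have [->|l0] := posnP l; first by rewrite /vcr invr0 mul0r.
rewrite /vcr mulrC ler_pdivrMr ?ltr0n // mul1r.
have le1 : \sum_(l <= k < 2 * l) ((`|n| <= k)%N%:R : R) <= \sum_(l <= k < 2 * l) 1.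
  by apply: ler_sum => k _; case: (_ <= _)%N.
by apply: le_trans le1 _; rewrite sumr_const_nat ler_nat; lia.
Qed.

Lemma vcr_eq1 l n : (0 < l)%N -> (`|n| <= l)%N -> vcr l n = 1.
Proof.
move=> l0 nl; rewrite /vcr.
rewrite (eq_big_nat _ _ (F2 := fun=> 1)) => [|k /andP[lk _]]; last by rewrite (leq_trans nl).
rewrite sumr_const_nat (_ : (2 * l - l = l)%N); last lia.
by rewrite mulVf // pnatr_eq0 -lt0n.
Qed.

Lemma vcr_eq0 l n : (2 * l <= `|n|)%N -> vcr l n = 0.
Proof.
move=> nl; rewrite /vcr big_nat big1 ?mulr0 // => k /andP[_ kl].
by rewrite leqNgt (leq_trans kl nl).
Qed.

Lemma vcr_ge_half l n : (0 < l)%N -> (2 * `|n| <= 3 * l)%N -> 2^-1 <= vcr l n.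
Proof.
move=> l0 nl; have [nl1|nl1] := leqP `|n| l; first by rewrite vcr_eq1 //; lra.
rewrite /vcr (big_cat_nat _ (n := `|n|%N)) /=; [|lia|lia].
rewrite [X in _ + X](eq_big_nat _ _ (F2 := fun=> 1)) => [|k /andP[-> _] //].
rewrite sumr_const_nat mulrC ler_pdivlMr ?ltr0n //.
apply: ler_wpDl; first by rewrite sumr_ge0.
rewrite natrB; last lia.
have : (2 * `|n|)%:R <= (3 * l)%:R :> R by rewrite ler_nat.
by rewrite !natrM; lra.
Qed.

Lemma bandlim_vc l : bandlim (2 * l) (vc l).
Proof. by move=> n nl; rewrite /vc vcr_eq0 // ltnW. Qed.

Lemma vallee_poussinE l x : vallee_poussin l x = tp (2 * l) (vc l) x.
Proof.
rewrite /vallee_poussin /tp.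
transitivity (l%:R^-1 * \sum_(l <= k < 2 * l) \sum_(n <- zr (2 * l))
   (`|n| <= k)%N%:R * expi n x : C).
  congr (_ * _); apply: eq_big_nat => k /andP[_ kl]; rewrite dirichletE.
  rewrite (@sum_zr_widen _ k (2 * l)) ?(ltnW kl) //.
    by rewrite big_seq [RHS]big_seq; apply: eq_bigr => n; rewrite mem_zr => ->; rewrite mul1r.
  by move=> n; rewrite ltnNge => /negbTE ->; rewrite mul0r.
rewrite exchange_big /= mulr_sumr; apply: eq_bigr => n _.
rewrite -mulr_suml mulrA; congr (_ * _).
rewrite /vc /vcr rmorphM /= fmorphV rmorph_nat rmorph_sum /=; congr (_ * _).
by apply: eq_bigr => k _; rewrite rmorph_nat.
Qed.

Local Arguments expi : simpl never.

(** The one-sided sum whose squared modulus is N times the Fejer kernel. *)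
Definition G (N : nat) (x : R) : C := \sum_(j < N) expi j x.

Lemma conj_G N x : (G N x)^*%C = \sum_(j < N) expi (- j%:Z) x.
Proof.
by rewrite /G (rmorph_sum (@conjc R)); apply: eq_bigr => j _; rewrite -expi_conj.
Qed.

(** Passing from N to N + 1, the expansion of the squared modulus gains each frequency between -N
    and N exactly once, which is [dirichlet N]. *)
Lemma sum_dirichlet N (x : R) : \sum_(k < N) dirichlet k x = (normc (G N x) ^+ 2)%:C%C.
Proof.
elim: N => [|N ih].
  by rewrite /G !big_ord0 ComplexField.Normc.normc0 expr0n.
rewrite big_ord_recr /= ih !sqr_normcC /G big_ord_recr /= -/(G N x).
have -> : (G N x + expi N x)^*%C = (G N x)^*%C + expi (- N%:Z) x.
  by rewrite -expi_conj; exact: (rmorphD (@conjc R)).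
rewrite mulrDl !mulrDr expi_prodM -!addrA; congr (_ + _).
rewrite addrA conj_G mulr_suml mulr_sumr.
rewrite /dirichlet -(big_mkord predT (fun j => expi (j%:Z - N%:Z) x)).
rewrite (big_cat_nat _ (n := N)) //=; [|lia].
rewrite big_nat_recl; [|lia].
rewrite subrr expi0 [1 + _]addrC addrA; congr (_ + _ + _).
  by rewrite big_mkord; apply: eq_bigr => j _; rewrite -expiD.
rewrite -(big_mkord predT (fun j => expi N x * expi (- j%:Z) x)) big_nat_rev /=.
rewrite -{1}[N]add0n big_addn (_ : (2 * N - N = N)%N); last lia.
apply: eq_big_nat => j jN; rewrite -expiD.
by congr expi; lia.
Qed.

Lemma sum_zr_nat (V : zmodType) (N : nat) (F : int -> V) :
  \sum_(n <- zr N) (if (0 <= n < N%:Z) then F n else 0) = \sum_(j < N) F j.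
Proof.
rewrite -(big_mkord predT (fun j => F j%:Z)) -[RHS](big_map Posz predT F).
rewrite (@sum_uniq_sub _ _ [seq j%:Z | j <- index_iota 0 N]) ?uniq_zr //.
- rewrite !big_map; apply: eq_big_seq => j; rewrite mem_index_iota => /andP[_ jN].
  by rewrite ifT //; lia.
- by rewrite map_inj_uniq ?iota_uniq // => i j; lia.
- by move=> n /mapP[j]; rewrite mem_index_iota mem_zr => jN ->; lia.
move=> n _; apply: contraNeq; case: ifP => [h _|]; last by rewrite eqxx.
by apply/mapP; exists `|n|%N; rewrite ?mem_index_iota; lia.
Qed.

Lemma G_tp N x : G N x = tp N (fun n => if 0 <= n < N%:Z then 1 else 0) x.
Proof.
rewrite /G -(@sum_zr_nat _ N (fun n => expi n x)); apply: eq_bigr => n _.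
by case: ifP; rewrite ?mul1r ?mul0r.
Qed.

Lemma sum_sqr_G (M N : nat) (x : R) : (2 * N < M)%N ->
  \sum_(j < M) normc (G N (x - grid R M j)) ^+ 2 = M%:R * N%:R.
Proof.
move=> NM; under eq_bigr do rewrite G_tp.
rewrite tp_parseval //; congr (_ * _).
transitivity (\sum_(n <- zr N) (if 0 <= n < N%:Z then 1 else 0) : R).
  apply: eq_bigr => n _; case: ifP => _.
    by rewrite ComplexField.Normc.normc1 expr1n.
  by rewrite ComplexField.Normc.normc0 expr0n.
by rewrite sum_zr_nat sumr_const card_ord.
Qed.

Lemma normc_vallee_poussin l x :
  normc (vallee_poussin l x) <= l%:R^-1 * (normc (G (2 * l) x) ^+ 2 + normc (G l x) ^+ 2).
Proof.
rewrite /vallee_poussin ComplexField.Normc.normcM ComplexField.Normc.normcV normc_nat.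
rewrite ler_wpM2l ?invr_ge0 //.
have -> : \sum_(l <= k < 2 * l) dirichlet k x =
    (normc (G (2 * l) x) ^+ 2)%:C%C - (normc (G l x) ^+ 2)%:C%C.
  rewrite -!sum_dirichlet -!(big_mkord predT (fun k => dirichlet k x)).
  by rewrite [in RHS](big_cat_nat _ (n := l)) //=; [rewrite addrAC subrr add0r|lia].
by apply: le_trans (normc_sub _ _) _; rewrite !normc_real !ger0_norm ?sqr_ge0.
Qed.

(** The kernel is the difference of two squared moduli divided by l, and Parseval averages both
    exactly: (2 l + l) / l = 3. All factors 3 in later sup bounds come from here. *)
Lemma sum_normc_vallee_poussin (M l : nat) (x : R) : (0 < l)%N -> (4 * l < M)%N ->
  \sum_(j < M) normc (vallee_poussin l (x - grid R M j)) <= 3 * M%:R.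
Proof.
move=> l0 lM.
apply: (@le_trans _ _ (\sum_(j < M) l%:R^-1 * (normc (G (2 * l) (x - grid R M j)) ^+ 2 +
    normc (G l (x - grid R M j)) ^+ 2))).
  by apply: ler_sum => j _; exact: normc_vallee_poussin.
rewrite -mulr_sumr big_split /= !sum_sqr_G; [|lia|lia].
have l1 : (l%:R : R) != 0 by rewrite pnatr_eq0 -lt0n.
rewrite natrM (_ : _ * _ = 3 * M%:R) //; field.
by rewrite l1.
Qed.

(* The sup bound is proved by discretising the convolution on a grid finer than
   twice the degree, where it is exact. *)
Lemma vp_bounded (D l : nat) (c : int -> C) (B : R) : (0 < l)%N -> bandlim D c ->
  (forall x, normc (tp D c x) <= B) ->
  forall x, normc (tp D (fun n => vc l n * c n) x) <= 3 * B.
Proof.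
(* M exceeds L + D, so that the samples determine c up to frequency L, and 4 l, as the average of
   the kernel requires. *)
move=> l0 cD cB x; pose L := (2 * l)%N; pose M := (2 * L + D).+1.
have cL : bandlim (minn D L) (fun n => vc l n * c n).
  move=> n; rewrite /minn; case: ifP => _ nD; first by rewrite cD ?mulr0.
  by rewrite (@bandlim_vc l n nD) mul0r.
rewrite (tp_widen _ (geq_minl D L) cL) -(tp_widen _ (geq_minr D L) cL).
have -> : tp L (fun n => vc l n * c n) x =
    M%:R^-1 * \sum_(j < M) tp D c (grid R M j) * vallee_poussin l (x - grid R M j).
  under [in RHS]eq_bigr do rewrite vallee_poussinE.
  rewrite (tp_conv M L (fun j => tp D c (grid R M j)) (vc l) x) /tp.
  rewrite big_seq [RHS]big_seq; apply: eq_bigr => n; rewrite mem_zr => nL.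
  by rewrite dft_tp // /M; lia.
have B0 : 0 <= B by apply: le_trans (cB 0); exact: normc_ge0.
rewrite ComplexField.Normc.normcM ComplexField.Normc.normcV normc_nat.
rewrite mulrC ler_pdivrMr ?ltr0n //.
apply: le_trans (normc_sum _ _ _) _.
apply: (@le_trans _ _ (\sum_(j < M) B * normc (vallee_poussin l (x - grid R M j)))).
  by apply: ler_sum => j _; rewrite ComplexField.Normc.normcM ler_wpM2r ?normc_ge0.
rewrite -mulr_sumr mulrAC mulrC ler_wpM2r //.
by apply: sum_normc_vallee_poussin => //; rewrite /M /L; lia.
Qed.

End vallee_poussin_kernel.

(** * Derandomised choice of indices *)

Section selection.
Variable R : realType.
Local Notation C := R[i].
Local Notation normc := ComplexField.Normc.normc.
Local Arguments expi : simpl never.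

(** Combine e^x <= 1 / (1 - x) with (1 - x)(1 + x + 2 x^2) = 1 + x^2 (1 - 2 x). *)
Lemma expR_le_quad (x : R) : x <= 2^-1 -> expR x <= 1 + x + 2 * x ^+ 2.
Proof.
move=> x2; have h := expR_ge1Dx (- x); have x1 : 0 < 1 - x by lra.
have {h} : (1 - x) * expR x <= 1.
  by rewrite -[leRHS](expRxMexpNx_1 x) [leRHS]mulrC ler_wpM2r ?expR_ge0.
rewrite mulrC -ler_pdivlMr // => /le_trans; apply; rewrite ler_pdivrMr //.
have := sqr_ge0 x; nra.
Qed.

Lemma exists_le_mean (I : eqType) (s : seq I) (w F : I -> R) (X : R) :
  {in s, forall i, 0 <= w i} -> \sum_(i <- s) w i = 1 ->
  \sum_(i <- s) w i * F i <= X -> exists2 i, i \in s & F i <= X.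
Proof.
move=> w0 w1 wX; apply: contrapT => h.
have h' i : i \in s -> X < F i.
  by move=> si; rewrite ltNge; apply/negP => FX; apply: h; exists i.
have [i si wi] : exists2 i, i \in s & 0 < w i.
  apply: contrapT => h2; suff : \sum_(i <- s) w i = 0 :> R by rewrite w1; lra.
  rewrite big1_seq // => i /andP[_ si]; apply/eqP.
  rewrite eq_le w0 // andbT leNgt; apply/negP => wi; apply: h2; by exists i.
have : 0 < \sum_(i <- s) w i * (F i - X).
  rewrite (perm_big _ (perm_to_rem si)) big_cons /=; apply: ltr_pwDl.
    by rewrite mulr_gt0 // subr_gt0 h'.
  rewrite big_seq sumr_ge0 // => j /mem_rem sj.
  by rewrite mulr_ge0 ?w0 // subr_ge0 ltW // h'.
under eq_bigr do rewrite mulrBr.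
by rewrite sumrB -mulr_suml w1 mul1r; lra.
Qed.

(* Derandomised sampling: each new index is chosen so that the exponential
   potential does not exceed its mean. *)
Lemma greedy_selection (I : eqType) (s : seq I) (w : I -> R) (J : finType)
    (y : I -> J -> R) (lam : R) (m : nat) :
  {in s, forall i, 0 <= w i} -> \sum_(i <- s) w i = 1 ->
  {in s, forall i j, `|y i j| <= 1} ->
  (forall j, \sum_(i <- s) w i * y i j = 0) -> 0 <= lam <= 2^-1 ->
  exists t : seq I, [/\ size t = m, {subset t <= s} &
    \sum_j expR (lam * \sum_(i <- t) y i j) <= #|J|%:R * (1 + 2 * lam ^+ 2) ^+ m].
Proof.
move=> w0 w1 y1 wy /andP[lam0 lam1]; elim: m => [|m [t [tm ts ht]]].
  exists [::]; split=> //; rewrite expr0 mulr1.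
  under eq_bigr do rewrite big_nil mulr0 expR0.
  by rewrite sumr_const.
pose S j := \sum_(i <- t) y i j.
pose X := (1 + 2 * lam ^+ 2) * \sum_j expR (lam * S j).
have [i si iX] : exists2 i, i \in s & \sum_j expR (lam * (y i j + S j)) <= X.
  apply: (exists_le_mean w0 w1).
  (* The factor [expR (lam * y i j)] is at most [1 + lam * y i j + 2 * lam ^+ 2]; its linear term
     drops out in the mean by [wy]. *)
  apply: (@le_trans _ _ (\sum_(i <- s) \sum_j expR (lam * S j) *
      (w i * (1 + 2 * lam ^+ 2) + lam * (w i * y i j)))).
    rewrite big_seq [leRHS]big_seq; apply: ler_sum => i si.
    rewrite mulr_sumr; apply: ler_sum => j _.
    rewrite mulrDr expRD [expR (lam * S j) * _]mulrC mulrA ler_wpM2r ?expR_ge0 //.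
    have -> : w i * (1 + 2 * lam ^+ 2) + lam * (w i * y i j) =
      w i * (1 + lam * y i j + 2 * lam ^+ 2) by ring.
    rewrite ler_wpM2l ?w0 //.
    have := y1 i si j; rewrite ler_norml => /andP[ya yb].
    apply: le_trans (expR_le_quad _) _; first nra.
    rewrite lerD2l ler_wpM2l // exprMn ler_piMr ?sqr_ge0 //.
    nra.
  rewrite exchange_big /= /X mulr_sumr; apply: ler_sum => j _.
  rewrite -mulr_sumr big_split /= -mulr_suml w1 mul1r -mulr_sumr wy mulr0 addr0.
  by rewrite mulrC.
exists (i :: t); split=> /=; first by rewrite tm.
  by move=> k; rewrite inE => /orP[/eqP -> //|/ts].
under eq_bigr do rewrite big_cons.
apply: le_trans iX _; rewrite exprS mulrCA ler_wpM2l //.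
by have := sqr_ge0 lam; lra.
Qed.

Lemma sqr_sum_le (I : Type) (s : seq I) (a : I -> R) :
  (\sum_(i <- s) a i) ^+ 2 <= (size s)%:R * \sum_(i <- s) a i ^+ 2.
Proof.
have [s0|s0] := posnP (size s).
  by rewrite s0 mul0r (size0nil s0) big_nil expr0n.
have [A eA] : exists A, A = \sum_(i <- s) a i by eexists.
rewrite -eA; set n : R := (size s)%:R.
have n0 : 0 < n by rewrite ltr0n.
have : 0 <= \sum_(i <- s) (n * a i - A) ^+ 2 by apply: sumr_ge0 => i _; rewrite sqr_ge0.
have -> : \sum_(i <- s) (n * a i - A) ^+ 2 =
    n ^+ 2 * (\sum_(i <- s) a i ^+ 2) - 2 * n * A * A + n * A ^+ 2.
  have -> : 2 * n * A * A = \sum_(i <- s) 2 * n * A * a i by rewrite -mulr_sumr -eA.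
  rewrite mulr_sumr -sumrB.
  have -> : n * A ^+ 2 = \sum_(i <- s) A ^+ 2.
    by rewrite big_const_seq count_predT iter_addr_0 mulr_natl.
  rewrite -big_split /=; apply: eq_bigr => i _. ring.
move=> h; rewrite -subr_ge0 -(pmulr_rge0 _ n0); nra.
Qed.

Lemma sqr_l1_le (D : nat) (c : int -> C) :
  (\sum_(n <- zr D) normc (c n)) ^+ 2 <= (2 * D).+1%:R * \sum_(n <- zr D) normc (c n) ^+ 2.
Proof. by rewrite -size_zr; exact: sqr_sum_le. Qed.

End selection.

(** * One round of sparse approximation on a grid *)

Section sampling_step.
Variable R : realType.
Local Notation C := R[i].
Local Notation normc := ComplexField.Normc.normc.
Local Arguments expi : simpl never.

(** Trades the square of a large grid value for the exponential moment that the selection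
    controls. *)
Lemma sqr_le_expR (x : R) : 0 <= x -> x ^+ 2 <= 64 * expR (x / 4).
Proof.
move=> x0; have -> : x / 4 = x / 8 + x / 8 by lra.
rewrite expRD; have h := expR_ge1Dx (x / 8).
have h2 : (1 + x / 8) * (1 + x / 8) <= expR (x / 8) * expR (x / 8).
  by apply: ler_pM => //; lra.
nra.
Qed.

Definition part (b : bool) (z : C) : R := if b then complex.Re z else complex.Im z.

Lemma part_sum (b : bool) (I : Type) (s : seq I) (F : I -> C) :
  part b (\sum_(i <- s) F i) = \sum_(i <- s) part b (F i).
Proof.
case: b; first exact: (raddf_sum (@complex.Re R : Rcomplex R -> R)).
exact: (raddf_sum (@complex.Im R : Rcomplex R -> R)).
Qed.

Lemma part_le_normc (b : bool) (z : C) : `|part b z| <= normc z.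
Proof. by case: b; [exact: Re_le_normc|exact: Im_le_normc]. Qed.

Lemma part_realM (b : bool) (a : R) (z : C) : part b (a%:C%C * z) = a * part b z.
Proof. by case: b; case: z => u v /=; rewrite mul0r ?subr0 ?addr0. Qed.

(** The exponential potential needs real quantities. The four functionals Re, Im and their negatives
    suffice, as the larger of the two parts has at least half of the modulus. *)
Lemma part_ge_half (z : C) : exists b : bool * bool,
  normc z / 2 <= (-1) ^+ b.2 * part b.1 z.
Proof.
have h := normc_leD z.
have aux (x : R) : exists b : bool, (-1) ^+ b * x = `|x|.
  by exists (x < 0); rewrite -normrEsign.
have [le|le] := leP `|complex.Re z| `|complex.Im z|.
  by have [b hb] := aux (complex.Im z); exists (false, b); rewrite /= hb; lra.
by have [b hb] := aux (complex.Re z); exists (true, b); rewrite /= hb; lra.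
Qed.

Lemma expR_half_le2 (m : nat) : (0 < m)%N ->
  (1 + (2 * m%:R)^-1 : R) ^+ m <= 2.
Proof.
move=> m0; have m1 : (m%:R : R) != 0 by rewrite pnatr_eq0 -lt0n.
apply: (@le_trans _ _ (expR (2 * m%:R)^-1 ^+ m)).
  have h : 0 <= (2 * m%:R : R)^-1 by rewrite invr_ge0 mulr_ge0.
  by apply: lerXn2r; rewrite ?nnegrE ?expR_ge0 ?expR_ge1Dx //; lra.
rewrite -expRM_natl (_ : m%:R * (2 * m%:R)^-1 = 2^-1 :> R); last by field.
by apply: le_trans (expR_le_quad _) _; lra.
Qed.

Lemma dftB (M : nat) (y z : nat -> C) n :
  dft M (fun j => y j - z j) n = dft M y n - dft M z n.
Proof.
rewrite /dft -mulrBr -sumrB; congr (_ * _).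
by apply: eq_bigr => j _; rewrite mulrBl.
Qed.

(** De la Vallee-Poussin interpolation of arbitrary grid data is bounded in the sup norm, although
    the data come from no polynomial. *)
Lemma interp_bounded (M l : nat) (y : nat -> C) (B : R) : (0 < l)%N -> (4 * l < M)%N ->
  (forall j, normc (y j) <= B) ->
  forall x, normc (tp (2 * l) (fun n => vc R l n * dft M y n) x) <= 3 * B.
Proof.
move=> l0 lM yB x; rewrite -tp_conv; under eq_bigr do rewrite -vallee_poussinE.
have B0 : 0 <= B by apply: le_trans (yB 0); exact: normc_ge0.
rewrite ComplexField.Normc.normcM ComplexField.Normc.normcV normc_nat.
rewrite mulrC ler_pdivrMr ?ltr0n //; last lia.
apply: le_trans (normc_sum _ _ _) _.
apply: (@le_trans _ _ (\sum_(j < M) B * normc (vallee_poussin l (x - grid R M j)))).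
  by apply: ler_sum => j _; rewrite ComplexField.Normc.normcM ler_wpM2r ?normc_ge0.
rewrite -mulr_sumr mulrAC mulrC ler_wpM2r //.
exact: sum_normc_vallee_poussin.
Qed.

Section sampling.
Variables (D m : nat) (c : int -> C) (K A : R).
Hypotheses (D0 : (0 < D)%N) (m0 : (0 < m)%N) (cD : bandlim D c) (K0 : 0 <= K).
Hypothesis AE : A = \sum_(n <- zr D) normc (c n).
Hypothesis A0 : 0 < A.
Let M := (4 * D).+1.
Let ph k : C := c k / (normc (c k))%:C%C.
(** Maurey's device: if k is drawn with probability [|c k| / A], the exponential [A * ph k * expi k]
    has mean [tp D c]. [Y] is the deviation from this mean, divided by 2 A to have modulus at most
    1. *)
Let Y k x : C := ((2 * A)^-1)%:C%C * (tp D c x - A%:C%C * ph k * expi k x).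
Variable sm : R.
Hypothesis smE : sm = Num.sqrt m%:R.
(** With this value 2 lam^2 = 1 / (2 m), so m selections multiply the potential by at most 2. *)
Local Notation lam := ((2 * sm)^-1).

Let M4 : (4 * D < M)%N. Proof. by []. Qed.

Let M2 : (2 * (2 * D) < M)%N. Proof. by rewrite mulnA. Qed.

Let M3 n : (n <= 2 * D)%N -> (n + D < M)%N.
Proof. by clear => h; rewrite /M; lia. Qed.

Let normc_ph k : normc (ph k) <= 1.
Proof.
rewrite /ph ComplexField.Normc.normcM ComplexField.Normc.normcV normc_real ger0_norm ?normc_ge0 //.
by have [->|h] := eqVneq (normc (c k)) 0; rewrite ?mul0r // divff.
Qed.

Let phE k : (normc (c k))%:C%C * ph k = c k.
Proof.
have [h|h] := eqVneq (normc (c k)) 0.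
  by rewrite h mul0r (ComplexField.Normc.eq0_normc h).
by rewrite /ph mulrCA divff ?mulr1 // (inj_eq (@complexI R)) /=.
Qed.

Let normc_Y k x : normc (Y k x) <= 1.
Proof.
have A0' := A0; have a2 : 0 < 2 * A by rewrite mulr_gt0.
rewrite /Y ComplexField.Normc.normcM normc_real gtr0_norm ?invr_gt0 //.
rewrite mulrC ler_pdivrMr // mul1r; apply: le_trans (normc_sub _ _) _.
have h1 : normc (tp D c x) <= A by rewrite AE; exact: normc_tp.
have h2 : A * normc (ph k) <= A by rewrite ler_piMr ?normc_ph // ltW.
rewrite (ComplexField.Normc.normcM (_ * _)) (ComplexField.Normc.normcM _ (ph k)) normc_real.
by rewrite (gtr0_norm A0) normc_expi mulr1; lra.
Qed.

Let mean_Y x : \sum_(k <- zr D) ((normc (c k) / A)%:C%C * Y k x) = 0.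
Proof.
have A1 : A%:C%C != 0 :> C by rewrite (inj_eq (@complexI R)) /= gt_eqF.
transitivity (\sum_(k <- zr D) ((2 * A)^-1)%:C%C *
    ((normc (c k))%:C%C * (A^-1%:C%C * tp D c x) - c k * expi k x)).
  apply: eq_bigr => k _; rewrite /Y -[X in _ = _ * (_ - X * _)](phE k).
  rewrite (rmorphM (real_complex R) (normc (c k)) A^-1) [_ (A^-1)]fmorphV.
  move: (ph k) (tp D c x) (((2 * A)^-1)%:C)%C => a b d /=; field.
  by rewrite A1.
rewrite -mulr_sumr sumrB -mulr_suml -(rmorph_sum (real_complex R)) -AE mulrA.
by rewrite -rmorphM /= divff ?gt_eqF // rmorph1 mul1r subrr mulr0.
Qed.

Let sm_ge1 : 1 <= sm.
Proof. by rewrite smE -[leLHS]sqrtr1 ler_wsqrtr // ler1n. Qed.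

Let sm2 : sm ^+ 2 = m%:R.
Proof. by rewrite smE sqr_sqrtr. Qed.

Let lamP : 0 <= lam <= 2^-1.
Proof.
have h := sm_ge1; rewrite invr_ge0 mulr_ge0 //=; last lra.
by rewrite lef_pV2 ?posrE; lra.
Qed.

Let y k (j : 'I_M * (bool * bool)) : R :=
  (-1) ^+ j.2.2 * part j.2.1 (Y k (grid R M j.1)).

Let S t x : C := \sum_(k <- t) Y k x.

Let sum_y t j : \sum_(k <- t) y k j =
  (-1) ^+ j.2.2 * part j.2.1 (S t (grid R M j.1)).
Proof.
by rewrite -mulr_sumr /S part_sum.
Qed.

(** The potential runs over 4 M indices, the grid points times the four functionals, and grows at
    most by the factor 2: hence 8 M. *)
Let selection : exists t : seq int, [/\ size t = m, {subset t <= zr D} &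
  \sum_(j < M) expR (normc (S t (grid R M j)) * lam / 2) <= 8 * M%:R].
Proof.
have [] := @greedy_selection R int (zr D) (fun k => normc (c k) / A) _ y lam m.
- by move=> k _; rewrite divr_ge0 ?normc_ge0 // ltW.
- by rewrite -mulr_suml -AE divff // gt_eqF.
- move=> k _ j; rewrite /y normrM normrX normrN1 expr1n mul1r.
  exact: le_trans (part_le_normc _ _) (normc_Y _ _).
- move=> j; rewrite /y; under eq_bigr do rewrite mulrCA -part_realM.
  by rewrite -mulr_sumr -part_sum mean_Y /part /=; case: j.2.1; rewrite mulr0.
- exact: lamP.
move=> t [tm ts ht]; exists t; split => //.
have {ht} : \sum_(j : 'I_M * (bool * bool)) expR (lam * \sum_(i <- t) y i j) <= 8 * M%:R.
  apply: le_trans ht _; rewrite card_prod card_prod card_bool card_ord.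
  have -> : 2 * lam ^+ 2 = (2 * m%:R)^-1.
    by rewrite exprVn exprMn sm2; field; rewrite pnatr_eq0 -lt0n.
  have := expR_half_le2 m0; have : (0 : R) <= M%:R by [].
  rewrite natrM; nra.
apply: le_trans.
rewrite -(pair_bigA _ (fun j b => expR (lam * \sum_(i <- t) y i (j, b)))) /=.
apply: ler_sum => j _; have [b hb] := part_ge_half (S t (grid R M j)).
rewrite (bigD1 b) //=; apply: ler_wpDr; first by apply: sumr_ge0 => b' _; exact: expR_ge0.
rewrite ler_expR sum_y /= mulrAC mulrC ler_wpM2l //; by case/andP: lamP.
Qed.

(** Averaging the selected exponentials leaves the error 2 A / m times the sum of the deviations,
    whose grid values are 4 (A / sm) u. Values with u <= K are interpolated into an error of sup
    norm 3 * 4 K (A / sm); the others are interpolated into [c'], which is handed on to the next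
    round. The constant 8192 is 16 * 64 * 8. *)
Lemma sampling_pos : exists (q c' : int -> C) (Th : seq int),
  [/\ (size Th <= m)%N, forall n, n \notin Th -> q n = 0, bandlim D q, bandlim (2 * D) c' &
    \sum_(n <- zr (2 * D)) normc (c' n) ^+ 2 <= 8192 * (A / sm) ^+ 2 * expR (- (K / 4)) /\
    forall x, normc (tp (2 * D) (fun n => c n - q n - c' n) x) <= 12 * K * (A / sm)].
Proof.
have [t [tm ts ht]] := selection.
have smp : 0 < sm by apply: lt_le_trans sm_ge1.
have mC : (m%:R : C) != 0 by exact: natC_neq0.
have AC : A%:C%C != 0 :> C by rewrite (inj_eq (@complexI R)) /= gt_eqF.
pose q n : C := (A / m%:R)%:C%C * \sum_(k <- t) (if k == n then ph k else 0).
have qt n : n \notin t -> q n = 0.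
  move=> nt; rewrite /q big1_seq ?mulr0 // => k /andP[_ kt].
  by case: eqP => // kn; rewrite -kn kt in nt.
have qD : bandlim D q.
  by move=> n nD; apply: qt; apply: contraL nD => /ts; rewrite mem_zr -leqNgt.
pose E x := tp D (fun n => c n - q n) x.
have ES x : E x = (2 * A / m%:R)%:C%C * S t x.
  have -> : S t x = ((2 * A)^-1)%:C%C * (m%:R * tp D c x -
      A%:C%C * \sum_(k <- t) ph k * expi k x).
    rewrite /S /Y -mulr_sumr sumrB big_const_seq count_predT tm iter_addr_0.
    congr (_ * (_ - _)); first by rewrite mulr_natl.
    by rewrite mulr_sumr; apply: eq_bigr => k _; rewrite mulrA.
  have -> : E x = tp D c x - (A / m%:R)%:C%C * \sum_(k <- t) ph k * expi k x.
    rewrite /E tpB tpZ; congr (_ - _ * _); rewrite /tp.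
    under eq_bigr do rewrite mulr_suml.
    rewrite exchange_big /= big_seq [RHS]big_seq; apply: eq_bigr => k kt.
    rewrite (@sum_zr_delta _ _ _ k) ?eqxx // => n nk.
      case: eqP => [kn|]; last by rewrite mul0r.
      by have := ts _ kt; rewrite mem_zr leqNgt kn nk.
    by rewrite eq_sym (negbTE nk) mul0r.
  rewrite mulrA -rmorphM /= !rmorphM !fmorphV /= !rmorphM !rmorph_nat.
  by field; rewrite AC mC.
pose u j := normc (S t (grid R M j)) * lam.
have u0 j : 0 <= u j by rewrite mulr_ge0 ?normc_ge0 //; case/andP: lamP.
have Eu j : normc (E (grid R M j)) = 4 * (A / sm) * u j.
  rewrite ES ComplexField.Normc.normcM normc_real ger0_norm; last first.
    by rewrite divr_ge0 // mulr_ge0 // ltW.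
  by rewrite /u -sm2; field; rewrite gt_eqF.
pose y1 j := if u j <= K then E (grid R M j) else 0.
pose y2 j := E (grid R M j) - y1 j.
pose c' n := vc R D n * dft M y2 n.
have c'D : bandlim (2 * D) c' by move=> n nD; rewrite /c' bandlim_vc ?mul0r.
exists q, c', t; split=> //; first by rewrite tm.
have M0 : (0 : R) < M%:R by rewrite ltr0n.
split.
  have hX : 0 <= 16 * (A / sm) ^+ 2 * (64 * expR (- (K / 4))).
    by apply: mulr_ge0; apply: mulr_ge0; rewrite ?sqr_ge0 ?expR_ge0.
  apply: (@le_trans _ _ (\sum_(n <- zr (2 * D)) normc (dft M y2 n) ^+ 2)).
    apply: ler_sum => n _; rewrite ComplexField.Normc.normcM exprMn ler_piMl ?sqr_ge0 //.
    by rewrite normc_real ger0_norm ?vcr_ge0 // exprn_ile1 ?vcr_ge0 ?vcr_le1.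
  rewrite -(ler_pM2l M0); apply: le_trans (dft_bessel _ M2) _.
  apply: (@le_trans _ _ (\sum_(j < M) 16 * (A / sm) ^+ 2 * (64 * expR (- (K / 4))) *
      expR (u j / 2))).
    apply: ler_sum => j _; rewrite /y2 /y1; case: ifP => [_|/negbT].
      by rewrite subrr ComplexField.Normc.normc0 expr0n /=; apply: mulr_ge0 hX (expR_ge0 _).
    rewrite -ltNge subr0 => Ku; rewrite Eu.
    have -> : (4 * (A / sm) * u j) ^+ 2 = 16 * (A / sm) ^+ 2 * u j ^+ 2 by ring.
    rewrite -[leRHS]mulrA; apply: ler_wpM2l; first by apply: mulr_ge0; rewrite ?sqr_ge0.
    rewrite -mulrA.
    (* Since u > K, the exponent u/4 is at most u/2 - K/4: the moment of order u/2 is available, and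
       the gain [expR (- (K / 4))] is left over. *)
    apply: le_trans (sqr_le_expR (u0 j)) _; rewrite -expRD ler_wpM2l // ler_expR.
    by move: (u j) Ku => a; lra.
  rewrite -mulr_sumr.
  apply: le_trans (ler_wpM2l hX ht) _.
  by rewrite le_eqVlt; apply/orP; left; apply/eqP; ring.
move=> x.
(* The interpolation reproduces polynomials of degree D, hence E; removing [c'] leaves the
   interpolant of the small values. *)
have -> : tp (2 * D) (fun n => c n - q n - c' n) x =
    tp (2 * D) (fun n => vc R D n * dft M y1 n) x.
  rewrite /tp big_seq [RHS]big_seq; apply: eq_bigr => n; rewrite mem_zr => nD.
  congr (_ * _); rewrite /c' /y2 dftB mulrBr dft_tp; last 2 first.
  - by move=> k kD; rewrite cD // qD // subrr.
  - exact: M3.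
  have [nD'|nD'] := leqP `|n| D; first by rewrite /vc vcr_eq1 // mul1r; ring.
  by rewrite cD // qD //; ring.
apply: le_trans (@interp_bounded M D y1 (4 * K * (A / sm)) D0 M4 _ x) _.
- move=> j; rewrite /y1; case: ifP => uK; last first.
    by rewrite ComplexField.Normc.normc0 !mulr_ge0 ?invr_ge0 // ltW.
  by rewrite Eu mulrAC ler_wpM2r ?divr_ge0 ?ler_wpM2l // ltW.
- by rewrite !mulrA (_ : 3 * 4 = 12) //; ring.
Qed.

End sampling.

Lemma sampling (D m : nat) (c : int -> C) (K A : R) :
  (0 < D)%N -> (0 < m)%N -> bandlim D c -> 0 <= K ->
  A = \sum_(n <- zr D) normc (c n) ->
  exists (q c' : int -> C) (Th : seq int),
  [/\ (size Th <= m)%N, forall n, n \notin Th -> q n = 0, bandlim D q, bandlim (2 * D) c' &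
    \sum_(n <- zr (2 * D)) normc (c' n) ^+ 2 <=
      8192 * (A / Num.sqrt m%:R) ^+ 2 * expR (- (K / 4)) /\
    forall x, normc (tp (2 * D) (fun n => c n - q n - c' n) x) <=
      12 * K * (A / Num.sqrt m%:R)].
Proof.
move=> D0 m0 cD K0 AE.
have [A0|] := ltP 0 A; first exact: (sampling_pos D0 m0 cD K0 AE A0 erefl).
move=> A_le0; have A0 : A = 0.
  by apply/eqP; rewrite eq_le A_le0 AE sumr_ge0 // => n _; exact: normc_ge0.
have c0 n : c n = 0.
  have [nD|nD] := leqP `|n| D; last exact: cD.
  apply: ComplexField.Normc.eq0_normc; apply/eqP.
  have /eqP := AE; rewrite A0 eq_sym psumr_eq0; last by move=> k _; exact: normc_ge0.
  by move=> /allP /(_ n); rewrite mem_zr => /(_ nD).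
exists (fun=> 0), (fun=> 0), [::]; split => //; split.
  rewrite big1 => [|n _]; first by rewrite A0 mul0r expr0n /= mulr0 mul0r.
  by rewrite ComplexField.Normc.normc0 expr0n.
move=> x; rewrite A0 mul0r mulr0 (@eq_tp _ _ _ (fun=> 0)) => [|n]; last by rewrite c0 !subr0.
by rewrite tp0 ComplexField.Normc.normc0.
Qed.

End sampling_step.

(** * Iterated sparse approximation of polynomials *)

Section sparse_approximation.
Variable R : realType.
Local Notation C := R[i].
Local Notation normc := ComplexField.Normc.normc.
Local Notation t := (Num.sqrt 2 : R).

Lemma sqrt2_ge1 : 1 <= t.
Proof. by rewrite -[leLHS]sqrtr1 ler_wsqrtr // ler1n. Qed.

Lemma sqrt2_sqr : t ^+ 2 = 2.
Proof. by rewrite sqr_sqrtr. Qed.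

Lemma sqrt2X_ge1 n : 1 <= t ^+ n.
Proof. by rewrite exprn_ege1 // sqrt2_ge1. Qed.

Lemma sqrt2X_sqr n : (t ^+ n) ^+ 2 = (2 ^ n)%:R.
Proof. by rewrite exprAC sqrt2_sqr natrX. Qed.

(** Cauchy-Schwarz over 2 * 2^u + 1 <= 4 * 2^u frequencies. *)
Lemma l1_le_l2 (u : nat) (c : int -> C) (rho : R) : 0 <= rho ->
  \sum_(n <- zr (2 ^ u)) normc (c n) ^+ 2 <= rho ^+ 2 ->
  \sum_(n <- zr (2 ^ u)) normc (c n) <= 2 * t ^+ u * rho.
Proof.
move=> rho0 h; have t0 := sqrt2X_ge1 u.
rewrite -(ler_pXn2r (n := 2)) ?nnegrE //; last 2 first.
- by apply: sumr_ge0 => n _; exact: normc_ge0.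
- by rewrite !mulr_ge0 //; apply: le_trans t0.
apply: le_trans (sqr_l1_le _ _) _; rewrite exprMn; apply: ler_pM => //.
  by apply: sumr_ge0 => n _; rewrite sqr_ge0.
rewrite exprMn sqrt2X_sqr -natrX -natrM ler_nat.
have : (0 < 2 ^ u)%N by rewrite expn_gt0.
lia.
Qed.

(** For the threshold K = 96 (1 + v) the l2 norm of the remainder gains [expR (- (K / 8))], which
    must beat the factor 2^(v/2) of a round uniformly in v. *)
Lemma expRN_small (v : nat) : t ^+ v * expR (- (12 * (1 + v%:R))) <= 4096^-1.
Proof.
have g : expR (- 1) <= (2^-1 : R).
  rewrite expRN lef_pV2 ?posrE ?expR_gt0 //.
  by have := expR_ge1Dx (1 : R); lra.
have g0 := expR_ge0 (- 1 : R).
have -> : - (12 * (1 + v%:R)) = (12 * v.+1)%N%:R * - 1 :> R.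
  by rewrite natrM -(natr1 v); ring.
rewrite expRM_natl exprM; set a := _ ^+ 12.
have a1 : a <= 4096^-1.
  apply: le_trans (_ : 2^-1 ^+ 12 <= _); last by lra.
  by apply: lerXn2r; rewrite ?nnegrE.
have a0 : 0 <= a by rewrite exprn_ge0.
rewrite exprSr mulrA -exprMn.
have t2 : t <= 2 by have := sqrt2_sqr; have := sqrt2_ge1; move: (t) => y; nra.
have ta : t * a <= 1 by apply: le_trans (_ : 2 * 4096^-1 <= _); [apply: ler_pM; rewrite ?sqrtr_ge0|lra].
rewrite -[leRHS]mul1r; apply: ler_pM => //.
  by rewrite exprn_ge0 // mulr_ge0 ?sqrtr_ge0.
by rewrite exprn_ile1 // mulr_ge0 ?sqrtr_ge0.
Qed.

(** Closes the induction below: the sum of the direct error of a round, at most 2304 (1 + v) z, and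
    the error for the remainder, about 1333 (1 + v) z, stays below the constant 5000. *)
Lemma sparse_approx_const (v z e a : R) :
  0 <= v -> 0 <= z -> a <= 2 * z -> e <= 4096^-1 ->
  12 * (96 * (1 + v)) * a + 5000 * 182 * 2 * (3 + v) * e * z <= 5000 * (1 + v) * z.
Proof.
move=> v0 z0 az e1.
have h1 : (1 + v) * a <= (1 + v) * (2 * z) by rewrite ler_wpM2l //; lra.
have h2 : (3 + v) * (e * z) <= (3 + v) * (4096^-1 * z).
  by rewrite ler_wpM2l; [|lra|rewrite ler_wpM2r].
have h3 : 0 <= v * z by rewrite mulr_ge0.
lra.
Qed.

(* The large values left over by the sampling step form a polynomial of twice the
   degree but much smaller energy, to which the statement applies again with half
   as many terms. *)
Lemma sparse_approx (u v : nat) (c : int -> C) (rho : R) :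
  bandlim (2 ^ u) c -> 0 <= rho -> \sum_(n <- zr (2 ^ u)) normc (c n) ^+ 2 <= rho ^+ 2 ->
  exists (q : int -> C) (Th : seq int) (E : nat),
  [/\ (size Th <= if (v <= u)%N then (2 ^ (u - v)).*2 else 0)%N,
      forall n, n \notin Th -> q n = 0, (2 ^ u <= E)%N, bandlim E q &
      forall x, normc (tp E (fun n => c n - q n) x) <= 5000 * (1 + v%:R) * t ^+ v * rho].
Proof.
(* For v > u no exponentials are spent, and the l1 norm of the coefficients is already small
   enough. *)
have base w u' v' c' r : w = (u'.+1 - v')%N -> (w = 0)%N ->
  bandlim (2 ^ u') c' -> 0 <= r -> \sum_(n <- zr (2 ^ u')) normc (c' n) ^+ 2 <= r ^+ 2 ->
  forall x, normc (tp (2 ^ u') c' x) <= 5000 * (1 + v'%:R) * t ^+ v' * r.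
  move=> -> /eqP; rewrite subn_eq0 => uv _ r0 h x.
  apply: le_trans (normc_tp _ _ _) _; apply: le_trans (l1_le_l2 r0 h) _.
  rewrite ler_wpM2r //; apply: ler_pM => //.
  - by have : (0 : R) <= v'%:R by []; lra.
  - by rewrite ler_weXn2l ?sqrt2_ge1 // ltnW.
(* In a round the degree doubles and the budget 2^(u - v) halves, so u grows by 1, v by 2, and u + 1
   - v drops by 1. *)
move: {2}(u.+1 - v)%N (erefl (u.+1 - v)%N) => w; elim: w u v c rho => [|w ih] u v c rho uvw cD rho0 hc.
  exists (fun=> 0), [::], (2 ^ u)%N; split => //.
  move=> x; have := base 0%N u v c rho (esym uvw) erefl cD rho0 hc x.
  by rewrite (@eq_tp _ _ (fun n => c n - 0) c) // => n; rewrite subr0.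
have vu : (v <= u)%N by move: uvw; clear; lia.
have e2 : (u.+2 - v.+2 = w)%N by move: uvw; clear; lia.
have K0 : (0 : R) <= 96 * (1 + v%:R) by have : (0 : R) <= v%:R by []; lra.
have [q1 [c1 [Th1 [sTh1 q1Th q1D c1D [hc1 hB]]]]] :=
  @sampling R (2 ^ u)%N (2 ^ (u - v))%N c _ _ (expn_gt0 2 u) (expn_gt0 2 (u - v)) cD K0 erefl.
have t0 : 0 < t ^+ (u - v) by apply: lt_le_trans (sqrt2X_ge1 _).
have As : (\sum_(n <- zr (2 ^ u)) normc (c n)) / Num.sqrt (2 ^ (u - v))%:R <= 2 * t ^+ v * rho.
  have -> : Num.sqrt (2 ^ (u - v))%:R = t ^+ (u - v).
    by rewrite -sqrt2X_sqr sqrtr_sqr ger0_norm // ltW.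
  rewrite ler_pdivrMr //; apply: le_trans (l1_le_l2 rho0 hc) _.
  have -> : t ^+ u = t ^+ v * t ^+ (u - v) by rewrite -exprD subnKC.
  by rewrite le_eqVlt; apply/orP; left; apply/eqP; ring.
have A0 : 0 <= (\sum_(n <- zr (2 ^ u)) normc (c n)) / Num.sqrt (2 ^ (u - v))%:R.
  by rewrite divr_ge0 ?sqrtr_ge0 // sumr_ge0 // => n _; exact: normc_ge0.
set a := _ / _ in hc1 hB As A0.
(* 182 = 2 * 91, and 91^2 = 8281 covers the constant 8192 of the sampling step. *)
set r1 := 182 * t ^+ v * expR (- (12 * (1 + v%:R))) * rho.
have tv := sqrt2X_ge1 v.
have r10 : 0 <= r1.
  by rewrite /r1 mulr_ge0 // mulr_ge0 ?expR_ge0 // mulr_ge0 //; apply: le_trans tv.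
rewrite -expnS in c1D hc1 hB.
have hc1' : \sum_(n <- zr (2 ^ u.+1)) normc (c1 n) ^+ 2 <= r1 ^+ 2.
  apply: le_trans hc1 _.
  have -> : - (96 * (1 + v%:R) / 4) = - (12 * (1 + v%:R)) + - (12 * (1 + v%:R)) :> R by lra.
  rewrite expRD; set e := expR _.
  have -> : r1 ^+ 2 = 8281 * (2 * t ^+ v * rho) ^+ 2 * (e * e) by rewrite /r1 -/e; ring.
  have : a ^+ 2 <= (2 * t ^+ v * rho) ^+ 2.
    by apply: lerXn2r; rewrite ?nnegrE //; apply: le_trans As.
  have := sqr_ge0 a; move: (a ^+ 2) ((2 * t ^+ v * rho) ^+ 2) => X Y X0 XY.
  apply: ler_wpM2r; [by apply: mulr_ge0; apply: expR_ge0|lra].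
have [q2 [Th2 [E [sTh2 q2Th uE q2E hE]]]] := ih u.+1 v.+2 c1 r1 e2 c1D r10 hc1'.
exists (fun n => q1 n + q2 n), (Th1 ++ Th2), E; split.
(* This round uses 2^(u - v) exponentials and the later ones twice the half of that, together the
   double. *)
- rewrite size_cat vu; apply: leq_trans (leq_add sTh1 sTh2) _.
  have -> : (u.+1 - v.+2 = (u - v).-1)%N by clear; lia.
  case: ifP => uv; last by rewrite addn0 -addnn leq_addr.
  have : (0 < u - v)%N by move: uv; clear; lia.
  by case: (u - v)%N => // d _; rewrite expnS /=; clear; lia.
- by move=> n; rewrite mem_cat negb_or => /andP[/q1Th -> /q2Th ->]; rewrite addr0.
- by apply: leq_trans uE; rewrite leq_exp2l.
- move=> n nE; rewrite q2E // q1D ?addr0 //.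
  by apply: leq_ltn_trans nE; apply: leq_trans uE; rewrite leq_exp2l.
move=> x.
have -> : tp E (fun n => c n - (q1 n + q2 n)) x =
    tp (2 ^ u.+1) (fun n => c n - q1 n - c1 n) x + tp E (fun n => c1 n - q2 n) x.
  rewrite -(tp_widen _ uE) => [|n nu].
    by rewrite -tpD; apply: eq_tp => n; ring.
  rewrite c1D // cD ?q1D ?subrr //; by apply: leq_ltn_trans nu; rewrite leq_exp2l.
apply: le_trans (le_normcD _ _) _; apply: le_trans (lerD (hB x) (hE x)) _.
have v0 : (0 : R) <= v%:R by [].
have -> : 5000 * (1 + v.+2%:R) * t ^+ v.+2 * r1 =
    5000 * 182 * 2 * (3 + v%:R) * (t ^+ v * expR (- (12 * (1 + v%:R)))) * (t ^+ v * rho).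
  rewrite -[v.+2]addn2 natrD exprD sqrt2_sqr /r1; ring.
have -> : 5000 * (1 + v%:R) * t ^+ v * rho = 5000 * (1 + v%:R) * (t ^+ v * rho).
  by rewrite !mulrA.
apply: sparse_approx_const => //; last exact: expRN_small.
  by rewrite mulr_ge0 // exprn_ge0 // sqrtr_ge0.
by rewrite mulrA.
Qed.

End sparse_approximation.
Local Open Scope classical_set_scope.

(** * Invariance of the torus integral under shifts and reflection *)

Section torus_integral.
Variable R : realType.
Local Notation leb := (@lebesgue_measure R).
Local Notation mu := (@torus_measure R).
Local Notation T2pi := (`[0%R, (2 * pi)%R[ : set R).

Lemma pi2_gt0 : 0 < 2 * pi :> R.
Proof. by rewrite mulr_gt0 ?pi_gt0. Qed.

Lemma lebesgue_measure_shift (a : R) (A : set R) : measurable A ->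
  pushforward leb (fun x : R => x + a : measurableTypeR R) A = leb A.
Proof.
move=> mA; apply/esym/lebesgue_measure_unique => //=.
  exact: measurable_funD.
move=> _ _ [[u v]] _ <-; rewrite /pushforward.
have -> : (fun x : R => x + a) @^-1` `]u, v] = `](u - a), (v - a)].
  by apply/seteqP; split => x /=; rewrite !in_itv /= lerBrDr ltrBlDr.
rewrite !lebesgue_measure_itv /= !lte_fin ltrD2r.
by case: ifP => // _; congr (_%:E); rewrite opprB addrC addrA subrK addrC.
Qed.

Lemma ge0_integral_shift (a : R) (D : set R) (g : R -> \bar R) :
  measurable D -> measurable_fun setT g -> (forall x, 0 <= g x)%E ->
  (\int[leb]_(x in D) g x = \int[leb]_(x in (fun x => x + a)%R @^-1` D) g (x + a)%R)%E.
Proof.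
move=> mD mg g0.
have mphi : measurable_fun [set: measurableTypeR R]
    (fun x : measurableTypeR R => (x : R) + a : measurableTypeR R).
  exact: measurable_funD.
have mg' : measurable_fun D g by exact: measurable_funTS.
rewrite -[RHS](ge0_integral_pushforward mphi leb mD mg' (fun y _ => g0 y)).
by apply: eq_measure_integral => //= A mA AS; exact/esym/lebesgue_measure_shift.
Qed.

Lemma ge0_integral_opp (D : set R) (g : R -> \bar R) :
  measurable D -> measurable_fun setT g -> (forall x, 0 <= g x)%E ->
  (\int[leb]_(x in D) g x = \int[leb]_(x in (-%R : R -> R) @^-1` D) g (- x)%R)%E.
Proof.
move=> mD mg g0.
have mphi : measurable_fun [set: measurableTypeR R]
    (-%R : measurableTypeR R -> measurableTypeR R).
  exact: oppr_measurable.
have mg' : measurable_fun D g by exact: measurable_funTS.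
rewrite -[RHS](ge0_integral_pushforward mphi leb mD mg' (fun y _ => g0 y)).
by apply: eq_measure_integral => //= A mA AS; exact/esym/lebesgue_measureN.
Qed.

Lemma integral_mrestr_ge0 (D : set R) (mD : measurable D) (g : R -> \bar R) :
  measurable_fun setT g -> (forall x, 0 <= g x)%E ->
  (\int[mrestr leb mD]_x g x = \int[leb]_(x in D) g x)%E.
Proof.
move=> mg g0; have mDC : measurable (~` D) by exact: measurableC.
have mgD : measurable_fun (D `|` ~` D) (g : measurableTypeR R -> \bar R).
  exact: measurable_funTS.
rewrite -(setUv D) (@ge0_integral_setU _ (measurableTypeR R) _ (mrestr leb mD) _ _ mD mDC _ mgD) //;
  last exact/disj_setPCl.
rewrite [X in (_ + X)%E](_ : _ = 0%E) ?adde0; last first.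
  apply: null_set_integral => //; first exact: measurable_funTS.
  by rewrite /= /mrestr setICl measure0.
by apply: eq_measure_integral => A mA AD; rewrite /= /mrestr setIidl.
Qed.

Lemma ge0_integral_torus (g : R -> \bar R) :
  measurable_fun setT g -> (forall x, 0 <= g x)%E ->
  (\int[mu]_x g x = ((2 * pi)^-1)%:E * \int[leb]_(x in T2pi) g x)%E.
Proof.
by move=> mg g0; rewrite /torus_measure ge0_integral_mscale //= integral_mrestr_ge0.
Qed.

Lemma torus_measureT : mu setT = 1%E.
Proof.
rewrite /torus_measure /mscale /= /mrestr setTI lebesgue_measure_itv /= lte_fin pi2_gt0.
by rewrite oppr0 adde0 -EFinM mulVf // gt_eqF // pi2_gt0.
Qed.

Lemma periodic_int (V : Type) (g : R -> V) (k : int) (x : R) :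
  (forall x, g (x + 2 * pi) = g x) -> g (x + 2 * pi * k%:~R) = g x.
Proof.
move=> gp; have gn (n : nat) y : g (y + 2 * pi * n%:R) = g y.
  elim: n y => [|n ih] y; first by rewrite mulr0 addr0.
  by rewrite -[n.+1%:R]natr1 mulrDr mulr1 addrA gp ih.
case: k => n; first exact: gn.
by rewrite NegzE intrN mulrN -pmulrn -[LHS](gn n.+1) subrK.
Qed.

(** Periodicity reduces to 0 <= a < 2 pi; the window from a to 2 pi + a is then cut at 2 pi and its
    overhang moved back by one period. *)
Lemma ge0_torus_shift (g : R -> \bar R) (a : R) : (forall x, g (x + 2 * pi) = g x) ->
  measurable_fun setT g -> (forall x, 0 <= g x)%E ->
  (\int[mu]_x g (x + a)%R = \int[mu]_x g x)%E.
Proof.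
move=> gp mg g0.
have mga (b : R) : measurable_fun setT (fun x : R => g (x + b)).
  by apply: measurableT_comp => //; exact: measurable_funD.
wlog a0 : a / 0 <= a < 2 * pi => [h|].
  pose k := Num.floor (a / (2 * pi)).
  have ak : a = a - 2 * pi * k%:~R + 2 * pi * k%:~R by rewrite subrK.
  rewrite -(h (a - 2 * pi * k%:~R)).
    by apply: eq_integral => x _; rewrite [in LHS]ak addrA periodic_int.
  have := floor_itv (a / (2 * pi)).
  rewrite -/k ler_pdivlMr ?pi2_gt0 // ltr_pdivrMr ?pi2_gt0 // intrD.
  by move=> /andP[]; have := pi2_gt0; move: (2 * pi) => p p0 h1 h2; apply/andP; split; nra.
rewrite !ge0_integral_torus //; congr (_ * _)%E.
case/andP: a0 => a0 a2.
have eT : T2pi = (fun x => x + a) @^-1` `[a, (2 * pi + a)[.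
  by apply/seteqP; split => x /=; rewrite !in_itv /= lerDr ltrD2r.
rewrite [LHS](_ : _ = \int[leb]_(x in (fun x => x + a)%R @^-1` `[a, (2 * pi + a)%R[) g (x + a)%R)%E;
  last by rewrite -eT.
rewrite -(@ge0_integral_shift a `[a, (2 * pi + a)[ g) //.
have spl (b c d : R) : b <= c -> c <= d ->
   (\int[leb]_(x in `[b, d[) g x = \int[leb]_(x in `[b, c[) g x + \int[leb]_(x in `[c, d[) g x)%E.
  move=> bc cd; rewrite (@itv_bndbnd_setU _ _ (BLeft b) (BLeft c)) //.
  rewrite ge0_integral_setU //; first exact: measurable_funTS.
  apply/disj_setPS => x [] /=; rewrite !in_itv /= => /andP[_ xc] /andP[cx _].
  by move: (lt_le_trans xc cx); rewrite ltxx.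
rewrite (spl a (2 * pi) (2 * pi + a)) ?(ltW a2) ?lerDl //.
rewrite [RHS](spl 0 a (2 * pi)) ?(ltW a2) // addeC; congr (_ + _)%E.
rewrite (@ge0_integral_shift (2 * pi)) //.
have -> : (fun x : R => x + 2 * pi) @^-1` `[(2 * pi), (2 * pi + a)[ = `[0, a[.
  by apply/seteqP; split => x /=; rewrite !in_itv /= lerDr [2 * pi + a]addrC ltrD2r.
by apply: eq_integral => x _; rewrite gp.
Qed.

Lemma ge0_torus_opp (g : R -> \bar R) : (forall x, g (x + 2 * pi) = g x) ->
  measurable_fun setT g -> (forall x, 0 <= g x)%E ->
  (\int[mu]_x g (- x)%R = \int[mu]_x g x)%E.
Proof.
move=> gp mg g0.
have mgo : measurable_fun setT (fun x : R => g (- x)).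
  by apply: measurableT_comp => //; exact: oppr_measurable.
rewrite !ge0_integral_torus //; congr (_ * _)%E.
have eT : T2pi = (-%R : R -> R) @^-1` `](- (2 * pi)), 0].
  by apply/seteqP; split => x /=; rewrite !in_itv /= oppr_le0 ltrN2 andbC.
rewrite [LHS](_ : _ = \int[leb]_(x in (-%R : R -> R) @^-1` `](- (2 * pi))%R, 0%R]) g (- x)%R)%E;
  last by rewrite -eT.
rewrite -(@ge0_integral_opp `](- (2 * pi)), 0] g) //.
rewrite (@ge0_integral_shift (- (2 * pi))) //.
have -> : (fun x : R => x - 2 * pi) @^-1` `](- (2 * pi)), 0] = `]0, (2 * pi)].
  by apply/seteqP; split => x /=; rewrite !in_itv /= subr_le0 ltrDr.
transitivity (\int[leb]_(x in `]0%R, (2 * pi)%R]) g x)%E.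
  by apply: eq_integral => x _; rewrite -[LHS]gp subrK.
rewrite integral_itv_obnd_cbnd; last exact: measurable_funTS.
by rewrite -integral_itv_bndo_bndc //; exact: measurable_funTS.
Qed.

Lemma funepos_torus (f : R -> R) : (forall x, f (x + 2 * pi) = f x) ->
  measurable_fun setT f ->
  [/\ forall x, ((EFin \o f)^\+ (x + 2 * pi)%R = (EFin \o f)^\+ x)%E,
      measurable_fun setT (EFin \o f)^\+%E & forall x, (0 <= (EFin \o f)^\+ x)%E].
Proof.
move=> fp mf; split=> [x||x]; rewrite ?funepos_ge0 //.
  by rewrite !funeposE /= fp.
by apply: measurable_funepos; exact/measurable_EFinP.
Qed.

Lemma funeneg_torus (f : R -> R) : (forall x, f (x + 2 * pi) = f x) ->
  measurable_fun setT f ->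
  [/\ forall x, ((EFin \o f)^\- (x + 2 * pi)%R = (EFin \o f)^\- x)%E,
      measurable_fun setT (EFin \o f)^\-%E & forall x, (0 <= (EFin \o f)^\- x)%E].
Proof.
move=> fp mf; split=> [x||x]; rewrite ?funeneg_ge0 //.
  by rewrite !funenegE /= fp.
by apply: measurable_funeneg; exact/measurable_EFinP.
Qed.

Lemma Rintegral_torus_shift (f : R -> R) (a : R) : (forall x, f (x + 2 * pi) = f x) ->
  measurable_fun setT f -> Rintegral mu setT (fun x => f (x + a)) = Rintegral mu setT f.
Proof.
move=> fp mf; rewrite /Rintegral; congr fine; rewrite [LHS]integralE [RHS]integralE.
have [p1 p2 p3] := funepos_torus fp mf; have [n1 n2 n3] := funeneg_torus fp mf.
rewrite -(ge0_torus_shift a p1 p2 p3) -(ge0_torus_shift a n1 n2 n3).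
by congr (_ - _)%E; apply: eq_integral => x _; rewrite ?funeposE ?funenegE.
Qed.

Lemma Rintegral_torus_opp (f : R -> R) : (forall x, f (x + 2 * pi) = f x) ->
  measurable_fun setT f -> Rintegral mu setT (fun x => f (- x)) = Rintegral mu setT f.
Proof.
move=> fp mf; rewrite /Rintegral; congr fine; rewrite [LHS]integralE [RHS]integralE.
have [p1 p2 p3] := funepos_torus fp mf; have [n1 n2 n3] := funeneg_torus fp mf.
rewrite -(ge0_torus_opp p1 p2 p3) -(ge0_torus_opp n1 n2 n3).
by congr (_ - _)%E; apply: eq_integral => x _; rewrite ?funeposE ?funenegE.
Qed.

End torus_integral.

(** * Fourier coefficients of integrable functions *)

Section fourier_coefficients.
Variable R : realType.
Local Notation C := R[i].
Local Notation normc := ComplexField.Normc.normc.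
Local Notation mu := (@torus_measure R).
Local Arguments expi : simpl never.

Lemma continuous_sqrt : continuous (@Num.sqrt R).
Proof. exact: sqrt_continuous. Qed.

Lemma measurable_normc (f : R -> C) : cmeasurable f -> measurable_fun setT (fun x => normc (f x)).
Proof.
move=> [m1 m2].
have -> : (fun x => normc (f x)) = (fun x => Num.sqrt (complex.Re (f x) ^+ 2 + complex.Im (f x) ^+ 2)).
  by apply/funext => x; case: (f x).
apply: measurableT_comp; first exact: (continuous_measurable_fun continuous_sqrt).
by apply: measurable_funD; exact: measurable_funX.
Qed.

Lemma cmeasurableM (f g : R -> C) : cmeasurable f -> cmeasurable g -> cmeasurable (fun x => f x * g x).
Proof.
move=> [f1 f2] [g1 g2]; split.
  have -> : (fun x => complex.Re (f x * g x)) = (fun x => complex.Re (f x) * complex.Re (g x) -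
     complex.Im (f x) * complex.Im (g x)).
    by apply/funext => x; case: (f x) => ? ?; case: (g x).
  by apply: measurable_funB; exact: measurable_funM.
have -> : (fun x => complex.Im (f x * g x)) = (fun x => complex.Re (f x) * complex.Im (g x) +
     complex.Im (f x) * complex.Re (g x)).
  by apply/funext => x; case: (f x) => ? ?; case: (g x).
by apply: measurable_funD; exact: measurable_funM.
Qed.

Lemma cmeasurableD (f g : R -> C) : cmeasurable f -> cmeasurable g -> cmeasurable (fun x => f x + g x).
Proof.
move=> [f1 f2] [g1 g2]; split.
  have -> : (fun x => complex.Re (f x + g x)) = (fun x => complex.Re (f x) + complex.Re (g x)).
    by apply/funext => x; case: (f x) => ? ?; case: (g x).
  exact: measurable_funD.
have -> : (fun x => complex.Im (f x + g x)) = (fun x => complex.Im (f x) + complex.Im (g x)).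
  by apply/funext => x; case: (f x) => ? ?; case: (g x).
exact: measurable_funD.
Qed.

Lemma cmeasurable_cst (a : C) : cmeasurable (fun _ : R => a).
Proof. by split; exact: measurable_cst. Qed.

Lemma cmeasurable_expi (n : int) : cmeasurable (@expi R n).
Proof.
split; rewrite /expi /=.
  apply: measurableT_comp; first exact: (continuous_measurable_fun (@continuous_cos R)).
  exact: measurable_funM.
apply: measurableT_comp; first exact: (continuous_measurable_fun (@continuous_sin R)).
exact: measurable_funM.
Qed.

Lemma cmeasurable_sum (I : Type) (s : seq I) (f : I -> R -> C) :
  (forall i, cmeasurable (f i)) -> cmeasurable (fun x => \sum_(i <- s) f i x).
Proof.
move=> mf; elim: s => [|i s ih].
  rewrite (_ : (fun _ => _) = (fun=> 0)); first exact: cmeasurable_cst.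
  by apply/funext => x; rewrite big_nil.
rewrite (_ : (fun _ => _) = (fun x => f i x + \sum_(j <- s) f j x)); first exact: cmeasurableD.
by apply/funext => x; rewrite big_cons.
Qed.

Lemma cmeasurable_tp (D : nat) (c : int -> C) : cmeasurable (tp D c).
Proof.
apply: cmeasurable_sum => n; apply: cmeasurableM; first exact: cmeasurable_cst.
exact: cmeasurable_expi.
Qed.

Lemma cmeasurable_shift (f : R -> C) (a : R) : cmeasurable f -> cmeasurable (fun x => f (x + a)).
Proof.
have h : measurable_fun setT (fun x : R => x + a) by exact: measurable_funD.
by move=> [f1 f2]; split; [exact: (measurableT_comp f1 h)|exact: (measurableT_comp f2 h)].
Qed.

Definition cL1 (f : R -> C) :=
  cmeasurable f /\ mu.-integrable setT (EFin \o (fun x => normc (f x))).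

(** Integration by components is the form in which [conv] is defined. *)
Definition cint (f : R -> C) : C :=
  Complex (Rintegral mu setT (fun x => complex.Re (f x)))
          (Rintegral mu setT (fun x => complex.Im (f x))).

Lemma cL1_Re f : cL1 f -> mu.-integrable setT (EFin \o (fun x => complex.Re (f x))).
Proof.
move=> [[f1 f2] fi]; apply: le_integrable fi => //; first exact/measurable_EFinP.
by move=> x _; rewrite /= lee_fin [leRHS]ger0_norm ?normc_ge0 ?Re_le_normc.
Qed.

Lemma cL1_Im f : cL1 f -> mu.-integrable setT (EFin \o (fun x => complex.Im (f x))).
Proof.
move=> [[f1 f2] fi]; apply: le_integrable fi => //; first exact/measurable_EFinP.
by move=> x _; rewrite /= lee_fin [leRHS]ger0_norm ?normc_ge0 ?Im_le_normc.
Qed.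

Lemma cL1D f g : cL1 f -> cL1 g -> cL1 (fun x => f x + g x).
Proof.
move=> [mf fi] [mg gi]; have m := cmeasurableD mf mg; split => //.
have h : mu.-integrable setT ((EFin \o (fun x => normc (f x))) \+ (EFin \o (fun x => normc (g x))))%E.
  exact: integrableD.
apply: le_integrable h => //; first by apply/measurable_EFinP; exact: (measurable_normc m).
move=> x _; rewrite /= lee_fin !ger0_norm ?normc_ge0 ?addr_ge0 ?normc_ge0 //.
exact: le_normcD.
Qed.

Lemma cL1_le f g (B : R) : cL1 f -> cmeasurable g -> (forall x, normc (g x) <= B * normc (f x)) ->
  cL1 g.
Proof.
move=> [mf fi] mg h; split => //.
have h2 : mu.-integrable setT (fun x => B%:E * (normc (f x))%:E)%E by exact: integrableZl.
apply: le_integrable h2 => //; first by apply/measurable_EFinP; exact: (measurable_normc mg).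
move=> x _; rewrite /= lee_fin ger0_norm ?normc_ge0 //.
exact: le_trans (h x) (ler_norm _).
Qed.

Lemma Rintegral_torus_cst (a : R) : Rintegral mu setT (fun=> a) = a.
Proof.
rewrite (Rintegral_cst _ measurableT) [X in _ * fine X](_ : _ = 1%E) ?mulr1 //.
exact: torus_measureT.
Qed.

Lemma cL1_bounded (f : R -> C) (B : R) : cmeasurable f -> (forall x, normc (f x) <= B) -> cL1 f.
Proof.
move=> mf fB; split => //.
have h : mu.-integrable setT (EFin \o cst B).
  apply/integrableP; split; first by apply/measurable_EFinP; exact: measurable_cst.
  rewrite (_ : (fun x => _) = cst `|B|%:E) // integral_cst //.
  by rewrite [X in (_ * X)%E](_ : _ = 1%E) ?mule1 ?ltry //; exact: torus_measureT.
apply: le_integrable h => //; first by apply/measurable_EFinP; exact: (measurable_normc mf).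
move=> x _; rewrite /= lee_fin ger0_norm ?normc_ge0 //.
exact: le_trans (fB x) (ler_norm _).
Qed.

Lemma cL1_tp D c : cL1 (tp D c).
Proof. by apply: cL1_bounded (@normc_tp R D c); exact: cmeasurable_tp. Qed.

Lemma cL1_expi n : cL1 (@expi R n).
Proof. by apply: (@cL1_bounded _ 1) => [|x]; [exact: cmeasurable_expi|rewrite normc_expi]. Qed.

Lemma cL1Mexpi f n : cL1 f -> cL1 (fun x => f x * expi n x).
Proof.
move=> fi; apply: (@cL1_le f _ 1) => // [|x].
  by apply: cmeasurableM; [exact: fi.1|exact: cmeasurable_expi].
by rewrite ComplexField.Normc.normcM normc_expi mulr1 mul1r.
Qed.

Lemma cL1Z (a : C) f : cL1 f -> cL1 (fun x => a * f x).
Proof.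
move=> fi; apply: (@cL1_le f _ (normc a)) => // [|x].
  by apply: cmeasurableM; [exact: cmeasurable_cst|exact: fi.1].
by rewrite ComplexField.Normc.normcM.
Qed.

Lemma cL1_shift f a : periodic2pi f -> cL1 f -> cL1 (fun x => f (x + a)).
Proof.
move=> fp [mf fi]; have mfa := cmeasurable_shift a mf; split => //.
apply/integrableP; split; first by apply/measurable_EFinP; exact: (measurable_normc mfa).
have /integrableP[_ h] := fi; rewrite -(@ge0_torus_shift R _ a) in h => //.
- by move=> x; rewrite /= fp.
- by apply: measurableT_comp => //; apply/measurable_EFinP; exact: (measurable_normc mf).
Qed.

Lemma eq_cint f g : f =1 g -> cint f = cint g.
Proof. by move=> /funext ->. Qed.

Lemma cintD f g : cL1 f -> cL1 g -> cint (fun x => f x + g x) = cint f + cint g.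
Proof.
move=> fi gi; rewrite /cint; apply/eqP; rewrite eq_complex /=.
rewrite -RintegralD ?cL1_Re // -RintegralD ?cL1_Im //; apply/andP.
by split; apply/eqP; apply: eq_Rintegral => x _; case: (f x) => ? ?; case: (g x).
Qed.

Lemma cintZ (a : C) f : cL1 f -> cint (fun x => a * f x) = a * cint f.
Proof.
move=> fi; case: a => a b; rewrite /cint; apply/eqP; rewrite eq_complex /=.
have i1 := cL1_Re fi; have i2 := cL1_Im fi.
have iZ (k : R) g : mu.-integrable setT (EFin \o g) ->
    mu.-integrable setT (EFin \o (fun x => k * g x)).
  by move=> ig; exact: (integrableZl measurableT k ig).
rewrite -!RintegralZl // -RintegralB ?iZ // -RintegralD ?iZ //.
by apply/andP; split; apply/eqP; apply: eq_Rintegral => x _; case: (f x).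
Qed.

Lemma cint_sum (I : Type) (s : seq I) (a : I -> C) (f : I -> R -> C) :
  (forall i, cL1 (f i)) ->
  cL1 (fun x => \sum_(i <- s) a i * f i x) /\
  cint (fun x => \sum_(i <- s) a i * f i x) = \sum_(i <- s) a i * cint (f i).
Proof.
move=> fi; elim: s => [|i s [ih1 ih2]].
  have e : (fun x => \sum_(i <- [::]) a i * f i x) = (fun=> 0).
    by apply/funext => x; rewrite big_nil.
  split; first by rewrite e; apply: (@cL1_bounded _ 0) => [|x];
    [exact: cmeasurable_cst|rewrite ComplexField.Normc.normc0].
  by rewrite e big_nil /cint /= Rintegral_torus_cst.
have e : (fun x => \sum_(j <- i :: s) a j * f j x) =
    (fun x => a i * f i x + \sum_(j <- s) a j * f j x).
  by apply/funext => x; rewrite big_cons.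
rewrite e; split; first by apply: cL1D => //; exact: cL1Z.
by rewrite cintD // ?ih2 ?cintZ // ?big_cons //; exact: cL1Z.
Qed.

Lemma cint_shift f a : periodic2pi f -> cmeasurable f -> cint (fun x => f (x + a)) = cint f.
Proof.
move=> fp [f1 f2]; rewrite /cint.
rewrite (@Rintegral_torus_shift R (fun x => complex.Re (f x))) //; last by move=> x; rewrite fp.
by rewrite (@Rintegral_torus_shift R (fun x => complex.Im (f x))) // => x; rewrite fp.
Qed.

Lemma cint_opp f : periodic2pi f -> cmeasurable f -> cint (fun x => f (- x)) = cint f.
Proof.
move=> fp [f1 f2]; rewrite /cint.
rewrite (@Rintegral_torus_opp R (fun x => complex.Re (f x))) //; last by move=> x; rewrite fp.
by rewrite (@Rintegral_torus_opp R (fun x => complex.Im (f x))) // => x; rewrite fp.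
Qed.

Lemma cint_reflect f a : periodic2pi f -> cmeasurable f -> cint (fun x => f (a - x)) = cint f.
Proof.
move=> fp mf; rewrite -(cint_shift a fp mf) -[RHS]cint_opp.
- by apply: eq_cint => x; rewrite addrC.
- by move=> x; rewrite addrAC fp.
- exact: cmeasurable_shift.
Qed.

(** For n nonzero, translation by pi / n changes the sign of the exponential, so its integral equals
    its own negative. *)
Lemma cint_expi (n : int) : cint (@expi R n) = if n == 0 then 1 else 0.
Proof.
case: eqP => [->|/eqP n0].
  rewrite /cint /expi; under eq_Rintegral do rewrite /= mul0r cos0.
  under [X in Complex _ X]eq_Rintegral do rewrite /= mul0r sin0.
  by rewrite !Rintegral_torus_cst.
have nR : (n%:~R : R) != 0 by rewrite intr_eq0.
have h := @cint_shift (@expi R n) (pi / n%:~R) (fun x => expiD2pi n x) (cmeasurable_expi n).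
have e : expi n (pi / n%:~R) = -1 :> C.
  by rewrite /expi mulrC divfK // cospi sinpi; apply/eqP; rewrite eq_complex /= oppr0 !eqxx.
move: h; under eq_cint do rewrite expi_add mulrC e.
rewrite cintZ; last exact: cL1_expi.
move=> /eqP; rewrite mulN1r eq_sym -subr_eq0 opprK -mulr2n mulrn_eq0 /= => /eqP.
by [].
Qed.

Definition fhat (f : R -> C) (n : int) : C := cint (fun t => f t * expi (- n) t).

(** After the substitution t -> x - t the variable x sits in the kernel, a finite sum of
    exponentials. From here on every block is a polynomial in which f appears only through
    [fhat f]. *)
Lemma VP_tp l f x : periodic2pi f -> cL1 f -> VP l f x = tp (2 * l) (fun n => vc R l n * fhat f n) x.
Proof.
move=> fp fi.
have -> : VP l f x = cint (fun t => (fun s => f s * vallee_poussin l (x - s)) (x - t)).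
  by rewrite /VP /conv /cint; congr Complex; apply: eq_Rintegral => t _ /=; rewrite subKr.
have e : (fun s => f s * vallee_poussin l (x - s)) =
    (fun s => \sum_(n <- zr (2 * l)) (vc R l n * expi n x) * (f s * expi (- n) s)).
  apply/funext => s; rewrite vallee_poussinE /tp mulr_sumr; apply: eq_bigr => n _.
  by rewrite expi_add expi_opp; ring.
have [i1 i2] := cint_sum (zr (2 * l)) (fun n => vc R l n * expi n x)
  (fun n => cL1Mexpi (- n) fi).
rewrite (@cint_reflect (fun s => f s * vallee_poussin l (x - s)) x) e; [|move=> s|exact: i1.1].
  by rewrite i2 /tp; apply: eq_bigr => n _; rewrite -/(fhat f n); ring.
by apply: eq_bigr => n _; rewrite fp expiD2pi.
Qed.

Lemma fhatB_tp f D q n : cL1 f -> bandlim D q ->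
  fhat (fun x => f x - tp D q x) n = fhat f n - q n.
Proof.
move=> fi qD; rewrite /fhat.
have [i1 i2] := cint_sum (zr D) q (fun k => cL1_expi (k - n)).
have -> : (fun t => (f t - tp D q t) * expi (- n) t) =
    (fun t => f t * expi (- n) t + -1 * \sum_(k <- zr D) q k * expi (k - n) t).
  apply/funext => t; rewrite mulrBl mulN1r; congr (_ - _).
  by rewrite /tp mulr_suml; apply: eq_bigr => k _; rewrite expiD mulrA.
rewrite cintD; [|exact: cL1Mexpi|exact: cL1Z].
rewrite cintZ // mulN1r i2; congr (_ - _).
under eq_bigr do rewrite cint_expi.
rewrite (@sum_zr_delta _ _ _ n) ?subrr ?eqxx ?mulr1 //.
- by move=> k /qD ->; rewrite mul0r.
- by move=> k kn; rewrite subr_eq0 (negbTE kn) mulr0.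
Qed.

Lemma fhat_Delta f h n : periodic2pi f -> cL1 f ->
  fhat (Delta h f) n = (expi n h - 1) * fhat f n.
Proof.
move=> fp fi.
have fe : cL1 (fun t => f t * expi (- n) t) by exact: cL1Mexpi.
have fep : periodic2pi (fun t => f t * expi (- n) t).
  by move=> t; rewrite fp expiD2pi.
have -> : fhat (Delta h f) n = cint (fun t => expi n h * (f (t + h) * expi (- n) (t + h)) +
     -1 * (f t * expi (- n) t)).
  apply: eq_cint => t; rewrite /Delta expi_add.
  rewrite mulrBl mulN1r; congr (_ - _).
  by rewrite -[LHS]mul1r -(expi_prodM n h); ring.
have fes := cL1_shift h fep fe.
rewrite cintD; [|exact: cL1Z|exact: cL1Z].
rewrite !cintZ // (@cint_shift (fun t => f t * expi (- n) t)) //; last exact: fe.1.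
by rewrite -/(fhat f n); ring.
Qed.

Lemma Delta_props f h : periodic2pi f -> cL1 f -> periodic2pi (Delta h f) /\ cL1 (Delta h f).
Proof.
move=> fp fi; split; first by move=> x; rewrite /Delta addrAC !fp.
have -> : Delta h f = (fun x => f (x + h) + -1 * f x).
  by apply/funext => x; rewrite mulN1r.
by apply: cL1D; [exact: cL1_shift|exact: cL1Z].
Qed.

Lemma Deltak_props k f h : periodic2pi f -> cL1 f -> [/\ periodic2pi (Deltak k h f),
  cL1 (Deltak k h f) & forall n, fhat (Deltak k h f) n = (expi n h - 1) ^+ k * fhat f n].
Proof.
move=> fp fi; elim: k => [|k [ih1 ih2 ih3]]; first by split=> // n; rewrite expr0 mul1r.
have [h1 h2] := Delta_props h ih1 ih2; split=> // n.
by rewrite /Deltak /= fhat_Delta // ih3 exprS mulrA.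
Qed.

End fourier_coefficients.

(** * Parseval for polynomials and a general Bessel argument *)

Section parseval.
Variable R : realType.
Local Notation C := R[i].
Local Notation normc := ComplexField.Normc.normc.
Local Notation mu := (@torus_measure R).
Local Arguments expi : simpl never.

Lemma fhat_tp D q n : fhat (@tp R D q) n = if (`|n| <= D)%N then q n else 0.
Proof.
have [i1 i2] := cint_sum (zr D) q (fun k => @cL1_expi R (k - n)).
rewrite /fhat (_ : (fun t => _) = (fun t => \sum_(k <- zr D) q k * expi (k - n) t)); last first.
  apply/funext => t; rewrite /tp mulr_suml; apply: eq_bigr => k _.
  by rewrite expiD mulrA.
rewrite i2; under eq_bigr do rewrite cint_expi subr_eq0.
case: ifPn => nD.
  rewrite (bigD1_seq n) ?mem_zr ?uniq_zr //= eqxx mulr1 big1 ?addr0 // => k kn.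
  by rewrite (negbTE kn) mulr0.
rewrite big1_seq // => k /andP[_]; rewrite mem_zr => kD; case: eqP => [kn|_]; last by rewrite mulr0.
by rewrite kn (negbTE nD) in kD.
Qed.

Lemma cint_mul_conj_tp g D c : cL1 g ->
  cL1 (fun t => g t * (@tp R D c t)^*%C) /\
  cint (fun t => g t * (@tp R D c t)^*%C) = \sum_(n <- zr D) (c n)^*%C * fhat g n.
Proof.
move=> gi; have [i1 i2] := cint_sum (zr D) (fun n => (c n)^*%C) (fun n => cL1Mexpi (- n) gi).
have e : (fun t => g t * (@tp R D c t)^*%C) =
    (fun t => \sum_(n <- zr D) (c n)^*%C * (g t * expi (- n) t)).
  by apply/funext => t; rewrite conj_tp mulr_sumr; apply: eq_bigr => n _; rewrite mulrCA.
by rewrite e.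
Qed.

Lemma integral_sqr_tp D c :
  (\int[mu]_x (normc (@tp R D c x) ^+ 2)%:E = (\sum_(n <- zr D) normc (c n) ^+ 2)%:E)%E.
Proof.
have [i1 i2] := @cint_mul_conj_tp _ D c (@cL1_tp R D c).
have e x : normc (tp D c x) ^+ 2 = complex.Re (tp D c x * (tp D c x)^*%C).
  by rewrite -sqr_normcC.
have ir := cL1_Re i1.
transitivity (Rintegral mu setT (fun x => complex.Re (tp D c x * (tp D c x)^*%C)))%:E.
  rewrite /Rintegral fineK; last exact: integrable_fin_num.
  by apply: eq_integral => x _; rewrite e.
congr (_%:E); rewrite -[LHS]/(complex.Re (cint (fun x => tp D c x * (tp D c x)^*%C))) i2.
rewrite -[RHS]/(complex.Re (\sum_(n <- zr D) normc (c n) ^+ 2)%:C%C) rmorph_sum /=.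
congr complex.Re; apply: eq_big_seq => n; rewrite mem_zr => nD.
by rewrite fhat_tp nD sqr_normcC mulrC.
Qed.

Lemma mu_pos : (0 < mu setT)%E.
Proof. by rewrite torus_measureT lte01. Qed.

Lemma Tnorm_ooE (g : R -> C) : Tnorm +oo%E g = ess_sup mu (fun x => (normc (g x))%:E).
Proof.
rewrite /Tnorm unlock /Lnorm mu_pos; congr ess_sup; apply/funext => x.
by rewrite /= /cabs /= ger0_norm ?normc_ge0.
Qed.

Lemma Tnorm_finE (p : R) (g : R -> C) :
  Tnorm p%:E g = ((\int[mu]_x (normc (g x) `^ p)%:E) `^ p^-1)%E.
Proof.
rewrite /Tnorm unlock /Lnorm; congr (_ `^ _)%E; apply: eq_integral => x _.
by rewrite /cabs /= ger0_norm ?normc_ge0.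
Qed.

Lemma Tnorm_oo_le (g : R -> C) (B : R) : (forall x, normc (g x) <= B) -> (Tnorm +oo%E g <= B%:E)%E.
Proof. by move=> gB; rewrite Tnorm_ooE; apply/ess_supP; apply: nearW => x; rewrite lee_fin. Qed.

Lemma Tnorm_ge0 (p : \bar R) (g : R -> C) : (0 <= Tnorm p g)%E.
Proof. exact: Lnorm_ge0. Qed.

Lemma measurable_normc_powR (g : R -> C) (p : R) : cmeasurable g ->
  measurable_fun setT (fun x => (normc (g x) `^ p)%:E).
Proof.
move=> mg; apply/measurable_EFinP; apply: (measurableT_comp (measurable_powR p)).
exact: measurable_normc.
Qed.

Lemma Tnorm_fin_le (p W : R) (g : R -> C) : 0 < p -> 0 <= W -> (Tnorm p%:E g <= W%:E)%E ->
  (\int[mu]_x (normc (g x) `^ p)%:E <= (W `^ p)%:E)%E.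
Proof.
move=> p0 W0; rewrite Tnorm_finE => h.
have I0 : (0 <= \int[mu]_x (normc (g x) `^ p)%:E)%E.
  by apply: integral_ge0 => x _; rewrite lee_fin powR_ge0.
have W0' : (0 <= W%:E)%E by rewrite lee_fin.
have := @gt0_ler_poweR R p (ltW p0) _ _ _ _ h.
rewrite !in_itv /= !leey !andbT poweR_ge0 => /(_ isT W0').
by rewrite -poweRrM mulVf ?gt_eqF // poweRe1 // poweR_EFin.
Qed.

Lemma ae_torusS (P Q : R -> Prop) : (forall x, P x -> Q x) ->
  (\forall x \ae mu, P x) -> \forall x \ae mu, Q x.
Proof.
move=> PQ.
by apply: (@filterS _ _ (ae_filter_ringOfSetsType (mu : {measure set _ -> \bar R}))).
Qed.

(** Common core for all p. With T the partial Fourier sum of g, the energy X is the integral of g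
    times the conjugate of T, hence at most X/2 + H. The majorant h carries the dependence on p. *)
Lemma bessel_aux (g : R -> C) D (h : R -> R) (H : R) : cL1 g ->
  measurable_fun setT h -> (forall x, 0 <= h x) -> (\int[mu]_x (h x)%:E <= H%:E)%E ->
  (\forall x \ae mu, normc (g x) * normc (tp D (fhat g) x) <=
     normc (tp D (fhat g) x) ^+ 2 / 2 + h x) ->
  \sum_(n <- zr D) normc (fhat g n) ^+ 2 <= 2 * H.
Proof.
move=> gi mh h0 hH hae; set T := tp D (fhat g); set X := \sum_(n <- zr D) _.
have [i1 i2] := @cint_mul_conj_tp g D (fhat g) gi.
have ir := cL1_Re i1.
have mT : cmeasurable T by exact: cmeasurable_tp.
have mF : measurable_fun setT (fun x => normc (g x * (T x)^*%C)) by exact: measurable_normc i1.1.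
have mT2 : measurable_fun setT (fun x => normc (T x) ^+ 2 / 2).
  apply: measurable_funM => //; apply: measurable_funX; exact: measurable_normc.
have XE : (X%:E = \int[mu]_x (complex.Re (g x * (T x)^*%C))%:E)%E.
  transitivity (Rintegral mu setT (fun x => complex.Re (g x * (T x)^*%C)))%:E; last first.
    by rewrite /Rintegral fineK //; exact: integrable_fin_num.
  congr (_%:E); rewrite -[RHS]/(complex.Re (cint (fun x => g x * (T x)^*%C))) i2.
  rewrite -[LHS]/(complex.Re X%:C%C) /X (rmorph_sum (real_complex R)).
  by congr complex.Re; apply: eq_bigr => n _; rewrite -[RHS]mulrC -sqr_normcC.
have : (X%:E <= (X / 2 + H)%:E)%E.
  rewrite XE; apply: (@le_trans _ _ (\int[mu]_x (normc (g x * (T x)^*%C))%:E)%E).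
    apply: le_integral => //; first exact: i1.2.
    by move=> x _; rewrite lee_fin; apply: le_trans (Re_le_normc _); exact: ler_norm.
  apply: (@le_trans _ _ (\int[mu]_x ((normc (T x) ^+ 2 / 2)%:E + (h x)%:E))%E).
    apply: ae_ge0_le_integral => //.
    - by move=> x _; rewrite lee_fin normc_ge0.
    - exact/measurable_EFinP.
    - by move=> x _; rewrite -EFinD lee_fin addr_ge0 // divr_ge0 ?sqr_ge0.
    - by apply: emeasurable_funD; exact/measurable_EFinP.
    - apply: ae_torusS hae => x hx _.
      by rewrite -EFinD lee_fin ComplexField.Normc.normcM normc_conj.
  have F0 x : setT x -> (0 <= (normc (T x) ^+ 2 / 2)%:E)%E.
    by move=> _; rewrite lee_fin divr_ge0 ?sqr_ge0.
  have H0 x : setT x -> (0 <= (h x)%:E)%E by move=> _; rewrite lee_fin.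
  have MF : measurable_fun setT (fun x => (normc (T x) ^+ 2 / 2)%:E) by exact/measurable_EFinP.
  have MH : measurable_fun setT (fun x => (h x)%:E) by exact/measurable_EFinP.
  rewrite (ge0_integralD mu measurableT F0 MF H0 MH).
  rewrite EFinD; apply: leeD => //.
  under eq_integral do rewrite EFinM.
  have MT : measurable_fun setT (fun x => (normc (T x) ^+ 2)%:E).
    by apply/measurable_EFinP; apply: measurable_funX; exact: measurable_normc.
  have T0 x : setT x -> (0 <= (normc (T x) ^+ 2)%:E)%E by move=> _; rewrite lee_fin sqr_ge0.
  rewrite (ge0_integralZr mu measurableT MT T0); last by rewrite lee_fin invr_ge0.
  by rewrite integral_sqr_tp -EFinM lexx.
rewrite lee_fin; lra.
Qed.

End parseval.

(** * Bessel's inequality for functions in L_p *)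

Section bessel_in_Lp.
Variable R : realType.
Local Notation C := R[i].
Local Notation normc := ComplexField.Normc.normc.
Local Notation mu := (@torus_measure R).

Lemma powRD_gt0 (x a b : R) : 0 < x -> x `^ (a + b) = x `^ a * x `^ b.
Proof. by move=> x0; rewrite powRD // (gt_eqF x0) implybT. Qed.

(** For G <= M, Young's inequality leaves G^2 / 2, and G^2 <= M^(2-p) G^p; for G > M already G M <=
    M^(2-p) G^p. *)
Lemma young_le2 (p G tau M : R) : 1 <= p <= 2 -> 0 <= G -> 0 <= tau <= M -> 0 < M ->
  G * tau <= tau ^+ 2 / 2 + M `^ (2 - p) * G `^ p.
Proof.
move=> /andP[p1 p2] G0 /andP[t0 tM] M0.
have [GM|MG] := leP G M.
  suff h : G ^+ 2 <= M `^ (2 - p) * G `^ p.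
    by have := sqr_ge0 (G - tau); nra.
  have [->|Gn] := eqVneq G 0; first by rewrite expr0n /= mulr_ge0 ?powR_ge0.
  have Gp : 0 < G by rewrite lt_neqAle eq_sym Gn.
  have -> : G ^+ 2 = G `^ (2 - p) * G `^ p by rewrite -powRD_gt0 // subrK powR_mulrn.
  by rewrite ler_wpM2r ?powR_ge0 // ge0_ler_powR ?nnegrE ?subr_ge0 // ltW.
have Gp := lt_trans M0 MG.
suff h : G * M <= M `^ (2 - p) * G `^ p.
  by have : G * tau <= G * M by [rewrite ler_wpM2l]; have := sqr_ge0 tau; nra.
have eG : G `^ p = G * G `^ (p - 1).
  by rewrite mulr_powRB1 // (lt_le_trans ltr01).
have eM : M `^ (2 - p) * M `^ (p - 1) = M.
  by rewrite -powRD_gt0 // (_ : _ + _ = 1) ?powRr1 ?ltW //; ring.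
rewrite eG -{1}eM mulrCA ler_wpM2l ?powR_ge0 // ler_wpM2l //.
by rewrite ge0_ler_powR ?nnegrE ?subr_ge0 // ltW.
Qed.

Lemma sqr_le_powR (p G W : R) : 2 <= p -> 0 <= G -> 0 < W ->
  G ^+ 2 <= W ^+ 2 + W `^ (2 - p) * G `^ p.
Proof.
move=> p2 G0 W0; have [GW|WG] := leP G W.
  apply: ler_wpDr; first by rewrite mulr_ge0 ?powR_ge0.
  by rewrite lerXn2r ?nnegrE // ltW.
apply: ler_wpDl; first exact: sqr_ge0.
have Gp := lt_trans W0 WG.
have eG : G `^ p = G ^+ 2 * G `^ (p - 2).
  by rewrite -powR_mulrn // -powRD_gt0 // addrC subrK.
have eW : W `^ (2 - p) * W `^ (p - 2) = 1.
  by rewrite -powRD_gt0 // (_ : 2 - p + (p - 2) = 0) ?powRr0 //; ring.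
rewrite eG mulrCA ler_peMr ?sqr_ge0 // -[leLHS]eW.
by rewrite ler_wpM2l ?powR_ge0 // ge0_ler_powR ?nnegrE ?subr_ge0 // ltW.
Qed.

Definition gam (p : \bar R) : R := Num.max (einv p - 2^-1) 0.

Lemma gam_ge0 p : 0 <= gam p.
Proof. by rewrite /gam le_max lexx orbT. Qed.

(** For p < 2 the bound bootstraps. If y is the l2 norm of the coefficients, Cauchy-Schwarz gives
    [|T| <= M] with M = sqrt(N) y, so y^2 <= 2 M^(2-p) W^p; dividing by y^(2-p) and taking p-th
    roots produces the power (2 - p) / (2 p) = 1/p - 1/2 of N. *)
Lemma bessel_Lp (p : \bar R) (g : R -> C) (D : nat) (W : R) : (1 <= p)%E -> cL1 g -> 0 < W ->
  (Tnorm p g <= W%:E)%E ->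
  \sum_(n <- zr D) normc (fhat g n) ^+ 2 <= (2 * (2 * D).+1%:R `^ gam p * W) ^+ 2.
Proof.
move=> p1 gi W0 gW; set X := \sum_(n <- zr D) _; set N : R := (2 * D).+1%:R.
have N1 : 1 <= N by rewrite ler1n.
have X0 : 0 <= X by apply: sumr_ge0 => n _; rewrite sqr_ge0.
have mG := measurable_normc gi.1.
have Ng : 1 <= N `^ gam p by rewrite -(powRr0 N) ler_powR // gam_ge0.
have fin : X <= 2 * W ^+ 2 -> X <= (2 * N `^ gam p * W) ^+ 2.
  move=> h; apply: le_trans h _; rewrite exprMn ler_wpM2r ?sqr_ge0 //.
  by nra.
case: p p1 gW Ng fin => [p| |//].
- rewrite lee_fin => p1 gW Ng fin; have p0 : 0 < p by apply: lt_le_trans p1.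
  have hW := Tnorm_fin_le p0 (ltW W0) gW.
  have mGp := measurable_normc_powR p gi.1.
  have mZ (a b : R) : measurable_fun setT (fun x => a + b * normc (g x) `^ p).
    apply: measurable_funD; first exact: measurable_cst.
    by apply: measurable_funM; [exact: measurable_cst|exact/measurable_EFinP].
  have intL (a b : R) : 0 <= a -> 0 <= b ->
     (\int[mu]_x (a + b * normc (g x) `^ p)%:E <= (a + b * W `^ p)%:E)%E.
    move=> a0 b0; under eq_integral do rewrite EFinD EFinM.
    have F0 x : setT x -> (0 <= (fun _ : R => a%:E) x)%E by move=> _; rewrite lee_fin.
    have MF : measurable_fun setT (fun _ : R => a%:E) by exact: measurable_cst.
    have H0 x : setT x -> (0 <= b%:E * (normc (g x) `^ p)%:E)%E.
      by move=> _; rewrite -EFinM lee_fin mulr_ge0 ?powR_ge0.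
    have MH : measurable_fun setT (fun x => b%:E * (normc (g x) `^ p)%:E)%E.
      exact: measurable_funeM.
    have P0 x : setT x -> (0 <= (normc (g x) `^ p)%:E)%E by move=> _; rewrite lee_fin powR_ge0.
    rewrite (ge0_integralD mu measurableT F0 MF H0 MH) EFinD; apply: leeD.
      rewrite integral_cst // [X in (_ * X)%E](_ : _ = 1%E) ?mule1 //.
      exact: torus_measureT.
    by rewrite (ge0_integralZl mu measurableT mGp P0) // EFinM lee_wpmul2l // lee_fin.
  have [p2|p2] := leP 2 p.
  + apply: fin; have := @bessel_aux R g D _ _ gi (mZ (W ^+ 2 / 2) (W `^ (2 - p) / 2)) _ (intL _ _ _ _) _.
    have -> : W ^+ 2 / 2 + W `^ (2 - p) / 2 * W `^ p = W ^+ 2.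
      have : W `^ (2 - p) * W `^ p = W ^+ 2 by rewrite -powRD_gt0 // subrK powR_mulrn ?ltW.
      by move: (W `^ (2 - p)) (W `^ p) (W ^+ 2) => u v w; lra.
    apply.
    * by move=> x; rewrite addr_ge0 ?divr_ge0 ?sqr_ge0 // mulr_ge0 ?divr_ge0 ?powR_ge0.
    * by rewrite divr_ge0 ?sqr_ge0.
    * by rewrite divr_ge0 ?powR_ge0.
    * apply: aeW => x; have := sqr_le_powR p2 (normc_ge0 (g x)) W0.
      have := sqr_ge0 (normc (g x) - normc (tp D (fhat g) x)).
      by move: (W `^ (2 - p)) (normc (g x) `^ p) => u v; nra.
  + have [X00|Xn] := eqVneq X 0; first by rewrite X00 sqr_ge0.
    have Xp : 0 < X by rewrite lt_neqAle eq_sym Xn.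
    pose y := Num.sqrt X; have y0 : 0 < y by rewrite sqrtr_gt0.
    have yX : y ^+ 2 = X by rewrite sqr_sqrtr.
    pose M := Num.sqrt N * y.
    have sN : 0 < Num.sqrt N by rewrite sqrtr_gt0 (lt_le_trans ltr01).
    have M0 : 0 < M by rewrite mulr_gt0.
    have tM x : normc (tp D (fhat g) x) <= M.
      rewrite -(ler_pXn2r (n := 2)) ?nnegrE ?normc_ge0 ?(ltW M0) //.
      rewrite exprMn yX sqr_sqrtr; last exact: le_trans N1.
      apply: le_trans (sqr_l1_le _ _); rewrite lerXn2r ?nnegrE ?normc_ge0 //.
        by apply: sumr_ge0 => n _; exact: normc_ge0.
      exact: normc_tp.
    have := @bessel_aux R g D _ _ gi (mZ 0 (M `^ (2 - p))) _ (intL _ _ _ _) _.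
    rewrite -/X => /(_ _ _ _ _) h.
    have {h} h : X <= 2 * (M `^ (2 - p) * W `^ p).
      rewrite -[_ * W `^ p]add0r; apply: h => //.
      * by move=> x; rewrite add0r mulr_ge0 ?powR_ge0.
      * exact: powR_ge0.
      * apply: aeW => x; rewrite add0r.
        by apply: young_le2; rewrite ?p1 ?(ltW p2) ?normc_ge0 ?tM.
    have yp : y `^ p <= (2 * N `^ gam p%:E * W) `^ p.
      have e1 : y ^+ 2 = y `^ (2 - p) * y `^ p by rewrite -powRD_gt0 // subrK powR_mulrn ?ltW.
      move: h; rewrite -yX e1 /M (@powRM _ (Num.sqrt N)) ?(ltW sN) ?(ltW y0) //.
      rewrite [X in _ <= X](_ : _ = y `^ (2 - p) * (2 * (Num.sqrt N `^ (2 - p) * W `^ p))); last by ring.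
      rewrite ler_pM2l ?powR_gt0 // => /le_trans; apply.
      rewrite !powRM ?powR_ge0 ?mulr_ge0 ?powR_ge0 ?(ltW W0) //.
      rewrite mulrA ler_wpM2r ?powR_ge0 //; apply: ler_pM; rewrite ?powR_ge0 //.
        by rewrite -{1}(powRr1 (ler0n R 2)) ler_powR // ler1n.
      rewrite -powR12_sqrt; last exact: le_trans N1.
      rewrite -!powRrM ler_powR // /gam le_eqVlt; apply/orP; left; apply/eqP => /=.
      rewrite max_l; last by rewrite subr_ge0 lef_pV2 ?posrE // ltW.
      by rewrite mulrBl mulVf ?gt_eqF //; lra.
    rewrite -yX lerXn2r ?nnegrE ?(ltW y0) ?mulr_ge0 ?powR_ge0 ?(ltW W0) //.
    have := @ge0_ler_powR R p^-1 _ _ _ _ _ yp.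
    rewrite -!powRrM divff ?gt_eqF // !powRr1 ?mulr_ge0 ?powR_ge0 ?(ltW W0) ?(ltW y0) //.
    by apply; rewrite ?invr_ge0 ?nnegrE ?powR_ge0 ?(ltW p0).
- move=> _ gW Ng fin; apply: fin; rewrite Tnorm_ooE in gW; move/ess_supP: gW => gW.
  have mc : measurable_fun setT (fun _ : R => W ^+ 2) by exact: measurable_cst.
  apply: (@bessel_aux R g D _ _ gi mc).
  + by move=> x; rewrite sqr_ge0.
  + by rewrite integral_cst // [X in (_ * X)%E](_ : _ = 1%E) ?mule1 //; exact: torus_measureT.
  + apply: ae_torusS gW => x; rewrite lee_fin => gx.
    have : normc (g x) ^+ 2 <= W ^+ 2 by rewrite lerXn2r ?nnegrE ?normc_ge0 // ltW.
    by have := sqr_ge0 (normc (g x) - normc (tp D (fhat g) x)); nra.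
Qed.

End bessel_in_Lp.

(** * From the Besov norm to the modulus of smoothness *)

Section besov_modulus.
Variable R : realType.
Local Notation C := R[i].
Local Notation normc := ComplexField.Normc.normc.
Local Notation mu := (@torus_measure R).
Local Notation leb := (@lebesgue_measure R).

(** The modulus is a supremum over uncountably many steps h; monotonicity in t is what makes it
    measurable. *)
Lemma nondecreasing_emeasurable (F : R -> \bar R) :
  (forall s t, s <= t -> (F s <= F t)%E) -> measurable_fun setT F.
Proof.
move=> Fnd mD; apply: (measurability _ (ErealGenOInfty.measurableE R)) => //.
move=> /= _ [_ [r ->] <-]; rewrite setTI; apply: is_interval_measurable => s t /=.
rewrite !in_itv /= !andbT => rs rt u /andP[su _].
by rewrite in_itv /= andbT; exact: lt_le_trans rs (Fnd _ _ su).
Qed.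

Lemma omega_nd k p (f : R -> C) s t : s <= t -> (omega k p f s <= omega k p f t)%E.
Proof.
move=> st; apply: ub_ereal_sup => _ [h hs <-]; apply: ereal_sup_ubound.
by exists h => //=; exact: le_trans hs st.
Qed.

Lemma omega_ge0 k p (f : R -> C) t : 0 <= t -> (0 <= omega k p f t)%E.
Proof.
move=> t0; apply: (@le_trans _ _ (Tnorm p (Deltak k 0 f))); first exact: Tnorm_ge0.
by apply: ereal_sup_ubound; exists 0 => //=; rewrite normr0.
Qed.

Lemma Deltak_le_omega k p (f : R -> C) h t : `|h| <= t -> (Tnorm p (Deltak k h f) <= omega k p f t)%E.
Proof. by move=> ht; apply: ereal_sup_ubound; exists h. Qed.

Definition besov_integrand k r p th (f : R -> C) (t : R) : \bar R :=
  (((t `^ (- r))%:E * omega k p f t) `^ th * (t^-1)%:E)%E.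

Lemma measurable_besov_integrand k r p th (f : R -> C) :
  measurable_fun (`]0%R, +oo[ : set R) (besov_integrand k r p th f).
Proof.
apply: emeasurable_funM.
  apply: (measurableT_comp (measurable_poweR th)).
  apply: emeasurable_funM.
    apply/measurable_EFinP; apply: measurable_funTS; exact: measurable_powR.
  by apply: measurable_funTS; apply: nondecreasing_emeasurable => s t; exact: omega_nd.
apply/measurable_EFinP.
have h : measurable_fun setT (fun t : R => t `^ (- 1)) by exact: measurable_powR.
apply: (eq_measurable_fun (fun t : R => t `^ (- 1))); last exact: measurable_funTS.
by move=> t; rewrite inE /= in_itv /= andbT => t0; rewrite powR_inv1 // ltW.
Qed.

Lemma besov_integrand_ge0 k r p th (f : R -> C) t : 0 < t -> (0 <= besov_integrand k r p th f t)%E.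
Proof. by move=> t0; rewrite mule_ge0 ?poweR_ge0 // lee_fin invr_ge0 ltW. Qed.

(** For finite theta, monotonicity of the modulus makes the integral over t .. 2t at least half of
    the theta-th power of (2t)^(-r) omega(t). The resulting constant 2^(1/theta) is at most 2. *)
Lemma besov_omega k (r : R) p theta (f : R -> C) (t : R) : 0 < r -> (1 <= theta)%E ->
  (besov_norm k r p theta f <= 1)%E -> 0 < t ->
  (omega k p f t <= (2 * (2 * t) `^ r)%:E)%E.
Proof.
move=> r0 th1 hB t0.
have t20 : 0 < 2 * t by rewrite mulr_gt0.
have w0 := omega_ge0 k p f (ltW t0).
set w := omega k p f t in w0 *.
case: theta th1 hB => [th| |//].
- rewrite lee_fin => th1; rewrite /besov_norm -/(besov_integrand k r p th f) => hB.
  have thp : 0 < th by apply: lt_le_trans th1.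
  set I := (\int[_]_(t in _) _)%E in hB.
  have hI : (I <= 1)%E.
    have I0 : (0 <= I)%E.
      apply: integral_ge0 => s; rewrite /= in_itv /= andbT.
      exact: besov_integrand_ge0.
    have h1 : (I `^ th^-1 <= 1)%E.
      by apply: le_trans hB; rewrite leeDr // Tnorm_ge0.
    have := @gt0_ler_poweR R th (ltW thp) _ _ _ _ h1.
    rewrite !in_itv /= !leey !andbT poweR_ge0 lee01 => /(_ isT isT).
    by rewrite powR1 -poweRrM mulVf ?gt_eqF // poweRe1.
  have key : (((((2 * t) `^ (- r))%:E * w) `^ th) * (2^-1)%:E <= 1)%E.
    apply: le_trans hI.
    apply: (@le_trans _ _ (\int[leb]_(s in `[t, (2 * t)%R]) besov_integrand k r p th f s)%E).
      apply: (@le_trans _ _ (\int[leb]_(s in `[t, (2 * t)%R])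
          ((((2 * t) `^ (- r))%:E * w) `^ th * ((2 * t)^-1)%:E))%E).
        have lm : leb `[t, (2 * t)%R] = t%:E.
          rewrite lebesgue_measure_itv /= lte_fin ifT; last lra.
          by rewrite -?EFinN -?EFinD; congr (_%:E); lra.
        rewrite integral_cst // [X in (_ <= _ * X)%E](_ : _ = t%:E); last exact: lm.
        rewrite -muleA lee_wpmul2l ?poweR_ge0 // -EFinM lee_fin.
        by rewrite mulrC ler_pdivlMr //; lra.
      apply: ge0_le_integral => //.
      + by move=> s _; rewrite mule_ge0 ?poweR_ge0 // lee_fin invr_ge0 ltW.
      + apply: measurable_funS (@measurable_besov_integrand k r p th f) => // s /=.
        by rewrite !in_itv /= andbT => /andP[ts _]; exact: lt_le_trans ts.
      + move=> s /=; rewrite in_itv /= => /andP[ts st].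
        have s0 : 0 < s by exact: lt_le_trans ts.
        apply: lee_pmul; rewrite ?poweR_ge0 ?lee_fin ?invr_ge0 ?(ltW t20) //.
        * apply: gt0_ler_poweR; rewrite ?(ltW thp) // ?in_itv /= ?leey ?andbT.
          - by rewrite mule_ge0 // lee_fin powR_ge0.
          - by rewrite mule_ge0 // ?lee_fin ?powR_ge0 // omega_ge0 // ltW.
          - apply: lee_pmul => //; rewrite ?lee_fin ?powR_ge0 //; last exact: omega_nd.
            by rewrite !powRN lef_pV2 ?posrE ?powR_gt0 // ge0_ler_powR ?nnegrE ?(ltW r0) ?(ltW s0) ?(ltW t20).
        * by rewrite lef_pV2 ?posrE.
    apply: ge0_subset_integral => //.
    + exact: measurable_besov_integrand.
    + by move=> s /=; rewrite in_itv /= andbT; exact: besov_integrand_ge0.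
    + by move=> s /=; rewrite !in_itv /= andbT => /andP[ts _]; exact: lt_le_trans ts.
  move: w0 key; case: w => [w| |//].
    rewrite lee_fin => w0.
    rewrite (_ : (((2 * t) `^ (- r))%:E * w%:E = ((2 * t) `^ (- r) * w)%:E)%E) //.
    rewrite poweR_EFin -EFinM !lee_fin => key.
    have h : ((2 * t) `^ (- r) * w) `^ th <= 2 `^ th.
      apply: (@le_trans _ _ 2); first lra.
      by rewrite -{1}(powRr1 (ler0n R 2)) ler_powR // ler1n.
    have := @ge0_ler_powR R th^-1 _ _ _ _ _ h.
    rewrite -!powRrM divff ?gt_eqF // !powRr1 ?mulr_ge0 ?powR_ge0 // => /(_ _ _ _) h2.
    have {h2} : (2 * t) `^ (- r) * w <= 2.
      by apply: h2; rewrite ?invr_ge0 ?nnegrE ?powR_ge0 ?(ltW thp).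
    by rewrite powRN mulrC ler_pdivrMr ?powR_gt0.
  rewrite gt0_muley ?lte_fin ?powR_gt0 // poweRyr ?gt_eqF // gt0_mulye ?lte_fin //.
- move=> _; rewrite /besov_norm => hB.
  have : ((t `^ (- r))%:E * w <= 1)%E.
    apply: le_trans hB; apply: le_trans (leeDr _ (Tnorm_ge0 _ _)).
    by apply: ereal_sup_ubound; exists t => //=; rewrite in_itv /= andbT.
  move: w0; case: w => [w| |//].
    rewrite lee_fin -EFinM !lee_fin => w0; rewrite powRN mulrC ler_pdivrMr ?powR_gt0 // mul1r.
    move=> /le_trans; apply; apply: (@le_trans _ _ ((2 * t) `^ r)).
      by rewrite ge0_ler_powR ?nnegrE ?ltW //; lra.
    by rewrite ler_peMl ?powR_ge0 // ler1n.
  by rewrite gt0_muley ?lte_fin ?powR_gt0.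
Qed.

(** For finite p, |f| <= 1 + |f|^p on a space of mass one. *)
Lemma in_Lp_cL1 p (f : R -> C) : (1 <= p)%E -> in_Lp p f -> cL1 f.
Proof.
move=> p1 [fp [mf fi]]; split => //.
have mN : measurable_fun setT (fun x => (normc (f x))%:E).
  by apply/measurable_EFinP; exact: measurable_normc.
apply/integrableP; split => //.
under eq_integral do rewrite /= ger0_norm ?normc_ge0 //.
case: p p1 fi => [p| |//].
- rewrite lee_fin Tnorm_finE => p1 /lty_poweRy fi.
  have p0 : 0 < p by exact: lt_le_trans p1.
  have {fi} fi : (\int[mu]_x (normc (f x) `^ p)%:E < +oo)%E by apply: fi; rewrite invr_eq0 gt_eqF.
  have mP := measurable_normc_powR p mf.
  apply: (@le_lt_trans _ _ (\int[mu]_x (1%:E + (normc (f x) `^ p)%:E))%E).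
    apply: ge0_le_integral => //.
    + by move=> x _; rewrite lee_fin normc_ge0.
    + by apply: emeasurable_funD.
    + move=> x _; rewrite -EFinD lee_fin.
      have [n1|n1] := leP (normc (f x)) 1; first by rewrite ler_wpDr ?powR_ge0.
      by rewrite ler_wpDl // le1r_powR // ltW.
  have P0 x : setT x -> (0 <= (normc (f x) `^ p)%:E)%E by move=> _; rewrite lee_fin powR_ge0.
  have O0 x : setT x -> (0 <= (fun _ : R => 1%:E) x :> \bar R)%E by move=> _; rewrite lee_fin.
  have MO : measurable_fun setT (fun _ : R => 1%:E : \bar R) by exact: measurable_cst.
  rewrite (ge0_integralD mu measurableT O0 MO P0 mP) lte_add_pinfty //.
  rewrite integral_cst // [X in (_ * X)%E](_ : _ = 1%E) ?mule1 ?ltry //.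
  exact: torus_measureT.
- move=> _; rewrite Tnorm_ooE => fi.
  have [M hM] : exists M : R, (ess_sup mu (fun x => (normc (f x))%:E) <= M%:E)%E.
    move: fi; case: ess_sup => [M| |] //; [by exists M|by exists 0; rewrite leNye].
  move/ess_supP: hM => hM.
  apply: (@le_lt_trans _ _ (\int[mu]_x (`|M|%:E))%E).
    apply: ae_ge0_le_integral => //.
    + by move=> x _; rewrite lee_fin normc_ge0.
    + by apply: ae_torusS hM => x hx _; apply: le_trans hx _; rewrite lee_fin ler_norm.
  rewrite integral_cst // [X in (_ * X)%E](_ : _ = 1%E) ?mule1 ?ltry //.
  exact: torus_measureT.
Qed.

End besov_modulus.

(** * Energy of the dyadic blocks on the Besov class *)

Section dyadic_blocks.
Variable R : realType.
Local Notation C := R[i].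
Local Notation normc := ComplexField.Normc.normc.
Local Arguments expi : simpl never.

(** The Fourier multiplier of [sigma_blk s]; for s > 0 it lives on 2^(s-1) < |n| < 2^(s+1). *)
Definition sc (s : nat) (n : int) : R :=
  if s is s'.+1 then vcr R (2 ^ s) n - vcr R (2 ^ s') n else vcr R 1 n.

Lemma sc_small s n : (`|n| <= 2 ^ s)%N -> sc s.+1 n = 0.
Proof.
by move=> h; rewrite /sc !vcr_eq1 ?subrr ?expn_gt0 // (leq_trans h) // leq_exp2l.
Qed.

Lemma sc_large s n : (2 ^ s.+1 <= `|n|)%N -> sc s n = 0.
Proof.
case: s => [|s] h; rewrite /sc; first by rewrite vcr_eq0.
by rewrite !vcr_eq0 ?subrr // -?expnS // (leq_trans _ h) // leq_exp2l.
Qed.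

Lemma sum_sc N n : \sum_(s < N.+1) sc s n = vcr R (2 ^ N) n.
Proof.
elim: N => [|N ih]; first by rewrite big_ord_recr /= big_ord0 add0r.
by rewrite big_ord_recr /= ih addrC subrK.
Qed.

Lemma normr_sc_le1 s n : `|sc s n| <= 1.
Proof.
have h0 := vcr_ge0 R; have h1 := vcr_le1 R.
case: s => [|s]; rewrite /sc; first by rewrite ger0_norm.
rewrite ler_norml; have := h0 (2 ^ s.+1)%N n; have := h1 (2 ^ s.+1)%N n.
by have := h0 (2 ^ s)%N n; have := h1 (2 ^ s)%N n; move=> *; apply/andP; split; lra.
Qed.

Lemma bandlim_sc s (c : int -> C) : bandlim (2 ^ s.+1) (fun n => (sc s n)%:C%C * c n).
Proof. by move=> n h; rewrite sc_large ?mul0r // ltnW. Qed.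

Lemma sigma_blk_tp s (f : R -> C) x : periodic2pi f -> cL1 f ->
  sigma_blk s f x = tp (2 ^ s.+1) (fun n => (sc s n)%:C%C * fhat f n) x.
Proof.
move=> fp fi; case: s => [|s]; rewrite /sigma_blk /sc; first by rewrite VP_tp.
rewrite !VP_tp // -!expnS -(@tp_widen _ (2 ^ s.+1) (2 ^ s.+2)).
- by rewrite -tpB; apply: eq_tp => n; rewrite rmorphB mulrBl.
- by rewrite leq_exp2l.
- by move=> n h; rewrite /vc vcr_eq0 ?mul0r // -expnS ltnW.
Qed.

Lemma sc_bounded s D (c : int -> C) (B : R) : bandlim D c ->
  (forall x, normc (tp D c x) <= B) ->
  forall x, normc (tp D (fun n => (sc s n)%:C%C * c n) x) <= 6 * B.
Proof.
move=> cD cB x; have B0 : 0 <= B by apply: le_trans (cB 0); exact: normc_ge0.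
case: s => [|s]; rewrite /sc.
  by apply: le_trans (vp_bounded (ltnSn 0) cD cB x) _; lra.
have -> : tp D (fun n => (vcr R (2 ^ s.+1) n - vcr R (2 ^ s) n)%:C%C * c n) x =
    tp D (fun n => vc R (2 ^ s.+1) n * c n) x - tp D (fun n => vc R (2 ^ s) n * c n) x.
  by rewrite -tpB; apply: eq_tp => n; rewrite rmorphB mulrBl.
apply: le_trans (normc_sub _ _) _.
have h1 := vp_bounded (expn_gt0 2 s.+1) cD cB x.
have h2 := vp_bounded (expn_gt0 2 s) cD cB x.
lra.
Qed.

Lemma normc_expiB1 (n : int) (h : R) : normc (expi n h - 1) ^+ 2 = 2 - 2 * cos (n%:~R * h).
Proof.
rewrite sqr_normcE; have := cos2Dsin2 (n%:~R * h); rewrite /expi /= oppr0 addr0.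
move: (cos _) (sin _) => a b e.
have -> : (a - 1) ^+ 2 + b ^+ 2 = (a ^+ 2 + b ^+ 2) - 2 * a + 1 by ring.
by rewrite e; ring.
Qed.

(** On this range the cosine decreases, so the multiplier of a difference stays away from 0 and can
    be divided out. *)
Lemma expiB1_lower (n : int) (h : R) : 4^-1 <= `|n|%:R * h <= 1 ->
  2 - 2 * cos (4^-1 : R) <= normc (expi n h - 1) ^+ 2.
Proof.
move=> /andP[h1 h2]; rewrite normc_expiB1.
have -> : cos (n%:~R * h) = cos (`|n|%:R * h).
  rewrite natr_absz intr_norm; have [n0|n0] := leP 0 (n%:~R : R); first by rewrite ger0_norm.
  by rewrite ltr0_norm // mulNr cosN.
suff : cos (`|n|%:R * h) <= cos (4^-1 : R) by lra.
have p2 := pi_ge2 R.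
by rewrite leNgt ltr_cos ?in_itv /=; [rewrite -leNgt|apply/andP; split; lra|apply/andP; split; lra].
Qed.

Lemma cos4_lt1 : 0 < 2 - 2 * cos (4^-1 : R).
Proof.
have := @cos_lt1 R (4^-1); have p2 := pi_ge2 R => h; suff : cos (4^-1 : R) < 1 by lra.
by apply: h; apply/andP; split; lra.
Qed.

Lemma powR2_nat (s : nat) : (2 : R) `^ s%:R = (2 ^ s)%:R.
Proof. by rewrite powR_mulrn // natrX. Qed.

Lemma block_energy_const (e X Y Z W : R) : 0 <= W -> 0 <= Z -> X <= e * Y ->
  W * (2 * X * (2 * Z)) <= 4 * e * W * (Y * Z).
Proof.
move=> W0 Z0 XY; have -> : 4 * e * W * (Y * Z) = W * (2 * (e * Y) * (2 * Z)) by ring.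
by rewrite ler_wpM2l // ler_wpM2r ?mulr_ge0 // ler_wpM2l.
Qed.

Lemma block_energy (p theta : \bar R) (r : R) (k : nat) : (1 <= p)%E -> (1 <= theta)%E ->
  0 < r -> exists2 A : R, 0 < A & forall f, besov_class k r p theta f -> forall s,
    \sum_(n <- zr (2 ^ s.+1)) normc ((sc s n)%:C%C * fhat f n) ^+ 2 <=
      (A * 2 `^ (- (s%:R * (r - gam p)))) ^+ 2.
Proof.
move=> p1 th1 r0.
pose kap : R := 2 - 2 * cos (4^-1 : R); have kap0 : 0 < kap by exact: cos4_lt1.
(* [A1] serves block 0, bounded through the norm of f itself (5 frequencies); in [A2] the 4 is the 2
   of [bessel_Lp] times the 2 of [besov_omega]. *)
pose A1 : R := 2 * 5 `^ gam p.
pose A2 : R := 4 * 8 `^ gam p / Num.sqrt kap ^+ k.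
have A10 : 0 < A1 by rewrite mulr_gt0 // powR_gt0.
have A20 : 0 < A2 by rewrite divr_gt0 ?mulr_gt0 ?powR_gt0 // exprn_gt0 // sqrtr_gt0.
exists (A1 + A2); first by rewrite addr_gt0.
move=> f [fLp fB] s; have fi := in_Lp_cL1 p1 fLp; have fp := fLp.1.
case: s => [|s].
  rewrite mul0r oppr0 powRr0 mulr1.
  have f1 : (Tnorm p f <= 1%:E)%E.
    apply: le_trans fB; rewrite /besov_norm leeDl //.
    case: theta th1 => [th| |] //= _; first exact: poweR_ge0.
    apply: (@le_trans _ _ ((1 `^ (- r))%:E * omega k p f 1)%E).
      by rewrite mule_ge0 ?lee_fin ?powR_ge0 // omega_ge0.
    by apply: ereal_sup_ubound; exists 1 => //=; rewrite in_itv /= andbT.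
  apply: (@le_trans _ _ (\sum_(n <- zr (2 ^ 1)) normc (fhat f n) ^+ 2)).
    apply: ler_sum => n _; rewrite ComplexField.Normc.normcM exprMn ler_piMl ?sqr_ge0 //.
    by rewrite normc_real exprn_ile1 // normr_sc_le1.
  apply: le_trans (bessel_Lp _ p1 fi ltr01 f1) _; rewrite mulr1.
  by rewrite lerXn2r ?nnegrE ?addr_ge0 ?(ltW A10) ?(ltW A20) // lerDl ltW.
(* On the support 2^s < |n| < 2^(s+2) of block s + 1 this step gives 1/4 < |n| h < 1. *)
pose h : R := (2 ^ s.+2)%:R^-1.
have h0 : 0 < h by rewrite invr_gt0 ltr0n expn_gt0.
have [gp gi gh] := Deltak_props k h fp fi.
have W0 : 0 < 2 * (2 * h) `^ r by rewrite mulr_gt0 // powR_gt0 // mulr_gt0.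
have gW : (Tnorm p (Deltak k h f) <= (2 * (2 * h) `^ r)%:E)%E.
  apply: le_trans (besov_omega r0 th1 fB h0); apply: Deltak_le_omega.
  by rewrite ger0_norm // ltW.
have bes := bessel_Lp (2 ^ s.+2)%N p1 gi W0 gW.
have sk : 0 < Num.sqrt kap ^+ k by rewrite exprn_gt0 // sqrtr_gt0.
apply: (@le_trans _ _ ((Num.sqrt kap ^+ k) ^- 2 *
    \sum_(n <- zr (2 ^ s.+2)) normc (fhat (Deltak k h f) n) ^+ 2)).
  rewrite mulr_sumr; apply: ler_sum => n _; rewrite gh !ComplexField.Normc.normcM.
  have [nl|nl] := leqP `|n| (2 ^ s).
    rewrite sc_small // ComplexField.Normc.normc0 mul0r expr0n.
    by rewrite mulr_ge0 ?sqr_ge0 // invr_ge0 sqr_ge0.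
  have [nu|nu] := leqP (2 ^ s.+2) `|n|.
    rewrite sc_large // ComplexField.Normc.normc0 mul0r expr0n.
    by rewrite mulr_ge0 ?sqr_ge0 // invr_ge0 sqr_ge0.
  have low : Num.sqrt kap ^+ k <= normc ((expi n h - 1) ^+ k).
    have -> : normc ((expi n h - 1) ^+ k) = normc (expi n h - 1) ^+ k.
      by elim: (k) => [|j ih]; rewrite ?ComplexField.Normc.normc1 // !exprS ComplexField.Normc.normcM ih.
    rewrite lerXn2r ?nnegrE ?sqrtr_ge0 ?normc_ge0 //.
    rewrite -(ler_pXn2r (n := 2)) ?nnegrE ?sqrtr_ge0 ?normc_ge0 // sqr_sqrtr ?(ltW kap0) //.
    apply: expiB1_lower; rewrite /h ler_pdivlMr ?ltr0n ?expn_gt0 //.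
    rewrite ler_pdivrMr ?ltr0n ?expn_gt0 // mul1r ler_nat (ltnW nu) andbT.
    have : ((2 ^ s)%:R : R) <= `|n|%:R by rewrite ler_nat ltnW.
    by rewrite !expnS !natrM; lra.
  rewrite !exprMn [leRHS]mulrA ler_wpM2r ?sqr_ge0 //.
  apply: (@le_trans _ _ 1).
    by rewrite normc_real exprn_ile1 // normr_sc_le1.
  apply: (@le_trans _ _ ((Num.sqrt kap ^+ k) ^- 2 * (Num.sqrt kap ^+ k) ^+ 2)).
    by rewrite mulVf // gt_eqF // exprn_gt0.
  by rewrite ler_wpM2l ?invr_ge0 ?sqr_ge0 // lerXn2r ?nnegrE ?normc_ge0 // ltW.
apply: le_trans (ler_wpM2l _ bes) _; first by rewrite invr_ge0 sqr_ge0.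
rewrite -exprVn -exprMn lerXn2r ?nnegrE //.
- by rewrite mulr_ge0 ?invr_ge0 ?(ltW sk) // !mulr_ge0 ?powR_ge0.
- by rewrite mulr_ge0 ?powR_ge0 // addr_ge0 ?(ltW A10) ?(ltW A20).
have N2 : ((2 * 2 ^ s.+2).+1%:R : R) `^ gam p <= 8 `^ gam p * 2 `^ (s.+1%:R * gam p).
  rewrite powRrM powR2_nat -powRM // -natrM ge0_ler_powR ?gam_ge0 ?nnegrE // ler_nat.
  have : (0 < 2 ^ s)%N by rewrite expn_gt0.
  by rewrite !expnS; clear; lia.
have H2 : (2 * h) `^ r = 2 `^ (- (s.+1%:R * r)).
  rewrite -mulNr powRrM powRN powR2_nat /h; congr (_ `^ _).
  by rewrite expnS natrM invfM mulrA divff ?mul1r.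
rewrite H2; apply: (@le_trans _ _ (A2 * 2 `^ (- (s.+1%:R * (r - gam p))))); last first.
  by rewrite ler_wpM2r ?powR_ge0 // lerDr ltW.
have -> : - (s.+1%:R * (r - gam p)) = s.+1%:R * gam p + - (s.+1%:R * r) :> R by ring.
rewrite powRD_gt0 // /A2; exact: block_energy_const.
Qed.

End dyadic_blocks.

(** * Admissible approximants and smooth cutoffs *)

Section approximants.
Variable R : realType.
Local Notation C := R[i].
Local Notation normc := ComplexField.Normc.normc.
Local Notation t := (Num.sqrt 2 : R).

Lemma Binf1_norm_le (g : R -> C) (b : nat -> R) (K : R) :
  (forall s, (Tnorm +oo%E (sigma_blk s g) <= (b s)%:E)%E) ->
  (forall N, \sum_(s < N) b s <= K) -> (Binf1_norm g <= K%:E)%E.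
Proof.
move=> hb hK; rewrite /Binf1_norm; apply: lime_le.
  by apply: is_cvg_nneseries => s _ _; exact: Tnorm_ge0.
apply: nearW => N; rewrite /=.
apply: (@le_trans _ _ (\sum_(0 <= s < N) (b s)%:E)%E); first exact: lee_sum.
by rewrite sumEFin lee_fin big_mkord.
Qed.

Lemma tp_band D D' (c : int -> C) x : bandlim D c -> bandlim D' c -> tp D c x = tp D' c x.
Proof.
move=> h h'; rewrite -(tp_widen x (leq_maxl D D') h).
by rewrite (tp_widen x (leq_maxr D D') h').
Qed.

(** [em_fun] asks for exactly m distinct frequencies; a shorter list is freed of repetitions and
    padded with integers beyond all of its entries. *)
Lemma extend_uniq (s : seq int) (m : nat) : (size s <= m)%N ->
  exists Th : seq int, [/\ uniq Th, size Th = m & {subset s <= Th}].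
Proof.
move=> sm; pose N := (\max_(n <- s) absz n).+1.
pose s2 := [seq (N + i)%:Z | i <- iota 0 (m - size (undup s))].
have su : (size (undup s) <= m)%N by exact: leq_trans (size_undup s) sm.
exists (undup s ++ s2); split.
- rewrite cat_uniq undup_uniq /= map_inj_uniq ?iota_uniq; last by move=> i j; lia.
  rewrite andbT; apply/hasPn => _ /mapP[i _ ->]; rewrite mem_undup; apply/negP => h.
  have : (absz (N + i)%:Z <= \max_(n <- s) absz n)%N by exact: leq_bigmax_seq.
  by rewrite /N /=; lia.
- by rewrite size_cat size_map size_iota subnKC.
- by move=> n ns; rewrite mem_cat mem_undup ns.
Qed.

Lemma em_fun_le (f : R -> C) (m : nat) (Q : int -> C) (Th : seq int) (E : nat) :
  bandlim E Q -> (forall n, n \notin Th -> Q n = 0) -> (size Th <= m)%N ->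
  (em_fun m f <= Binf1_norm (fun x => (f x - tp E Q x)%R))%E.
Proof.
move=> QE QTh sTh; have [Th' [u1 u2 u3]] := extend_uniq sTh.
apply: ereal_inf_lbound; exists Th', Q; split; [exact: u1|exact: u2|].
suff e x : tp E Q x = \sum_(k <- Th') Q k * expi k x.
  by congr Binf1_norm; apply/funext => x; rewrite e.
pose U := undup (zr E ++ Th').
have [Uu zU TU] : [/\ uniq U, {subset zr E <= U} & {subset Th' <= U}].
  split; first exact: undup_uniq.
    by move=> n h; rewrite mem_undup mem_cat h.
  by move=> n h; rewrite mem_undup mem_cat h orbT.
rewrite /tp -(@sum_uniq_sub _ _ (zr E) U) ?uniq_zr //; last first.
  by move=> n _; rewrite mem_zr -ltnNge => /QE ->; rewrite mul0r.
rewrite -(@sum_uniq_sub _ _ Th' U) // => n _ nTh; rewrite QTh ?mul0r //.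
by apply: contra nTh; exact: u3.
Qed.

Lemma sigma_blk_B s (f : R -> C) E Q x : periodic2pi f -> cL1 f -> bandlim E Q ->
  sigma_blk s (fun x => f x - tp E Q x) x =
  tp (2 ^ s.+1) (fun n => (sc R s n)%:C%C * (fhat f n - Q n)) x.
Proof.
move=> fp fi QE; rewrite sigma_blk_tp.
- by apply: eq_tp => n; rewrite fhatB_tp.
- by move=> y; rewrite fp tp_D2pi.
- rewrite (_ : (fun _ => _) = (fun x => f x + -1 * tp E Q x)).
    by apply: cL1D => //; apply: cL1Z; exact: cL1_tp.
  by apply/funext => y; rewrite mulN1r.
Qed.

(** A wider cutoff, equal to 1 on the support of [sc u] for u > 1. As a multiplier it adds no
    frequencies to a sparse approximant, but it localises the error of level u, which otherwise
    could meet every block. *)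
Definition am (u : nat) (n : int) : R := vcr R (2 ^ u.+1) n - vcr R (2 ^ (u - 2)) n.

Lemma am_large u n : (2 ^ u.+2 <= `|n|)%N -> am u n = 0.
Proof.
move=> h; rewrite /am !vcr_eq0 ?subrr // -expnS // (leq_trans _ h) // leq_exp2l //; lia.
Qed.

Lemma am_small u n : (`|n| <= 2 ^ (u - 2))%N -> am u n = 0.
Proof.
move=> h; rewrite /am !vcr_eq1 ?subrr ?expn_gt0 // (leq_trans h) // leq_exp2l //; lia.
Qed.

Lemma am_sc u n : (1 < u)%N -> am u n * sc R u n = sc R u n.
Proof.
case: u => [//|[//|u]] _; have [h|h] := leqP `|n| (2 ^ u.+1).
  by rewrite sc_small // mulr0.
have [h2|h2] := leqP (2 ^ u.+3) `|n|; first by rewrite sc_large // mulr0.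
by rewrite /am vcr_eq1 ?expn_gt0 ?(ltnW h2) // vcr_eq0 ?subr0 ?mul1r // -expnS !subSS subn0 ltnW.
Qed.

Lemma am_bounded u D (c : int -> C) (B : R) : bandlim D c ->
  (forall x, normc (tp D c x) <= B) ->
  forall x, normc (tp D (fun n => (am u n)%:C%C * c n) x) <= 6 * B.
Proof.
move=> cD cB x.
have -> : tp D (fun n => (am u n)%:C%C * c n) x =
    tp D (fun n => vc R (2 ^ u.+1) n * c n) x - tp D (fun n => vc R (2 ^ (u - 2)) n * c n) x.
  by rewrite -tpB; apply: eq_tp => n; rewrite rmorphB mulrBl.
apply: le_trans (normc_sub _ _) _.
have h1 := vp_bounded (expn_gt0 2 u.+1) cD cB x.
have h2 := vp_bounded (expn_gt0 2 (u - 2)) cD cB x.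
lra.
Qed.

(** For large indices the supports are 2^(s-1) < |n| < 2^(s+1) and 2^(u-2) < |n| < 2^(u+2): only |s
    - u| <= 2 interact, a window of five. *)
Lemma sc_am_disjoint s u n : ~~ ((u < s + 3) && (s < u + 3))%N -> sc R s n * am u n = 0.
Proof.
rewrite negb_and -!leqNgt => /orP[us|su].
  have [h|h] := leqP (2 ^ s.+1) `|n|; first by rewrite sc_large // mul0r.
  by rewrite am_small ?mulr0 // ltnW // (leq_trans h) // leq_exp2l //; lia.
have [h|h] := leqP (2 ^ u.+2) `|n|; first by rewrite am_large // mulr0.
have -> : s = s.-1.+1 by lia.
by rewrite sc_small ?mul0r // ltnW // (leq_trans h) // leq_exp2l //; lia.
Qed.

Lemma sum_divn (q J : nat) (F : nat -> nat) : (0 < q)%N ->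
  (\sum_(0 <= d < q * J) F (d %/ q) = q * \sum_(0 <= i < J) F i)%N.
Proof.
move=> q0; elim: J => [|J ih]; first by rewrite muln0 !big_geq ?muln0.
rewrite (big_cat_nat _ (n := (q * J)%N)) //=; last by rewrite leq_mul2l leqnSn orbT.
rewrite ih big_nat_recr //= mulnDr; congr addn.
rewrite -{1}[(q * J)%N]add0n big_addn mulnS addnK.
rewrite (eq_big_nat _ _ (F2 := fun=> F J)) ?sum_nat_const_nat ?subn0 // => d /andP[_ dq].
by rewrite mulnC divnDMl ?divn_small ?add0n.
Qed.

Lemma sum_expn_le (J K : nat) : (J <= K.+1)%N ->
  (\sum_(0 <= i < J) 2 ^ (K - i) <= 2 ^ K.+1)%N.
Proof.
move=> JK; suff : (\sum_(0 <= i < J) 2 ^ (K - i) + 2 ^ (K.+1 - J) = 2 ^ K.+1)%N by lia.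
elim: J JK => [|J ih] JK; first by rewrite big_geq.
rewrite big_nat_recr //= -(ih (ltnW JK)) subSS -addnA; congr addn.
by rewrite subSn ?expnS; lia.
Qed.

End approximants.

(** * Distribution of the exponentials over the blocks *)

Section assembly.
Variable R : realType.
Local Notation C := R[i].
Local Notation normc := ComplexField.Normc.normc.
Local Notation t := (Num.sqrt 2 : R).

(** The slope 1 + 1/q in u - n balances two demands: above 1, so that the budgets of all levels have
    a sum of order q 2^n, and so close to 1 that half of it stays below the decay rate of the
    blocks. *)
Definition vlev (q n u : nat) : nat := (u - n + (u - n) %/ q)%N.

Definition eps (a : nat -> R) (q n u : nat) : R :=
  5000 * (1 + (vlev q n u)%:R) * t ^+ vlev q n u * a u.

Lemma blocks_approx (F : int -> C) (a : nat -> R) (q n : nat) :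
  (forall s, 0 <= a s) ->
  (forall s, \sum_(j <- zr (2 ^ s.+1)) normc ((sc R s j)%:C%C * F j) ^+ 2 <= a s ^+ 2) ->
  exists (qq : nat -> int -> C) (Th : nat -> seq int) (E : nat -> nat), forall u,
  [/\ (size (Th u) <= if (vlev q n u <= u.+1)%N then (2 ^ (u.+1 - vlev q n u)).*2 else 0)%N,
      forall j, j \notin Th u -> qq u j = 0, (2 ^ u.+1 <= E u)%N, bandlim (E u) (qq u) &
      forall x, normc (tp (E u) (fun j => (sc R u j)%:C%C * F j - qq u j) x) <= eps a q n u].
Proof.
move=> a0 hF.
have h u : exists Z : (int -> C) * seq int * nat,
  [/\ (size Z.1.2 <= if (vlev q n u <= u.+1)%N then (2 ^ (u.+1 - vlev q n u)).*2 else 0)%N,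
      forall j, j \notin Z.1.2 -> Z.1.1 j = 0, (2 ^ u.+1 <= Z.2)%N, bandlim Z.2 Z.1.1 &
      forall x, normc (tp Z.2 (fun j => (sc R u j)%:C%C * F j - Z.1.1 j) x) <= eps a q n u].
  have [qq [Th [E H]]] := sparse_approx (vlev q n u) (@bandlim_sc R u F) (a0 u) (hF u).
  by exists (qq, Th, E).
have [Z hZ] := choice h.
by exists (fun u => (Z u).1.1), (fun u => (Z u).1.2), (fun u => (Z u).2).
Qed.

(** The budget 2 * 2^(u + 1 - v) equals 2^(n + 2 - d/q), with d = u - n and the quotient rounded
    down: a geometric series in which each term occurs q times. *)
Lemma level_count (q n : nat) : (0 < q)%N ->
  (\sum_(n <= u < n + q * n.+2) (if (vlev q n u <= u.+1)%N then (2 ^ (u.+1 - vlev q n u)).*2 else 0)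
    <= q * 2 ^ n.+3)%N.
Proof.
move=> q0; rewrite -{1}[n]add0n big_addn addKn.
apply: (@leq_trans (\sum_(0 <= d < q * n.+2) 2 ^ (n.+2 - d %/ q))%N).
  rewrite big_nat [leqRHS]big_nat; apply: leq_sum => d _; rewrite /vlev addnK.
  case: ifP => // h; rewrite -muln2 -expnSr leq_exp2l //; lia.
rewrite (sum_divn n.+2 (fun i => 2 ^ (n.+2 - i))%N q0) leq_mul2l.
by rewrite sum_expn_le ?orbT.
Qed.

(** Blocks up to n are copied in full; those with n < u < S are replaced by their sparse
    approximants cut off by [am u]; the others contribute nothing to Q. The factor 36 = 6 * 6 is the
    price of the multipliers [sc s] and [am u]. *)
Lemma upper_assembly (F : int -> C) (a : nat -> R) (q n : nat) : (0 < q)%N -> (1 < n)%N ->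
  (forall s, 0 <= a s) ->
  (forall s, \sum_(j <- zr (2 ^ s.+1)) normc ((sc R s j)%:C%C * F j) ^+ 2 <= a s ^+ 2) ->
  exists (Q : int -> C) (Th : seq int) (E : nat),
  [/\ bandlim E Q, forall j, j \notin Th -> Q j = 0, (size Th <= q.+1 * 2 ^ n.+3)%N &
    forall s x, normc (tp (2 ^ s.+1) (fun j => (sc R s j)%:C%C * (F j - Q j)) x) <=
      \sum_(u < (s + 3)%N | ((n < u) && (s < u + 3))%N) 36 * eps a q n u].
Proof.
move=> q0 n1 a0 hF; have [qq [Th [E hE]]] := blocks_approx q n a0 hF.
pose c u j : C := (sc R u j)%:C%C * F j.
(* From S on, (u - n) / q is at least n + 2, so the level exceeds u + 1 and the budget is empty. *)
pose S := (n + q * n.+2)%N.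
have nS : (n < S)%N by rewrite /S; move: q0; clear; nia.
have qqS u j : (S <= u)%N -> qq u j = 0.
  move=> Su; have [sz h _ _ _] := hE u; apply: h; move: sz.
  rewrite ifF; first by rewrite leqn0 => /nilP ->.
  apply/negbTE; rewrite -ltnNge /vlev.
  have : (n.+2 <= (u - n) %/ q)%N by rewrite leq_divRL // mulnC; move: Su; rewrite /S; clear; lia.
  by move: nS Su; clear; lia.
pose Q j : C := \sum_(0 <= u < n.+1) c u j + \sum_(n.+1 <= u < S) (am R u j)%:C%C * qq u j.
pose ThQ := zr (2 ^ n.+1) ++ flatten [seq Th u | u <- index_iota n.+1 S].
have QTh j : j \notin ThQ -> Q j = 0.
  rewrite mem_cat negb_or mem_zr -ltnNge => /andP[jn jT].
  rewrite /Q !big1_seq ?addr0 // => u /andP[_]; rewrite mem_index_iota => /andP[u1 u2].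
    have [_ h _ _ _] := hE u; rewrite h ?mulr0 //; apply: contra jT => jT.
    by apply/flattenP; exists (Th u) => //; apply/mapP; exists u; rewrite ?mem_index_iota ?u1 ?u2.
  by rewrite /c sc_large ?mul0r // (leq_trans _ (ltnW jn)) // leq_exp2l.
have QE : bandlim (2 ^ S.+2) Q.
  move=> j jS; rewrite /Q !big1_seq ?addr0 // => u /andP[_]; rewrite mem_index_iota => /andP[u1 u2].
    by rewrite am_large ?mul0r // (leq_trans _ (ltnW jS)) // leq_exp2l // !ltnS ltnW.
  rewrite /c sc_large ?mul0r // (leq_trans _ (ltnW jS)) // leq_exp2l //.
  by move: u2 nS; clear; lia.
exists Q, ThQ, (2 ^ S.+2)%N; split => //.
  rewrite size_cat size_zr size_flatten sumnE !big_map.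
  have h1 : (\sum_(n.+1 <= u < S) size (Th u) <= q * 2 ^ n.+3)%N.
    apply: leq_trans (level_count n q0); rewrite -/S [leqRHS]big_ltn //.
    by apply: leq_trans (leq_addl _ _); apply: leq_sum => u _; have [] := hE u.
  apply: leq_trans (leq_add (leqnn _) h1) _; rewrite mulSn leq_add2r !expnS.
  by have := expn_gt0 2 n; clear; lia.
move=> s x; pose G u j : C := (sc R s j)%:C%C * ((am R u j)%:C%C * (c u j - qq u j)).
have key j : (sc R s j)%:C%C * (F j - Q j) =
    \sum_(u < (s + 3)%N | ((n < u) && (s < u + 3))%N) G u j.
  (* U covers the levels used in Q and the window of s, and on the support of [sc s] the blocks
     below U sum to F. *)
  pose U := maxn S (s + 3).
  have SU : (S <= U)%N by rewrite leq_maxl.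
  have sU : (s + 3 <= U)%N by rewrite leq_maxr.
  transitivity (\sum_(n.+1 <= u < U) G u j).
    have [j0|jne] := eqVneq (sc R s j) 0.
      by rewrite j0 mul0r big1 // => u _; rewrite /G j0 mul0r.
    have js : (`|j| < 2 ^ s.+1)%N by rewrite ltnNge; apply: contra jne => /sc_large ->.
    have FE : F j = \sum_(0 <= u < U) c u j.
      have -> : U = U.-1.+1 by move: sU; clear; lia.
      rewrite -mulr_suml big_mkord -(rmorph_sum (real_complex R)) sum_sc.
      rewrite vcr_eq1 ?mul1r ?expn_gt0 // (leq_trans (ltnW js)) // leq_exp2l //.
      by move: sU; clear; lia.
    have nU : (n.+1 <= U)%N by exact: leq_trans SU.
    rewrite FE /Q (big_cat_nat _ (n := n.+1)) //= opprD addrACA subrr add0r.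
    have -> : \sum_(n.+1 <= u < S) (am R u j)%:C%C * qq u j =
        \sum_(n.+1 <= u < U) (am R u j)%:C%C * qq u j.
      rewrite [RHS](big_cat_nat _ (n := S)) //= [X in _ = _ + X]big1_seq ?addr0 //.
      by move=> u /andP[_]; rewrite mem_index_iota => /andP[Su _]; rewrite qqS ?mulr0.
    rewrite -sumrB mulr_sumr; apply: eq_big_nat => u /andP[nu _].
    rewrite /G [in RHS]mulrBr; congr (_ * (_ - _)).
    rewrite /c mulrA -rmorphM /= am_sc //; exact: ltn_trans nu.
  rewrite [LHS](_ : _ = \sum_(0 <= u < U | (n < u)%N) G u j); last first.
    rewrite [RHS](big_cat_nat _ (n := n.+1)) //=; last by exact: leq_trans SU.
    rewrite [X in _ = X + _]big1_seq ?add0r; last first.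
      by move=> u /andP[nu]; rewrite mem_index_iota ltnS => /andP[_]; rewrite leqNgt nu.
    rewrite big_nat [RHS]big_nat_cond; apply: eq_bigl => u.
    by case: (n < u)%N; rewrite ?andbF ?andbT.
  rewrite -(big_mkord (fun u => (n < u) && (s < u + 3))%N (fun u => G u j)).
  rewrite (big_cat_nat _ (n := (s + 3)%N)) //= [X in _ + X]big1_seq ?addr0; last first.
    move=> u /andP[_]; rewrite mem_index_iota => /andP[su _].
    by rewrite /G mulrA -rmorphM /= sc_am_disjoint ?mul0r // ltnNge su.
  rewrite [LHS]big_mkcond [RHS]big_mkcond; apply: eq_big_nat => u /andP[_ us].
  case: (n < u)%N => //=; case: ifPn => // su.
  by rewrite /G mulrA -rmorphM /= sc_am_disjoint ?mul0r // us.
have -> : tp (2 ^ s.+1) (fun j => (sc R s j)%:C%C * (F j - Q j)) x =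
    \sum_(u < (s + 3)%N | ((n < u) && (s < u + 3))%N) tp (2 ^ s.+1) (G u) x.
  rewrite /tp exchange_big /=; apply: eq_bigr => j _; by rewrite key mulr_suml.
apply: le_trans (normc_sum _ _ _) _; apply: ler_sum => u _.
have [_ _ Eu1 Eu2 Eu3] := hE u.
have cE : bandlim (E u) (fun j => c u j - qq u j).
  by move=> j jE; rewrite /c bandlim_sc ?Eu2 ?subrr //; exact: leq_ltn_trans jE.
have aE : bandlim (E u) (fun j => (am R u j)%:C%C * (c u j - qq u j)).
  by move=> j jE; rewrite cE ?mulr0.
have := sc_bounded s aE (am_bounded u cE Eu3) x.
rewrite (@tp_band _ (E u) (2 ^ s.+1)).
- by rewrite mulrA (_ : 6 * 6 = 36) //; ring.
- by move=> j jE; rewrite aE ?mulr0.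
- exact: bandlim_sc.
Qed.

End assembly.

(** * Summation over the blocks and the upper bound *)

Section upper_estimate.
Variable R : realType.
Local Notation C := R[i].
Local Notation normc := ComplexField.Normc.normc.
Local Notation t := (Num.sqrt 2 : R).

Lemma bernoulli_le (h : R) (d : nat) : 0 <= h -> 1 + d%:R * h <= (1 + h) ^+ d.
Proof.
move=> h0; elim: d => [|d ih]; first by rewrite mul0r addr0 expr0.
rewrite exprS -natr1; have d0 : (0 : R) <= d%:R by [].
have : (1 + h) * (1 + d%:R * h) <= (1 + h) * (1 + h) ^+ d by rewrite ler_wpM2l //; lra.
have : 0 <= d%:R * h * h by rewrite !mulr_ge0.
by move: ((1 + h) ^+ d) (d%:R) => P D; nra.
Qed.

(** With x = 1 / (1 + h), Bernoulli's inequality bounds 1 + 2 d by (1 + 2/h)(1 + h)^d. *)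
Lemma linear_le_geom (x : R) : 0 < x < 1 -> exists2 K : R, 0 < K &
  forall d : nat, (1 + 2 * d%:R) * x ^+ d <= K.
Proof.
move=> /andP[x0 x1]; pose h := x^-1 - 1.
have h0 : 0 < h by rewrite subr_gt0 invf_gt1.
exists (1 + 2 / h); first by rewrite addr_gt0 // divr_gt0.
move=> d; have xE : x = (1 + h)^-1 by rewrite /h addrC subrK invrK.
have hd : 0 < (1 + h) ^+ d by rewrite exprn_gt0 // addr_gt0.
rewrite xE exprVn ler_pdivrMr //.
have D0 : (0 : R) <= d%:R by [].
have B := bernoulli_le d (ltW h0).
apply: (@le_trans _ _ ((1 + 2 / h) * (1 + d%:R * h))).
  have -> : (1 + 2 / h) * (1 + d%:R * h) = 1 + 2 * d%:R + (d%:R * h + 2 / h) by field; rewrite gt_eqF.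
  by rewrite lerDl addr_ge0 ?mulr_ge0 ?invr_ge0 // ltW.
by rewrite ler_wpM2l // addr_ge0 // divr_ge0 // ltW.
Qed.

Lemma sqrt2X_powR (v : nat) : t ^+ v = 2 `^ (v%:R / 2).
Proof. by rewrite -powR12_sqrt // -powR_mulrn ?powR_ge0 // -powRrM mulrC. Qed.

Definition geo (A rr : R) (s : nat) : R := A * 2 `^ (- (s%:R * rr)).

(** The gap rr > 1/2 admits q with 1/q < 2 rr - 1, so the error decays at the positive rate kap = rr
    - (1 + 1/q)/2 in d = u - n. One half of this rate, a factor x^d, absorbs 1 + v <= 1 + 2 d, the
    other half is kept. *)
Lemma eps_geom (A rr : R) : 0 <= A -> 2^-1 < rr -> exists (q : nat) (x B : R),
  [/\ (0 < q)%N, 0 < x < 1, 0 <= B & forall n u, (n <= u)%N ->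
     eps (geo A rr) q n u <= B * 2 `^ (- (n%:R * rr)) * x ^+ (u - n)].
Proof.
move=> A0 rr2; rewrite /eps; move: (5000 : R) (ler0n R 5000) => c5 c50.
pose q := (Num.trunc (2 * rr - 1)^-1).+1.
have q0 : (0 : R) < q%:R by rewrite ltr0n.
have rp : 0 < 2 * rr - 1 by lra.
have qr : q%:R^-1 < 2 * rr - 1.
  rewrite -[ltRHS]invrK ltf_pV2 ?posrE ?invr_gt0 //; apply: truncnS_gt.
pose kap : R := rr - (1 + q%:R^-1) / 2; have kap0 : 0 < kap by rewrite /kap; lra.
pose x : R := 2 `^ (- (kap / 2)).
have x01 : 0 < x < 1.
  rewrite powR_gt0 //= /x /powR pnatr_eq0 /= expR_lt1 mulNr oppr_lt0.
  by rewrite mulr_gt0 ?ln_gt0 ?ltr1n // divr_gt0.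
have [K K0 hK] := linear_le_geom x01.
exists q, x, (c5 * A * K); split => //; first by rewrite mulr_ge0 ?mulr_ge0 // ltW.
move=> n u nu; rewrite /vlev /geo; set d := (u - n)%N.
have -> : u = (n + d)%N by rewrite subnKC.
have dq : ((d %/ q)%:R : R) <= d%:R / q%:R.
  by rewrite ler_pdivlMr // -natrM ler_nat leq_trunc_div.
have dq1 : ((d %/ q)%:R : R) <= d%:R by rewrite ler_nat leq_div.
rewrite sqrt2X_powR !natrD.
have e1 : 2 `^ ((d%:R + (d %/ q)%:R) / 2) * 2 `^ (- ((n%:R + d%:R) * rr)) <=
    2 `^ (- (n%:R * rr)) * x ^+ d * x ^+ d :> R.
  have -> : 2 `^ (- (n%:R * rr)) * x ^+ d * x ^+ d = 2 `^ (- (n%:R * rr) - d%:R * kap) :> R.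
    rewrite -mulrA -exprD -powR_mulrn ?powR_ge0 // -powRrM -powRD_gt0 // natrD.
    by congr (_ `^ _); field.
  rewrite -powRD_gt0 // ler_powR ?ler1n // /kap.
  have : d%:R / q%:R = d%:R * q%:R^-1 :> R by [].
  move: dq; move: ((d %/ q)%:R) (d%:R) (n%:R) (q%:R^-1) => a b c e h1 _; nra.
apply: (@le_trans _ _ (c5 * (1 + 2 * d%:R) * (A * (2 `^ (- (n%:R * rr)) * x ^+ d * x ^+ d)))).
  have -> : c5 * (1 + (d%:R + (d %/ q)%:R)) * 2 `^ ((d%:R + (d %/ q)%:R) / 2) *
      (A * 2 `^ (- ((n%:R + d%:R) * rr))) = c5 * (1 + (d%:R + (d %/ q)%:R)) *
      (A * (2 `^ ((d%:R + (d %/ q)%:R) / 2) * 2 `^ (- ((n%:R + d%:R) * rr)))) :> R by ring.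
  apply: ler_pM; rewrite ?mulr_ge0 ?powR_ge0 ?addr_ge0 //.
    by rewrite ler_wpM2l // lerD2l mulr2n mulrDl mul1r lerD2l.
  by rewrite ler_wpM2l.
have -> : c5 * (1 + 2 * d%:R) * (A * (2 `^ (- (n%:R * rr)) * x ^+ d * x ^+ d)) =
  c5 * A * 2 `^ (- (n%:R * rr)) * x ^+ d * ((1 + 2 * d%:R) * x ^+ d) :> R by ring.
have -> : c5 * A * K * 2 `^ (- (n%:R * rr)) * x ^+ d =
  c5 * A * 2 `^ (- (n%:R * rr)) * x ^+ d * K :> R by ring.
rewrite ler_wpM2l // mulr_ge0 ?exprn_ge0 ?powR_ge0 // mulr_ge0 ?powR_ge0 // mulr_ge0 //.
Qed.

Lemma sum_window (s : nat) (z : R) (P : pred nat) : 0 <= z ->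
  (forall u, P u -> (s < u + 3)%N) -> \sum_(u < (s + 3)%N | P u) z <= 5 * z.
Proof.
move=> z0 hP; rewrite -(big_mkord P (fun=> z)).
rewrite (big_cat_nat _ (n := (s - 2)%N)) //=; last lia.
rewrite big1_seq ?add0r; last first.
  by move=> u /andP[/hP h]; rewrite mem_index_iota => /andP[_]; lia.
apply: (@le_trans _ _ (\sum_(s - 2 <= u < s + 3) z)).
  by rewrite big_mkcond; apply: ler_sum => u _; case: ifP.
by rewrite sumr_const_nat -[leLHS]mulr_natl ler_wpM2r // ler_nat; lia.
Qed.

Lemma sum_geom_from (x : R) (n N : nat) : 0 < x < 1 ->
  \sum_(s < N) (if (n <= s.+1)%N then x ^+ (s.+1 - n) else 0) <= (1 - x)^-1.
Proof.
move=> /andP[x0 x1]; have d0 : 0 < 1 - x by lra.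
rewrite -[leRHS]mul1r ler_pdivlMr // mulrC.
suff : (1 - x) * \sum_(s < N) (if (n <= s.+1)%N then x ^+ (s.+1 - n) else 0) <= 1 - x ^+ (N.+1 - n).
  by have : 0 <= x ^+ (N.+1 - n) by [rewrite exprn_ge0 // ltW]; lra.
elim: N => [|N ih].
  rewrite big_ord0 mulr0 subr_ge0 exprn_ile1 // ltW //.
rewrite big_ord_recr /= mulrDr; apply: le_trans (lerD ih (lexx _)) _.
case: ifP => nN; last first.
  have e1 : (N.+1 - n = 0)%N by move: nN; clear; lia.
  have e2 : (N.+2 - n = 0)%N by move: nN; clear; lia.
  by rewrite mulr0 addr0 e1 e2.
have -> : (N.+2 - n = (N.+1 - n).+1)%N by rewrite subSn.
by rewrite exprS; move: (x ^+ _) => y; lra.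
Qed.


Lemma sum_geom_le (x : R) (N : nat) : 0 < x < 1 -> \sum_(s < N) x ^+ s <= (1 - x)^-1.
Proof.
move=> x01; have := sum_geom_from 1 N x01; congr (_ <= _).
by apply: eq_bigr => s _; rewrite subSS subn0.
Qed.

(* For m below the threshold the zero approximant is good enough. *)
Lemma Binf1_besov_bounded (f : R -> C) (A rr : R) : periodic2pi f -> cL1 f -> 0 <= A -> 2^-1 < rr ->
  (forall s, \sum_(j <- zr (2 ^ s.+1)) normc ((sc R s j)%:C%C * fhat f j) ^+ 2 <= geo A rr s ^+ 2) ->
  (Binf1_norm (fun x => f x - tp 0 (fun=> 0%R) x)%R <=
     (2 * t * A / (1 - 2 `^ (2^-1 - rr)))%:E)%E.
Proof.
move=> fp fi A0 rr2 hf; pose z : R := 2 `^ (2^-1 - rr).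
have z01 : 0 < z < 1.
  rewrite powR_gt0 //= /z /powR pnatr_eq0 /= expR_lt1 -opprB mulNr oppr_lt0.
  by rewrite mulr_gt0 ?ln_gt0 ?ltr1n // subr_gt0.
apply: (@Binf1_norm_le _ _ (fun s => 2 * t * A * z ^+ s)).
  move=> s; apply: Tnorm_oo_le => x; rewrite sigma_blk_B //.
  have g0 : 0 <= geo A rr s by rewrite mulr_ge0 ?powR_ge0.
  apply: le_trans (normc_tp _ _ _) _.
  apply: (@le_trans _ _ (\sum_(n <- zr (2 ^ s.+1)) normc ((sc R s n)%:C%C * fhat f n))).
    by apply: ler_sum => n _; rewrite subr0.
  apply: le_trans (l1_le_l2 g0 (hf s)) _.
  rewrite le_eqVlt; apply/orP; left; apply/eqP; rewrite exprS /geo.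
  have -> : z ^+ s = t ^+ s * 2 `^ (- (s%:R * rr)).
    rewrite /z -powR_mulrn ?powR_ge0 // -powRrM sqrt2X_powR -powRD_gt0 //.
    by congr (_ `^ _); ring.
  by ring.
move=> N; rewrite -mulr_sumr ler_wpM2l ?sum_geom_le // mulr_ge0 // mulr_ge0 // sqrtr_ge0.
Qed.

(** Block s sees at most five levels u, all with u >= s - 2, whence 180 = 5 * 36 and the loss
    x^(-3). Blocks with s + 1 < n see none: they are reproduced exactly. *)
Lemma Binf1_approx (f : R -> C) (A rr : R) (q n : nat) (x B : R) :
  periodic2pi f -> cL1 f -> 0 <= A -> (0 < q)%N -> (1 < n)%N -> 0 < x < 1 -> 0 <= B ->
  (forall s, \sum_(j <- zr (2 ^ s.+1)) normc ((sc R s j)%:C%C * fhat f j) ^+ 2 <= geo A rr s ^+ 2) ->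
  (forall u, (n <= u)%N -> eps (geo A rr) q n u <= B * x ^+ (u - n)) ->
  forall m, (q.+1 * 2 ^ n.+3 <= m)%N ->
  (em_fun m f <= (180 * B * x ^- 3 / (1 - x))%:E)%E.
Proof.
move=> fp fi A0 q0 n1 x01 B0 hf hB m hm; case/andP: (x01) => x0 x1.
have g0 s : 0 <= geo A rr s by rewrite mulr_ge0 ?powR_ge0.
have [Q [Th [E [QE QTh sTh hQ]]]] := upper_assembly q0 n1 g0 hf.
apply: le_trans (em_fun_le f QE QTh (leq_trans sTh hm)) _.
have x3 : 0 < x ^- 3 by rewrite invr_gt0 exprn_gt0.
pose b s := 180 * B * x ^- 3 * (if (n <= s.+1)%N then x ^+ (s.+1 - n) else 0).
apply: (@Binf1_norm_le _ _ b).
  move=> s; apply: Tnorm_oo_le => y; rewrite sigma_blk_B //; apply: le_trans (hQ s y) _.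
  rewrite /b; case: ifPn => ns; last first.
    rewrite mulr0 big1 // => u /andP[nu _]; exfalso.
    by move: ns nu (ltn_ord u); clear; lia.
  apply: (@le_trans _ _ (\sum_(u < (s + 3)%N | ((n < u) && (s < u + 3))%N)
      36 * (B * (x ^- 3 * x ^+ (s.+1 - n))))).
    apply: ler_sum => u /andP[nu su]; rewrite ler_wpM2l //.
    apply: le_trans (hB u (ltnW nu)) _; rewrite ler_wpM2l //.
    rewrite mulrC ler_pdivlMr ?exprn_gt0 // -exprD; apply: ler_wiXn2l; rewrite ?(ltW x0) ?(ltW x1) //.
    by move: nu su; clear; lia.
  apply: le_trans (@sum_window s _ (fun u => (n < u) && (s < u + 3))%N _ _) _.
  - by rewrite !mulr_ge0 // ?(ltW x3) // exprn_ge0 // ltW.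
  - by move=> u /andP[].
  by rewrite le_eqVlt; apply/orP; left; apply/eqP; ring.
move=> N; rewrite -mulr_sumr ler_wpM2l ?sum_geom_from //.
by rewrite mulr_ge0 ?(ltW x3) // mulr_ge0.
Qed.

Lemma upper_bound (p theta : \bar R) (r : R) (k : nat) : (1 <= p)%E -> (1 <= theta)%E ->
  Num.max (einv p) 2^-1 < r ->
  exists2 K : R, 0 < K & forall m, (0 < m)%N ->
    (em_class m (besov_class k r p theta) <= (K * m%:R `^ (- (r - gam p)))%:E)%E.
Proof.
move=> p1 th1; rewrite gt_max => /andP[rp r2].
have r0 : 0 < r by lra.
have rr2 : 2^-1 < r - gam p by rewrite /gam; case: (leP (einv p - 2^-1) 0) => _; lra.
set rr := r - gam p in rr2 *; have rr0 : 0 < rr by lra.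
have [A A0 hA] := block_energy k p1 th1 r0.
have [q [x [B [q0 x01 B0 hB]]]] := eps_geom (ltW A0) rr2.
case/andP: (x01) => x0 x1.
(* Below [m0] the zero approximant is used; from [m0] on the level n chosen below is at least 2, as
   the cutoffs require. *)
pose m0 := (q.+1 * 2 ^ 5)%N.
pose K1 : R := 180 * B * x ^- 3 / (1 - x) * (q.+1 * 2 ^ 4)%:R `^ rr.
pose K2 : R := 2 * t * A / (1 - 2 `^ (2^-1 - rr)) * m0%:R `^ rr.
have K10 : 0 <= K1.
  rewrite mulr_ge0 ?powR_ge0 // divr_ge0 ?subr_ge0 ?(ltW x1) // mulr_ge0 ?mulr_ge0 //.
  by rewrite invr_ge0 exprn_ge0 // ltW.
have z1 : (2 : R) `^ (2^-1 - rr) < 1.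
  rewrite /powR pnatr_eq0 /= expR_lt1 -opprB mulNr oppr_lt0.
  by rewrite mulr_gt0 ?ln_gt0 ?ltr1n // subr_gt0.
have K20 : 0 <= K2.
  by rewrite mulr_ge0 ?powR_ge0 // divr_ge0 ?subr_ge0 ?(ltW z1) // !mulr_ge0 ?sqrtr_ge0 // ltW.
exists (K1 + K2 + 1); first by lra.
move=> m mp; have M0 : (0 : R) < m%:R by rewrite ltr0n.
apply: ub_ereal_sup => _ [f fB <-]; have fi := in_Lp_cL1 p1 fB.1; have fp := fB.1.1.
have P0 : 0 < m%:R `^ (- rr) :> R by rewrite powR_gt0.
have scale (a b : R) : 0 <= a -> m%:R <= b -> a <= a * b `^ rr * m%:R `^ (- rr).
  move=> a0 mb; rewrite -mulrA ler_peMr // powRN ler_pdivlMr ?powR_gt0 // mul1r.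
  by rewrite ge0_ler_powR ?nnegrE ?(ltW rr0) ?(ltW M0) // (le_trans (ltW M0)).
have [mm|mm] := ltnP m m0.
  have e0 : bandlim 0 (fun=> 0 : C) by [].
  apply: le_trans (@em_fun_le _ f m (fun=> 0) [::] 0 e0 _ _) _ => //.
  apply: le_trans (Binf1_besov_bounded fp fi (ltW A0) rr2 (hA f fB)) _.
  rewrite lee_fin; apply: (@le_trans _ _ (K2 * m%:R `^ (- rr))).
    apply: scale; last by rewrite ler_nat ltnW.
    by rewrite divr_ge0 ?subr_ge0 ?(ltW z1) // !mulr_ge0 ?sqrtr_ge0 // ltW.
  by rewrite ler_wpM2r ?(ltW P0) //; lra.
(* The largest n with (q + 1) 2^(n+3) <= m; then m is at most (q + 1) 2^(n+4), so 2^n and m are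
   comparable. *)
pose j := (m %/ (q.+1 * 2 ^ 3))%N; pose n := trunc_log 2 j.
have j4 : (4 <= j)%N by rewrite leq_divRL // (leq_trans _ mm) // /m0 mulnCA mulnA mulnC.
have jp : (0 < j)%N by exact: leq_trans j4.
have /andP[n1 n2] := trunc_log_bounds (ltnSn 1) jp.
have n2' : (1 < n)%N.
  by have := leq_ltn_trans j4 n2; rewrite -/n -[4%N]/(2 ^ 2)%N ltn_exp2l // ltnS.
have hm : (q.+1 * 2 ^ n.+3 <= m)%N.
  apply: leq_trans (leq_trunc_div m (q.+1 * 2 ^ 3)); rewrite -/j.
  by rewrite -addn3 expnD mulnCA leq_mul2r n1 orbT.
have hm2 : (m <= q.+1 * 2 ^ 4 * 2 ^ n)%N.
  have h : (m < j.+1 * (q.+1 * 2 ^ 3))%N by apply: ltn_ceil.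
  apply: leq_trans (ltnW h) _.
  have -> : (q.+1 * 2 ^ 4 * 2 ^ n = 2 ^ n.+1 * (q.+1 * 2 ^ 3))%N.
    by rewrite (expnSr 2 3) mulnA -mulnA -expnS mulnC.
  by rewrite leq_mul2r n2 orbT.
have hB' u : (n <= u)%N -> eps (geo A rr) q n u <= B * 2 `^ (- (n%:R * rr)) * x ^+ (u - n).
  exact: hB.
have B0' : 0 <= B * 2 `^ (- (n%:R * rr)) by rewrite mulr_ge0 ?powR_ge0.
apply: le_trans (Binf1_approx fp fi (ltW A0) q0 n2' x01 B0' (hA f fB) hB' hm) _.
rewrite lee_fin; apply: (@le_trans _ _ (K1 * m%:R `^ (- rr))); last first.
  by rewrite ler_wpM2r ?(ltW P0) //; lra.
have c0 : 0 <= 180 * B * x ^- 3 / (1 - x).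
  rewrite divr_ge0 ?subr_ge0 ?(ltW x1) // mulr_ge0 ?mulr_ge0 //.
  by rewrite invr_ge0 exprn_ge0 // ltW.
have -> : 180 * (B * 2 `^ (- (n%:R * rr))) * x ^- 3 / (1 - x) =
   180 * B * x ^- 3 / (1 - x) * 2 `^ (- (n%:R * rr)) by ring.
rewrite /K1; move: (180 * B * x ^- 3 / (1 - x)) c0 => cc cc0.
rewrite -[leRHS]mulrA ler_wpM2l // !powRN powRrM powR2_nat.
rewrite ler_pdivlMr ?powR_gt0 // mulrC ler_pdivrMr ?powR_gt0 ?ltr0n ?expn_gt0 //.
by rewrite -powRM // -natrM ge0_ler_powR ?nnegrE ?(ltW rr0) // ler_nat.
Qed.

End upper_estimate.

(** * Surviving coefficients and best approximation from below *)

Section approximation_from_below.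
Variable R : realType.
Local Notation C := R[i].
Local Notation normc := ComplexField.Normc.normc.
Local Notation mu := (@torus_measure R).

(** Contraposition of [bessel_Lp] at p = oo: a sup norm below y/4 would force the energy down to y^2
    / 4. *)
Lemma Tnorm_oo_ge_l2 D (c : int -> C) (y : R) : 0 < y ->
  y ^+ 2 <= \sum_(n <- zr D) normc (c n) ^+ 2 -> ((y / 4)%:E <= Tnorm +oo%E (tp D c))%E.
Proof.
move=> y0 hy; rewrite leNgt; apply/negP => h.
have y4 : 0 < y / 4 by rewrite divr_gt0.
have := @bessel_Lp R +oo%E _ D _ (leey _) (@cL1_tp R D c) y4 (ltW h).
have -> : gam (+oo%E : \bar R) = 0 by rewrite /gam /= max_r //; lra.
rewrite powRr0 (eq_big_seq (fun n => normc (c n) ^+ 2)); last first.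
  by move=> n; rewrite mem_zr => nD; rewrite fhat_tp nD.
move=> h2; have := le_trans hy h2; rewrite -subr_ge0.
have : 0 < y ^+ 2 by rewrite exprn_gt0.
by rewrite mulr1 !exprMn; nra.
Qed.

Lemma le_Binf1_norm (g : R -> C) s : (Tnorm +oo%E (sigma_blk s g) <= Binf1_norm g)%E.
Proof.
rewrite /Binf1_norm; have := @nneseries_lim_ge R (fun s => Tnorm +oo%E (sigma_blk s g)) xpredT 0 s.+1.
move=> /(_ (fun s _ _ => Tnorm_ge0 _ _)); apply: le_trans.
by rewrite big_nat_recr //= leeDr // sume_ge0 // => i _; exact: Tnorm_ge0.
Qed.

Lemma size_filter_notin (T : eqType) (s t : seq T) : uniq s ->
  (size s - size t <= size [seq x <- s | x \notin t])%N.
Proof.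
move=> us; rewrite leq_subLR -(count_predC (mem t) s) !size_filter leq_add2r -size_filter.
by apply: uniq_leq_size; rewrite ?filter_uniq // => x; rewrite mem_filter => /andP[].
Qed.

Lemma ler_sum_uniq_sub (I : eqType) (s s' : seq I) (F : I -> R) :
  uniq s -> uniq s' -> {subset s <= s'} -> (forall i, 0 <= F i) ->
  \sum_(i <- s) F i <= \sum_(i <- s') F i.
Proof.
move=> us us' ss F0; pose F' i := if i \in s then F i else 0.
apply: (@le_trans _ _ (\sum_(i <- s') F' i)); last first.
  by apply: ler_sum => i _; rewrite /F'; case: ifP.
rewrite (@sum_uniq_sub _ _ s s') //; last by move=> i _ /negbTE; rewrite /F' => ->.
by rewrite big_seq [leRHS]big_seq; apply: ler_sum => i is_; rewrite /F' is_.
Qed.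

(** The lower kernel has already vanished here and the upper one has lost at most half. *)
Lemma sc_ge_half s (n : int) : (2 ^ s.+1 <= `|n| <= 2 ^ s.+1 + 2 ^ s)%N -> 2^-1 <= sc R s.+1 n.
Proof.
move=> /andP[n1 n2]; rewrite /= (@vcr_eq0 _ (2 ^ s)) ?subr0; last by rewrite -expnS.
by apply: vcr_ge_half; rewrite ?expn_gt0 //; move: n2; rewrite expnS; move: (2 ^ s)%N => N; lia.
Qed.

(** Of the 2^s frequencies in [La], at least 2^(s-1) avoid Theta; each keeps a coefficient H / 2 in
    block s + 1. Their energy exceeds (H sqrt(2^s) / 4)^2, and the step to the sup norm costs the
    second 4 of 16. *)
Lemma em_fun_ge D (phi : int -> C) s m (H : R) : bandlim D phi -> 0 < H -> (2 * m <= 2 ^ s)%N ->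
  (forall n, (2 ^ s.+1 <= `|n| <= 2 ^ s.+1 + 2 ^ s)%N -> 0 <= n -> H <= normc (phi n)) ->
  ((H * Num.sqrt (2 ^ s)%:R / 16)%:E <= em_fun m (tp D phi))%E.
Proof.
move=> bp H0 ms hH; apply: le_ereal_inf_tmp => _ [Th [c [uTh sTh ->]]].
pose q n : C := if n \in Th then c n else 0.
pose E := \max_(n <- Th) `|n|%N.
have Eub n : n \in Th -> (`|n| <= E)%N by move=> nT; rewrite /E (big_rem n) //= leq_maxl.
have bq : bandlim E q.
  move=> n nE; rewrite /q ifF //; apply/negP => /Eub; lia.
have tpq x : \sum_(k <- Th) c k * expi k x = tp E q x.
  rewrite /tp (@sum_uniq_sub _ _ Th (zr E)) ?uniq_zr //.
  - by apply: eq_big_seq => n nT; rewrite /q nT.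
  - by move=> n /Eub; rewrite mem_zr.
  - by move=> n _ /negbTE nT; rewrite /q nT mul0r.
have -> : (fun x => tp D phi x - \sum_(k <- Th) c k * expi k x) = (fun x => tp D phi x - tp E q x).
  by apply/funext => x; rewrite tpq.
apply: le_trans (le_Binf1_norm _ s.+1).
have -> : sigma_blk s.+1 (fun x => tp D phi x - tp E q x) =
    tp (2 ^ s.+2) (fun n => (sc R s.+1 n)%:C%C * (phi n - q n)).
  apply/funext => x; rewrite sigma_blk_B //; last 2 first.
  - by move=> y; rewrite tp_D2pi.
  - exact: cL1_tp.
  by apply: eq_tp => n; rewrite fhat_tp; case: leqP => // /bp ->.
have N0 : (0 : R) < Num.sqrt (2 ^ s)%:R by rewrite sqrtr_gt0 ltr0n expn_gt0.
have -> : H * Num.sqrt (2 ^ s)%:R / 16 = H * Num.sqrt (2 ^ s)%:R / 4 / 4 by lra.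
apply: Tnorm_oo_ge_l2; first by rewrite divr_gt0 // mulr_gt0.
pose La := [seq (2 ^ s.+1 + j)%:Z | j <- iota 0 (2 ^ s)].
have uLa : uniq La by rewrite map_inj_uniq ?iota_uniq // => i j; lia.
have LaP n : n \in La -> (2 ^ s.+1 <= `|n| <= 2 ^ s.+1 + 2 ^ s)%N && (0 <= n).
  by move=> /mapP[j]; rewrite mem_iota; move: (2 ^ s.+1)%N (2 ^ s)%N => a b h ->; lia.
pose L := [seq n <- La | n \notin Th].
apply: (@le_trans _ _ (\sum_(n <- L) normc ((sc R s.+1 n)%:C%C * (phi n - q n)) ^+ 2)); last first.
  apply: ler_sum_uniq_sub; rewrite ?filter_uniq ?uniq_zr //; last by move=> i; exact: sqr_ge0.
  move=> n; rewrite mem_filter => /andP[_ /LaP/andP[/andP[_ h] _]]; rewrite mem_zr.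
  by move: h; rewrite !expnS; move: (2 ^ s)%N => a; lia.
apply: (@le_trans _ _ (\sum_(n <- L) (H / 2) ^+ 2)); last first.
  rewrite big_seq [leRHS]big_seq; apply: ler_sum => n.
  rewrite mem_filter => /andP[/negbTE nT /LaP/andP[h n0]]; rewrite /q nT subr0.
  rewrite ler_sqr ?nnegrE ?normc_ge0 //; last by rewrite divr_ge0 ?ltW.
  have sh := sc_ge_half h; have hh := hH _ h n0.
  rewrite ComplexField.Normc.normcM normc_real ger0_norm; last by apply: le_trans sh; lra.
  by rewrite mulrC; apply: ler_pM => //; lra.
rewrite big_const_seq count_predT iter_addr_0.
have sL : (2 ^ s - m <= size L)%N.
  by have := size_filter_notin Th uLa; rewrite size_map size_iota sTh.
have sL2 : (2 ^ s)%:R <= 2 * (size L)%:R :> R.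
  by rewrite -natrM ler_nat; move: sL ms; clear; lia.
rewrite -[leRHS]mulr_natr !exprMn sqr_sqrtr ?ler0n //.
have H2 : 0 < H ^+ 2 by rewrite exprn_gt0.
move: sL2; move: (H ^+ 2) H2 (2 ^ s)%:R (size L)%:R (ler0n R (size L)) => h h0 a b b0 ab.
have h1 : 0 <= h * (2 * b - a) by apply: mulr_ge0; lra.
have h2 : 0 <= h * b by apply: mulr_ge0; lra.
by lra.
Qed.

End approximation_from_below.

(** * Differences of kernels and Bernstein's inequality *)

Section differences.
Variable R : realType.
Local Notation C := R[i].
Local Notation normc := ComplexField.Normc.normc.
Local Notation mu := (@torus_measure R).
Local Arguments expi : simpl never.

Lemma normr_sin_le (x : R) : `|sin x| <= `|x|.
Proof.
wlog x0 : x / 0 <= x.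
  by move=> h; have [/h//|/ltW x0] := leP 0 x; rewrite -normrN -sinN -[leRHS]normrN h ?oppr_ge0.
have cs : {within `[0, x], continuous (@sin R)} by apply: continuous_subspaceT; exact: continuous_sin.
have [c _] := MVT_segment x0 (fun y _ => is_derive_sin y) cs.
rewrite sin0 !subr0 => ->; rewrite normrM ler_piMl // ler_norml.
by rewrite cos_geN1 cos_le1.
Qed.

Lemma normc_expiB1_le (n : int) (h : R) : normc (expi n h - 1) <= `|n%:~R * h|.
Proof.
rewrite -ler_sqr ?nnegrE ?normc_ge0 // normc_expiB1 real_normK ?num_real //.
move: (n%:~R * h) => y; pose z := y / 2.
have yE : y = z *+ 2 by rewrite /z mulr2n; lra.
have : sin z ^+ 2 <= z ^+ 2.
  by rewrite -real_normK ?num_real // -[leRHS]real_normK ?num_real // ler_sqr ?nnegrE // normr_sin_le.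
by rewrite yE cos_mulr2n cos2sin2 !mulr2n; nra.
Qed.

Lemma normc_expiB1_le2 (n : int) (h : R) : normc (expi n h - 1) <= 2.
Proof. by apply: le_trans (normc_sub _ _) _; rewrite normc_expi (normc_nat _ 1); lra. Qed.

Lemma tp_translate (D : nat) (a : int) (q : int -> C) x : bandlim D q ->
  tp (D + `|a|) (fun n => q (n - a)) x = expi a x * tp D q x.
Proof.
move=> qD; rewrite /tp (@sum_uniq_sub _ _ [seq n + a | n <- zr D]) ?uniq_zr //.
- rewrite big_map mulr_sumr; apply: eq_bigr => n _.
  by rewrite addrK expiD; ring.
- by rewrite map_inj_uniq ?uniq_zr //; exact: addIr.
- by move=> n /mapP[j]; rewrite !mem_zr => jD ->; lia.
move=> n _ nD; rewrite qD ?mul0r // ltnNge; apply: contra nD => nD.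
by apply/mapP; exists (n - a); rewrite ?mem_zr // subrK.
Qed.

Lemma Deltak_lin k h (a b : C) (f g : R -> C) x :
  Deltak k h (fun y => a * f y + b * g y) x = a * Deltak k h f x + b * Deltak k h g x.
Proof.
rewrite /Deltak; elim: k x => //= k ih x; rewrite /Delta !ih; ring.
Qed.

Lemma Deltak_tp k h D (c : int -> C) x :
  Deltak k h (tp D c) x = tp D (fun n => (expi n h - 1) ^+ k * c n) x.
Proof.
rewrite /Deltak; elim: k x => [x|k ih x] /=.
  by apply: eq_tp => n; rewrite expr0 mul1r.
by rewrite /Delta !ih tp_shift -tpB; apply: eq_tp => n; rewrite exprS; ring.
Qed.

Section difference_bounds.
Variables (M D : nat) (h eta : R).
Hypotheses (DM : (2 * D < M)%N) (eta0 : 0 < eta).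
Hypothesis heta : forall n : int, (`|n| <= D)%N -> normc (expi n h - 1) <= eta.

(** Cauchy-Schwarz as an arithmetic-geometric mean, with the weights that make both Parseval sums
    equal. *)
Lemma sum_normc_mul (c d : int -> C) (al be : R) x : 0 < al -> 0 < be ->
  \sum_(n <- zr D) normc (c n) ^+ 2 <= al ^+ 2 ->
  \sum_(n <- zr D) normc (d n) ^+ 2 <= be ^+ 2 ->
  \sum_(j < M) normc (tp D c (x - grid R M j) * tp D d (x - grid R M j)) <= M%:R * (al * be).
Proof.
move=> al0 be0 hc hd.
apply: (@le_trans _ _ (\sum_(j < M) (be / al / 2 * normc (tp D c (x - grid R M j)) ^+ 2 +
    al / be / 2 * normc (tp D d (x - grid R M j)) ^+ 2))).
  apply: ler_sum => j _; rewrite ComplexField.Normc.normcM.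
  move: (normc _) (normc _) => v u; rewrite -subr_ge0.
  have -> : be / al / 2 * u ^+ 2 + al / be / 2 * v ^+ 2 - u * v =
      (be * u - al * v) ^+ 2 / (2 * (al * be)).
    by field; rewrite !gt_eqF.
  by rewrite divr_ge0 ?sqr_ge0 // !mulr_ge0 ?ltW.
rewrite big_split -!mulr_sumr !tp_parseval //=.
have M0 : (0 : R) <= M%:R by [].
rewrite mulrCA [X in _ + X]mulrCA -mulrDr ler_wpM2l //.
apply: (@le_trans _ _ (be / al / 2 * al ^+ 2 + al / be / 2 * be ^+ 2)).
  by apply: lerD; apply: ler_wpM2l => //; rewrite !divr_ge0 ?ltW.
by rewrite le_eqVlt; apply/orP; left; apply/eqP; field; rewrite !gt_eqF.
Qed.

(* Product rule: each difference falls on one of the two factors, where it costs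
   a factor [eta] in l2. *)
Lemma sum_Deltak_mul k (c d : int -> C) (al be : R) x : 0 < al -> 0 < be ->
  \sum_(n <- zr D) normc (c n) ^+ 2 <= al ^+ 2 ->
  \sum_(n <- zr D) normc (d n) ^+ 2 <= be ^+ 2 ->
  \sum_(j < M) normc (Deltak k h (fun y => tp D c y * tp D d y) (x - grid R M j)) <=
    M%:R * ((2 * eta) ^+ k * (al * be)).
Proof.
elim: k c d al be => [|k ih] c d al be al0 be0 hc hd.
  by rewrite expr0 mul1r; exact: sum_normc_mul.
have l2D (b : int -> C) (g : R) : \sum_(n <- zr D) normc (b n) ^+ 2 <= g ^+ 2 ->
    \sum_(n <- zr D) normc ((expi n h - 1) * b n) ^+ 2 <= (eta * g) ^+ 2.
  move=> hb; rewrite exprMn; apply: le_trans (ler_wpM2l (sqr_ge0 eta) hb).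
  rewrite mulr_sumr big_seq [leRHS]big_seq; apply: ler_sum => n; rewrite mem_zr => nD.
  rewrite ComplexField.Normc.normcM exprMn ler_wpM2r ?sqr_ge0 //.
  by rewrite ler_sqr ?nnegrE ?normc_ge0 ?(ltW eta0) ?heta.
have l2s : \sum_(n <- zr D) normc (d n * expi n h) ^+ 2 <= be ^+ 2.
  by under eq_bigr do rewrite ComplexField.Normc.normcM normc_expi mulr1.
have ea : 0 < eta * al by rewrite mulr_gt0.
have eb : 0 < eta * be by rewrite mulr_gt0.
have h1 := ih _ _ _ _ ea be0 (l2D _ _ hc) l2s.
have h2 := ih _ _ _ _ al0 eb hc (l2D _ _ hd).
(* The shifted factor in the product rule keeps its l2 norm, since only the phases of its
   coefficients change. *)
have e : Delta h (fun y => tp D c y * tp D d y) = (fun y =>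
    1 * (tp D (fun n => (expi n h - 1) * c n) y * tp D (fun n => d n * expi n h) y) +
    1 * (tp D c y * tp D (fun n => (expi n h - 1) * d n) y)).
  apply/funext => y; rewrite /Delta -!tp_shift.
  have e1 (b : int -> C) : tp D (fun n => (expi n h - 1) * b n) y = tp D b (y + h) - tp D b y.
    by rewrite tp_shift -tpB; apply: eq_tp => n; ring.
  by rewrite !e1; ring.
have -> : M%:R * ((2 * eta) ^+ k.+1 * (al * be)) =
    M%:R * ((2 * eta) ^+ k * (eta * al * be)) + M%:R * ((2 * eta) ^+ k * (al * (eta * be))).
  by rewrite exprS; ring.
apply: le_trans (lerD h1 h2); rewrite -big_split /=; apply: ler_sum => j _.
rewrite [X in normc (X _) <= _](iterSr k (Delta h)) -/(Deltak k h _) e Deltak_lin !mul1r.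
exact: le_normcD.
Qed.

End difference_bounds.

(** The kernel with its spectrum moved by a: a = 0 serves Bernstein's inequality, a = 2^(s+1) the
    test functions for p < 2. *)
Definition eV (a : int) (l : nat) (x : R) : C := expi a x * vallee_poussin l x.

Lemma eV_tp a l x : eV a l x = tp (2 * l + `|a|) (fun n => vc R l (n - a)) x.
Proof. by rewrite /eV vallee_poussinE tp_translate //; exact: bandlim_vc. Qed.

Lemma eV_G a l x : eV a l x = l%:R^-1 * (expi a x * G (2 * l) x * (G (2 * l) x)^*%C) +
   - l%:R^-1 * (expi a x * G l x * (G l x)^*%C).
Proof.
rewrite /eV /vallee_poussin.
have -> : \sum_(l <= k < 2 * l) dirichlet k x =
    G (2 * l) x * (G (2 * l) x)^*%C - G l x * (G l x)^*%C.
  rewrite -!sqr_normcC -!sum_dirichlet -!(big_mkord predT (fun k => dirichlet k x)).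
  by rewrite [in RHS](big_cat_nat _ (n := l)) //=; [rewrite addrC addrK|lia].
by ring.
Qed.

Lemma sum_Deltak_G M D h eta k (a : int) (N : nat) x : (2 * D < M)%N -> 0 < eta ->
  (forall n : int, (`|n| <= D)%N -> normc (expi n h - 1) <= eta) ->
  (0 < N)%N -> (N + `|a| <= D)%N ->
  \sum_(j < M) normc (Deltak k h (fun y => expi a y * G N y * (G N y)^*%C) (x - grid R M j)) <=
    M%:R * ((2 * eta) ^+ k * N%:R).
Proof.
move=> DM eta0 heta N0 ND; pose g (n : int) : C := if 0 <= n < N%:Z then 1 else 0.
have bg : bandlim N g by move=> n nN; rewrite /g ifF //; apply/negP; lia.
have M0 : (0 : R) < M%:R by rewrite ltr0n; lia.
have e1 y : expi a y * G N y = tp D (fun n => g (n - a)) y.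
  rewrite G_tp -tp_translate // [RHS](tp_widen _ ND) // => n nN; apply: bg; lia.
have e2 y : (G N y)^*%C = tp D (fun n => g (- n)) y.
  rewrite -tp_opp (@tp_widen _ N D) //; last lia.
  rewrite -G_tp conj_G /G; apply: eq_bigr => j _.
  by rewrite expi_opp.
have -> : (fun y => expi a y * G N y * (G N y)^*%C) =
    (fun y => tp D (fun n => g (n - a)) y * tp D (fun n => g (- n)) y).
  by apply/funext => y; rewrite e1 e2.
have sN : (0 : R) < Num.sqrt N%:R by rewrite sqrtr_gt0 ltr0n.
have l2 (c : int -> C) : (forall y, normc (tp D c y) = normc (G N y)) ->
    \sum_(n <- zr D) normc (c n) ^+ 2 <= Num.sqrt N%:R ^+ 2.
  move=> hc; rewrite sqr_sqrtr // -(ler_pM2l M0) -(tp_parseval c 0 DM).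
  under eq_bigr do rewrite hc.
  by rewrite sum_sqr_G //; lia.
have -> : (N%:R : R) = Num.sqrt N%:R * Num.sqrt N%:R by rewrite -expr2 sqr_sqrtr.
apply: sum_Deltak_mul => //; apply: l2 => y.
  by rewrite -e1 ComplexField.Normc.normcM normc_expi mul1r.
by rewrite -e2 normc_conj.
Qed.

Lemma sum_Deltak_eV M h eta k (a : int) (l : nat) x : (0 < l)%N ->
  (2 * (2 * l + `|a|) < M)%N -> 0 < eta ->
  (forall n : int, (`|n| <= 2 * l + `|a|)%N -> normc (expi n h - 1) <= eta) ->
  \sum_(j < M) normc (Deltak k h (eV a l) (x - grid R M j)) <= M%:R * (3 * (2 * eta) ^+ k).
Proof.
move=> l0 lM eta0 heta.
have L0 : (0 : R) < l%:R by rewrite ltr0n.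
have l20 : (0 < 2 * l)%N by rewrite muln_gt0.
have h1 := @sum_Deltak_G M _ h eta k a (2 * l) x lM eta0 heta l20 (leqnn _).
have ll : (l + `|a| <= 2 * l + `|a|)%N by rewrite leq_add2r leq_pmull.
have h2 := @sum_Deltak_G M _ h eta k a l x lM eta0 heta l0 ll.
have -> : M%:R * (3 * (2 * eta) ^+ k) =
   l%:R^-1 * (M%:R * ((2 * eta) ^+ k * (2 * l)%:R)) + l%:R^-1 * (M%:R * ((2 * eta) ^+ k * l%:R)).
  by rewrite natrM; field; rewrite gt_eqF.
have eVE : eV a l = (fun y => l%:R^-1 * (expi a y * G (2 * l) y * (G (2 * l) y)^*%C) +
    - l%:R^-1 * (expi a y * G l y * (G l y)^*%C)) by apply/funext => y; exact: eV_G.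
have L1 : 0 <= (l%:R^-1 : R) by rewrite invr_ge0 ltW.
apply: le_trans (lerD (ler_wpM2l L1 h1) (ler_wpM2l L1 h2)).
rewrite !mulr_sumr -big_split /=; apply: ler_sum => j _.
rewrite eVE Deltak_lin; apply: le_trans (le_normcD _ _) _.
by rewrite !ComplexField.Normc.normcM normcN ComplexField.Normc.normcV normc_nat.
Qed.

(** A polynomial of degree D is its own convolution with the kernel of index D, computed exactly on
    the grid, so all differences can be moved onto the kernel. *)
Lemma bernstein D (c : int -> C) (B h eta : R) k x : (0 < D)%N -> bandlim D c ->
  (forall x, normc (tp D c x) <= B) -> 0 < eta ->
  (forall n : int, (`|n| <= 2 * D)%N -> normc (expi n h - 1) <= eta) ->
  normc (Deltak k h (tp D c) x) <= 3 * (2 * eta) ^+ k * B.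
Proof.
move=> D0 cD cB eta0 heta; pose M := (2 * (2 * D) + D).+1.
have -> : Deltak k h (tp D c) x =
    M%:R^-1 * \sum_(j < M) tp D c (grid R M j) * Deltak k h (eV 0 D) (x - grid R M j).
  have -> : eV 0 D = tp (2 * D) (vc R D).
    by apply/funext => y; rewrite /eV expi0 mul1r vallee_poussinE.
  under eq_bigr do rewrite Deltak_tp.
  rewrite (tp_conv M _ (fun j => tp D c (grid R M j))) Deltak_tp.
  rewrite -(@tp_widen _ D (2 * D)); [|lia|by move=> n /cD ->; rewrite mulr0].
  rewrite /tp big_seq [RHS]big_seq; apply: eq_bigr => n; rewrite mem_zr => nD.
  rewrite dft_tp //; last by move: nD; rewrite /M; clear; lia.
  have [nD'|/cD ->] := leqP `|n| D; last by rewrite !mulr0.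
  by rewrite /vc vcr_eq1 // mulr1.
have B0 : 0 <= B by apply: le_trans (cB 0); exact: normc_ge0.
rewrite ComplexField.Normc.normcM ComplexField.Normc.normcV normc_nat.
rewrite mulrC ler_pdivrMr ?ltr0n //.
apply: le_trans (normc_sum _ _ _) _.
apply: (@le_trans _ _ (\sum_(j < M) B * normc (Deltak k h (eV 0 D) (x - grid R M j)))).
  by apply: ler_sum => j _; rewrite ComplexField.Normc.normcM ler_wpM2r ?normc_ge0.
have -> : 3 * (2 * eta) ^+ k * B * M%:R = B * (M%:R * (3 * (2 * eta) ^+ k)) by ring.
rewrite -mulr_sumr ler_wpM2l //.
by apply: sum_Deltak_eV => //; rewrite addn0 // /M; clear; lia.
Qed.

(** Integrating the grid average over its offset x returns the integral of g, by translation
    invariance: uniform grid bounds become L1 bounds. *)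
Lemma torus_mean_le M (g : R -> R) (B : R) : (0 < M)%N ->
  (forall x, g (x + 2 * pi) = g x) -> measurable_fun setT g -> (forall x, 0 <= g x) ->
  (forall x, \sum_(j < M) g (x - grid R M j) <= M%:R * B) ->
  (\int[mu]_x (g x)%:E <= B%:E)%E.
Proof.
move=> M0 gp mg g0 hB; have MR : (0 : R) < M%:R by rewrite ltr0n.
have mgj (j : nat) : measurable_fun setT (fun x : R => (g (x - grid R M j))%:E).
  apply/measurable_EFinP; apply: (measurableT_comp mg).
  by apply: measurable_funD => //; exact: measurable_cst.
have : (\int[mu]_x (\sum_(j < M) (g (x - grid R M j))%:E) <= (M%:R * B)%:E)%E.
  apply: (@le_trans _ _ (\int[mu]_x (M%:R * B)%:E)%E).
    apply: ge0_le_integral => //.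
    - by move=> x _; apply: sume_ge0 => j _; rewrite lee_fin.
    - by apply: emeasurable_sum => j; exact: mgj.
    - by move=> x _; rewrite sumEFin lee_fin.
  rewrite integral_cst // [X in (_ * X)%E](_ : _ = 1%E) ?mule1 //; exact: torus_measureT.
rewrite ge0_integral_sum //; [|by move=> j; exact: mgj|by move=> j x _; rewrite lee_fin].
rewrite (eq_bigr (fun=> \int[mu]_x (g x)%:E)%E); last first.
  move=> j _; apply: (@ge0_torus_shift R (fun x => (g x)%:E)).
  - by move=> x; rewrite gp.
  - exact/measurable_EFinP.
  - by move=> x; rewrite lee_fin.
set I := (\int[mu]_x _)%E.
have : (0 <= I)%E by apply: integral_ge0 => x _; rewrite lee_fin.
case: I => [I| |//] _.
  rewrite sumEFin !lee_fin sumr_const card_ord -[leLHS]mulr_natl.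
  by rewrite ler_pM2l.
by case: M M0 {MR hB mgj} => // M _; rewrite big_ord_recl addye ?leye_eq // -ltNye; apply: lt_le_trans (ltNyr 0) _; apply: sume_ge0.
Qed.

Lemma integral_Deltak_eV h eta k (a : int) (l : nat) : (0 < l)%N -> 0 < eta ->
  (forall n : int, (`|n| <= 2 * l + `|a|)%N -> normc (expi n h - 1) <= eta) ->
  (\int[mu]_x (normc (Deltak k h (eV a l) x))%:E <= (3 * (2 * eta) ^+ k)%:E)%E.
Proof.
move=> l0 eta0 heta; pose M := (2 * (2 * l + `|a|)).+1.
have e x : Deltak k h (eV a l) x =
    tp (2 * l + `|a|) (fun n => (expi n h - 1) ^+ k * vc R l (n - a)) x.
  rewrite -Deltak_tp; congr (Deltak _ _ _ _); apply/funext => y; exact: eV_tp.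
apply: (@torus_mean_le M) => //.
- by move=> x; rewrite !e tp_D2pi.
- apply: measurable_normc; rewrite (_ : Deltak k h (eV a l) =
    tp (2 * l + `|a|) (fun n => (expi n h - 1) ^+ k * vc R l (n - a))); last exact/funext.
  exact: cmeasurable_tp.
- by move=> x; exact: normc_ge0.
- by move=> x; exact: sum_Deltak_eV.
Qed.

End differences.

(** * The Besov norm from a bound on the modulus *)

Section besov_membership.
Variable R : realType.
Local Notation C := R[i].
Local Notation normc := ComplexField.Normc.normc.
Local Notation mu := (@torus_measure R).
Local Notation leb := (@lebesgue_measure R).

(** The left base is at most y^de for y < 1 and y^(-de) for y >= 1, so it is at most 1 and a power
    th >= 1 only lowers it. The majorant on the right is chosen because, divided by y, it has an
    elementary antiderivative. *)
Lemma besov_kernel_le (r de th y : R) (k : nat) : 0 < de -> de <= r -> de <= k%:R - r -> 1 <= th ->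
  0 < y -> (y `^ (- r) * Num.min 1 y ^+ k) `^ th <= 4 * (y `^ de / (1 + y `^ de) ^+ 2).
Proof.
move=> de0 der dek th1 y0; have z0 : 0 < y `^ de by exact: powR_gt0.
have zp : 0 < (1 + y `^ de) ^+ 2 by rewrite exprn_gt0 // addr_gt0.
have K0 : 0 <= y `^ (- r) * Num.min 1 y ^+ k.
  by rewrite mulr_ge0 ?powR_ge0 // exprn_ge0 // le_min ler01 ltW.
have red m : m <= 1 -> m * (1 + y `^ de) ^+ 2 <= 4 * y `^ de ->
    y `^ (- r) * Num.min 1 y ^+ k <= m ->
    (y `^ (- r) * Num.min 1 y ^+ k) `^ th <= 4 * (y `^ de / (1 + y `^ de) ^+ 2).
  move=> m1 hm hK; rewrite mulrA ler_pdivlMr //; apply: le_trans hm.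
  rewrite ler_wpM2r ?(ltW zp) //; apply: le_trans (hK).
  have [->|Kn] := eqVneq (y `^ (- r) * Num.min 1 y ^+ k) 0.
    by rewrite powR0 // gt_eqF // (lt_le_trans _ th1).
  rewrite -[leRHS](powRr1 K0) ger_powR // lt_neqAle eq_sym Kn K0 /=.
  exact: le_trans hK m1.
case: (boolP (1 <= y)) => [y1|]; last rewrite -ltNge => y1.
- have z1 : 1 <= y `^ de by rewrite -(powRr0 y) ler_powR // ltW.
  apply: (red (y `^ de)^-1).
  + by rewrite invf_le1.
  + rewrite mulrC ler_pdivrMr //; move: (y `^ de) z1 => z z1; nra.
  + by rewrite min_l // expr1n mulr1 -powRN ler_powR // lerN2.
- have z1 : y `^ de <= 1 by rewrite -(powRr0 y) ger_powR ?y0 ?ltW.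
  apply: (red (y `^ de)) => //.
  + by rewrite mulrC ler_wpM2r ?(ltW z0) //; move: (y `^ de) z0 z1 => z z0 z1; nra.
  + rewrite min_r ?(ltW y1) // -powR_mulrn ?(ltW y0) // -powRD_gt0 //.
    rewrite ger_powR ?y0 ?(ltW y1) //; lra.
Qed.

Lemma continuous_powR (q t : R) : 0 < t -> {for t, continuous (@powR R ^~ q)}.
Proof.
move=> t0; apply: differentiable_continuous; apply/derivable1_diffP.
by apply: derivable_powR; rewrite in_itv /= andbT.
Qed.

(** The derivative of -1 / (1 + w t^de), so its integrals over intervals of positive reals stay
    below 1. *)
Definition bump (de w t : R) : R := w * de * t `^ (de - 1) / (1 + w * t `^ de) ^+ 2.

Lemma bump_den (de w t : R) : 0 < w -> 0 < 1 + w * t `^ de.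
Proof. by move=> w0; rewrite ltr_pwDl // mulr_ge0 ?powR_ge0 // ltW. Qed.

Lemma continuous_bump (de w t : R) : 0 < w -> 0 < t -> {for t, continuous (bump de w)}.
Proof.
move=> w0 t0; have d0 := bump_den de t w0.
have cw : {for t, continuous (fun s : R => 1 + w * s `^ de)}.
  apply: cvgD; first exact: cvg_cst.
  by apply: cvgM; [exact: cvg_cst|exact: continuous_powR].
apply: cvgM.
  by apply: cvgM; [exact: cvg_cst|exact: continuous_powR].
apply: cvgV; first by rewrite expf_neq0 // gt_eqF.
exact: (cvgM cw cw).
Qed.

Lemma is_derive_bump (de w t : R) : 0 < w -> 0 < t ->
  is_derive t 1 (fun s => - (1 + w * s `^ de)^-1) (bump de w t).
Proof.
move=> w0 t0; have d0 := bump_den de t w0.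
have h1 := is_derive1_powR de t0.
have h2 : is_derive t 1 (fun s => 1 + w * s `^ de) (0 + w *: (de * t `^ (de - 1))).
  exact: (is_deriveD (is_derive_cst (1 : R) t 1) (is_deriveZ w h1)).
have h3 := is_deriveN (@is_deriveV _ (fun s => 1 + w * s `^ de) t _ 1 (lt0r_neq0 d0) h2).
apply: is_derive_eq h3 _.
by rewrite add0r /bump /GRing.scale /=; field; rewrite gt_eqF.
Qed.

Lemma integral_bump_le (de w a b : R) : 0 < w -> 0 < a -> a < b ->
  (\int[leb]_(t in `[a, b]) (bump de w t)%:E <= 1)%E.
Proof.
move=> w0 a0 ab; have b0 : 0 < b by exact: lt_trans ab.
pose F (s : R) := - (1 + w * s `^ de)^-1.
have dF t : 0 < t -> derivable F t 1 by move=> t0; case: (is_derive_bump de w0 t0).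
have cF t : 0 < t -> {for t, continuous F}.
  by move=> t0; apply: differentiable_continuous; apply/derivable1_diffP; exact: dF.
rewrite (@continuous_FTC2 _ _ F) //.
- rewrite -EFinB lee_fin /F opprK.
  have h1 := bump_den de b w0; have h2 := bump_den de a w0.
  have : (1 + w * a `^ de)^-1 <= 1 by rewrite invf_le1 // lerDl mulr_ge0 ?powR_ge0 ?ltW.
  have : 0 < (1 + w * b `^ de)^-1 by rewrite invr_gt0.
  by move: (_^-1) (_^-1) => u v; lra.
- apply: continuous_in_subspaceT => t; rewrite inE /= in_itv /= => /andP[ta _].
  by apply: continuous_bump => //; exact: lt_le_trans ta.
- split.
  + by move=> t; rewrite in_itv /= => /andP[ta _]; apply: dF; exact: lt_trans ta.
  + by apply: cvg_at_right_filter; exact: cF.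
  + by apply: cvg_at_left_filter; exact: cF.
- move=> t; rewrite in_itv /= => /andP[ta _]; rewrite derive1E.
  have t0 : 0 < t by exact: lt_trans ta.
  by case: (is_derive_bump de w0 t0).
Qed.

Lemma ge0_integral_exhaust (f : R -> \bar R) (K : R) :
  measurable_fun (`]0%R, +oo[ : set R) f -> (forall t, 0 < t -> (0 <= f t)%E) ->
  (forall a b, 0 < a -> a < b -> (\int[leb]_(t in `[a, b]) f t <= K%:E)%E) ->
  (\int[leb]_(t in `]0%R, +oo[) f t <= K%:E)%E.
Proof.
(* [i.+2] rather than [i.+1], so that already the first interval is nondegenerate. *)
move=> mf f0 hK; pose F (i : nat) : set R := `[i.+2%:R^-1, i.+2%:R]%classic.
have Fpos i t : F i t -> 0 < t.
  by rewrite /F /= in_itv /= => /andP[h _]; apply: lt_le_trans h; rewrite invr_gt0.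
have UF : `]0%R, +oo[%classic = \bigcup_i F i.
  apply/seteqP; split => t /=; rewrite in_itv /= andbT; last by move=> [i _ /Fpos].
  move=> t0; pose i := Num.truncn (t + t^-1); exists i => //; rewrite /F /= in_itv /=.
  have tv : 0 < t^-1 by rewrite invr_gt0.
  have hi : t + t^-1 < i.+1%:R by apply: truncnS_gt.
  have hi2 : (i.+1%:R : R) <= i.+2%:R by rewrite ler_nat.
  apply/andP; split; last lra.
  by rewrite -[leRHS]invrK lef_pV2 ?posrE //; lra.
rewrite UF.
have : (\int[leb]_(x in F i) f x @[i --> \oo] --> \int[leb]_(x in \bigcup_i F i) f x)%E.
  apply: ge0_nondecreasing_set_cvg_integral.
  - apply/nondecreasing_seqP => i; apply/subsetPset => t; rewrite /F /= !in_itv /= => /andP[h1 h2].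
    apply/andP; split; last by apply: le_trans h2 _; rewrite ler_nat.
    by apply: le_trans h1; rewrite lef_pV2 ?posrE // ler_nat.
  - by move=> i; exact: measurable_itv.
  - by move=> i; apply: measurable_funS mf => // t /Fpos; rewrite /= in_itv /= andbT.
  - by move=> i t /Fpos; exact: f0.
move=> cv; rewrite -(cvg_lim _ cv) //; apply: lime_le; first by apply/cvg_ex; eexists; exact: cv.
apply: nearW => i; apply: hK; rewrite ?invr_gt0 //.
rewrite (@lt_trans _ _ 1) ?invf_lt1 ?ltr1n //.
Qed.

(** The modulus assumed is that of a polynomial of degree about D. Rescaling t to D t yields the
    factor D^r, and the root of order theta is bounded by 4 / de + 1, uniformly in theta. *)
Lemma besov_norm_le k (r de A D : R) p theta (f : R -> C) : (1 <= theta)%E ->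
  0 < de -> de <= r -> de <= k%:R - r -> 0 < A -> 0 < D -> (Tnorm p f <= A%:E)%E ->
  (forall t, 0 < t -> (omega k p f t <= (A * Num.min 1 (D * t) ^+ k)%:E)%E) ->
  (besov_norm k r p theta f <= (A + A * D `^ r * (4 / de + 1))%:E)%E.
Proof.
move=> th1 de0 der dek A0 D0 fA hw; rewrite EFinD; apply: leeD => //.
have AD0 : 0 < A * D `^ r by rewrite mulr_gt0 // powR_gt0.
have tw t : 0 < t -> ((t `^ (- r))%:E * omega k p f t <=
    (A * D `^ r * ((D * t) `^ (- r) * Num.min 1 (D * t) ^+ k))%:E)%E.
  move=> t0; apply: (@le_trans _ _ ((t `^ (- r))%:E * (A * Num.min 1 (D * t) ^+ k)%:E)%E).
    by rewrite lee_wpmul2l ?lee_fin ?powR_ge0 // hw.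
  rewrite -EFinM lee_fin powRM ?(ltW D0) ?(ltW t0) // [D `^ (- r)]powRN.
  rewrite le_eqVlt; apply/orP; left; apply/eqP; field.
  by rewrite gt_eqF // powR_gt0.
have ge0 t : 0 < t -> (0 <= (t `^ (- r))%:E * omega k p f t)%E.
  by move=> t0; rewrite mule_ge0 ?lee_fin ?powR_ge0 // omega_ge0 // ltW.
have ker0 t : 0 < t -> 0 <= (D * t) `^ (- r) * Num.min 1 (D * t) ^+ k.
  by move=> t0; rewrite mulr_ge0 ?powR_ge0 // exprn_ge0 // le_min ler01 mulr_ge0 ?ltW.
case: theta th1 => [th| |//] th1.
- rewrite lee_fin in th1; have th0 : 0 < th by exact: lt_le_trans th1.
  pose w := D `^ de; have w0 : 0 < w by exact: powR_gt0.
  pose K := (A * D `^ r) `^ th * (4 / de).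
  have K0 : 0 <= K by rewrite mulr_ge0 ?powR_ge0 // divr_ge0 // ltW.
  have J t : 0 < t -> (besov_integrand k r p th f t <= (K * bump de w t)%:E)%E.
    move=> t0; have Dt : 0 < D * t by rewrite mulr_gt0.
    apply: (@le_trans _ _ (((A * D `^ r * ((D * t) `^ (- r) * Num.min 1 (D * t) ^+ k))%:E `^ th) * (t^-1)%:E)%E).
      rewrite lee_wpmul2r ?lee_fin ?invr_ge0 ?(ltW t0) //.
      apply: gt0_ler_poweR; rewrite ?(ltW th0) // ?in_itv /= ?leey ?andbT ?ge0 ?tw //.
      by rewrite lee_fin mulr_ge0 ?ker0 // ltW.
    rewrite poweR_EFin -EFinM lee_fin powRM ?(ltW AD0) ?ker0 //.
    have hk := besov_kernel_le de0 der dek th1 Dt.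
    rewrite /K -!mulrA ler_wpM2l ?powR_ge0 //.
    rewrite ler_pdivrMr //; apply: le_trans hk _.
    rewrite powRM ?(ltW D0) ?(ltW t0) // -/w /bump.
    have -> : t `^ de = t `^ (de - 1) * t.
      by rewrite -[X in _ * X](powRr1 (ltW t0)) -powRD_gt0 // subrK.
    rewrite le_eqVlt; apply/orP; left; apply/eqP; field.
    have Q0 : 0 <= w * (t `^ (de - 1) * t) by rewrite !mulr_ge0 ?powR_ge0 ?ltW.
    by rewrite !gt_eqF //= ltr_pwDl.
  have hI : (\int[leb]_(t in `]0%R, +oo[) besov_integrand k r p th f t <= K%:E)%E.
    apply: ge0_integral_exhaust.
    + exact: measurable_besov_integrand.
    + by move=> t; exact: besov_integrand_ge0.
    move=> a b a0 ab.
    have posI t : `[a, b]%classic t -> 0 < t.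
      by rewrite /= in_itv /= => /andP[ta _]; exact: lt_le_trans ta.
    have b0 t : `[a, b]%classic t -> (0 <= (bump de w t)%:E)%E.
      move=> /posI t0; rewrite lee_fin divr_ge0 ?sqr_ge0 // !mulr_ge0 ?powR_ge0 ?ltW //.
    have mb : measurable_fun `[a, b] (fun t => (bump de w t)%:E).
      apply/measurable_EFinP; apply: subspace_continuous_measurable_fun => //.
      apply: continuous_in_subspaceT => t; rewrite inE => /posI t0.
      exact: continuous_bump.
    apply: (@le_trans _ _ (\int[leb]_(t in `[a, b]) (K%:E * (bump de w t)%:E))%E).
      apply: ge0_le_integral => //.
      + by move=> t /posI; exact: besov_integrand_ge0.
      + apply: measurable_funS (@measurable_besov_integrand R k r p th f) => // t /posI.
        by rewrite /= in_itv /= andbT.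
      + exact: measurable_funeM.
      + by move=> t /posI; rewrite -EFinM; exact: J.
    rewrite (ge0_integralZl leb _ mb b0) //.
    rewrite -[leRHS]mule1 lee_wpmul2l //; exact: integral_bump_le.
  rewrite -/(besov_integrand k r p th f).
  set I := (\int[_]_(t in _) _)%E in hI *.
  have I0 : (0 <= I)%E.
    by apply: integral_ge0 => t; rewrite /= in_itv /= andbT; exact: besov_integrand_ge0.
  apply: (@le_trans _ _ (K%:E `^ th^-1)%E).
    by apply: gt0_ler_poweR; rewrite ?invr_ge0 ?(ltW th0) // ?in_itv /= ?leey ?andbT.
  rewrite poweR_EFin lee_fin /K powRM ?powR_ge0 ?divr_ge0 ?(ltW de0) //.
  rewrite -powRrM divff ?gt_eqF // powRr1 ?(ltW AD0) // ler_wpM2l ?(ltW AD0) //.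
  have d4 : 0 < 4 / de by rewrite divr_gt0.
  apply: (@le_trans _ _ ((4 / de + 1) `^ th^-1)).
    by rewrite ge0_ler_powR ?nnegrE ?invr_ge0 ?(ltW th0) ?(ltW d4) //; lra.
  have q1 : 1 <= 4 / de + 1 by lra.
  by rewrite -[leRHS](powRr1 (le_trans ler01 q1)) ler_powR // invf_le1.
- apply: ub_ereal_sup => _ [t + <-]; rewrite /= in_itv /= andbT => t0.
  apply: le_trans (tw _ t0) _; rewrite lee_fin ler_wpM2l ?(ltW AD0) //.
  have Dt : 0 < D * t by rewrite mulr_gt0.
  have := besov_kernel_le de0 der dek (lexx 1) Dt; rewrite powRr1 ?ker0 // => /le_trans; apply.
  have z0 : 0 < (D * t) `^ de by rewrite powR_gt0.
  have d4 : 0 < 4 / de by rewrite divr_gt0.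
  apply: (@le_trans _ _ 1); last lra.
  rewrite mulrA ler_pdivrMr ?exprn_gt0 ?addr_gt0 // mul1r -subr_ge0.
  have -> : (1 + (D * t) `^ de) ^+ 2 - 4 * (D * t) `^ de = (1 - (D * t) `^ de) ^+ 2 by ring.
  exact: sqr_ge0.
Qed.

End besov_membership.

(** * Extremal polynomials in one dyadic block *)

Section test_functions.
Variable R : realType.
Local Notation C := R[i].
Local Notation normc := ComplexField.Normc.normc.
Local Notation mu := (@torus_measure R).
Local Arguments expi : simpl never.

Lemma bandlim_block (p : int -> C) (N : nat) :
  (forall j, normc (p j) = (0 <= j < N%:Z)%R%:R) -> bandlim N p.
Proof.
move=> hp n nN; apply: ComplexField.Normc.eq0_normc; rewrite hp.
by rewrite (_ : (_ <= n < _) = false) //; apply/negP; lia.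
Qed.

(** Doubling: p + e_N q and p - e_N q have disjointly placed unimodular coefficients, and the
    parallelogram law doubles the sum of squares. *)
Lemma rudin_shapiro (n : nat) : exists p q : int -> C,
  [/\ forall j, normc (p j) = (0 <= j < (2 ^ n)%:Z)%R%:R,
      forall j, normc (q j) = (0 <= j < (2 ^ n)%:Z)%R%:R &
      forall x, normc (tp (2 ^ n) p x) ^+ 2 + normc (tp (2 ^ n) q x) ^+ 2 = (2 ^ n.+1)%:R].
Proof.
elim: n => [|n [p [q [hp hq hpq]]]].
  pose d (j : int) : C := (j == 0)%:R.
  have hd j : normc (d j) = (0 <= j < (2 ^ 0)%:Z)%R%:R.
    by rewrite /d normc_nat expn0; congr ((nat_of_bool _)%:R); apply/idP/idP; lia.
  have td x : tp (2 ^ 0) d x = 1.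
    rewrite /tp (@sum_zr_delta _ _ _ 0).
    - by rewrite /d eqxx expi0 mulr1.
    - by move=> j jn; rewrite (bandlim_block hd) // mul0r.
    - by move=> j /negbTE j0; rewrite /d j0 mul0r.
  exists d, d; split=> // x; rewrite td ComplexField.Normc.normc1 expr1n expn1.
  by rewrite (natrD _ 1 1).
set N := (2 ^ n)%N in hp hq hpq.
have NS : (2 ^ n.+1 = N + `|N%:Z|)%N by rewrite expnS mul2n -addnn.
have bp := bandlim_block hp; have bq := bandlim_block hq.
have tq x : tp (2 ^ n.+1) (fun j => q (j - N%:Z)) x = expi N x * tp N q x.
  by rewrite NS tp_translate.
have tpp x : tp (2 ^ n.+1) p x = tp N p x by apply: tp_widen => //; rewrite NS leq_addr.
have hn (e : bool) j : normc (p j + (-1) ^+ e * q (j - N%:Z)) = (0 <= j < (2 ^ n.+1)%:Z)%R%:R.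
  rewrite NS; have [jN|jN] := ltP j N%:Z.
    have -> : q (j - N%:Z) = 0.
      apply: ComplexField.Normc.eq0_normc; rewrite hq (_ : (_ <= _ < _) = false) //; apply/negP; lia.
    by rewrite mulr0 addr0 hp; congr ((nat_of_bool _)%:R); apply/idP/idP; lia.
  have -> : p j = 0.
    apply: ComplexField.Normc.eq0_normc; rewrite hp (_ : (_ <= _ < _) = false) //; apply/negP; lia.
  rewrite add0r ComplexField.Normc.normcM hq.
  have -> : normc ((-1) ^+ e : C) = 1.
    by case: e; rewrite ?expr1 ?expr0 ?normcN ComplexField.Normc.normc1.
  by rewrite mul1r; congr ((nat_of_bool _)%:R); apply/idP/idP; lia.
exists (fun j => p j + (-1) ^+ false * q (j - N%:Z)), (fun j => p j + (-1) ^+ true * q (j - N%:Z)).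
split; [exact: hn|exact: hn|] => x.
rewrite !tpD !tpZ tq tpp expr0 expr1 mul1r mulN1r.
have e (u v : C) : normc (u + v) ^+ 2 + normc (u - v) ^+ 2 = 2 * (normc u ^+ 2 + normc v ^+ 2).
  by rewrite -[v in u + v]opprK !sqr_normcB normcN rmorphN mulrN raddfN /=; ring.
by rewrite e ComplexField.Normc.normcM normc_expi mul1r hpq -natrM -expnS.
Qed.

Lemma Tnorm_le_bounded (p : \bar R) (g : R -> C) (B : R) : (1 <= p)%E -> cmeasurable g ->
  (forall x, normc (g x) <= B) -> (Tnorm p g <= B%:E)%E.
Proof.
move=> p1 mg gB; have B0 : 0 <= B by apply: le_trans (gB 0); exact: normc_ge0.
case: p p1 => [p| |//]; last by move=> _; exact: Tnorm_oo_le.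
rewrite lee_fin => p1; have p0 : 0 < p by exact: lt_le_trans p1.
rewrite Tnorm_finE.
have h : (\int[mu]_x (normc (g x) `^ p)%:E <= (B `^ p)%:E)%E.
  apply: (@le_trans _ _ (\int[mu]_x (B `^ p)%:E)%E).
    apply: ge0_le_integral => //.
    - by move=> x _; rewrite lee_fin powR_ge0.
    - exact: measurable_normc_powR.
    - by move=> x _; rewrite lee_fin ge0_ler_powR ?nnegrE ?normc_ge0 // ltW.
  rewrite integral_cst // [X in (_ * X)%E](_ : _ = 1%E) ?mule1 //; exact: torus_measureT.
have -> : B%:E = ((B `^ p)%:E `^ p^-1)%E.
  by rewrite poweR_EFin -powRrM divff ?gt_eqF // powRr1.
apply: gt0_ler_poweR; rewrite ?invr_ge0 ?(ltW p0) // ?in_itv /= ?leey ?andbT //.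
- by apply: integral_ge0 => x _; rewrite lee_fin powR_ge0.
- by rewrite lee_fin powR_ge0.
Qed.

(** Interpolation between L_1 and the sup norm through |g|^p <= B^(p-1) |g|. *)
Lemma Tnorm_le_L1_bounded (p : R) (g : R -> C) (B J : R) : 1 <= p -> cmeasurable g -> 0 < B ->
  (forall x, normc (g x) <= B) -> (\int[mu]_x (normc (g x))%:E <= J%:E)%E -> 0 <= J ->
  (Tnorm p%:E g <= (B `^ (1 - p^-1) * J `^ p^-1)%:E)%E.
Proof.
move=> p1 mg B0 gB gJ J0; have p0 : 0 < p by exact: lt_le_trans p1.
have mN : measurable_fun setT (fun x => (normc (g x))%:E).
  by apply/measurable_EFinP; exact: measurable_normc.
have N0 x : setT x -> (0 <= (normc (g x))%:E)%E by move=> _; rewrite lee_fin normc_ge0.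
rewrite Tnorm_finE.
have h : (\int[mu]_x (normc (g x) `^ p)%:E <= (B `^ (p - 1) * J)%:E)%E.
  apply: (@le_trans _ _ (\int[mu]_x ((B `^ (p - 1))%:E * (normc (g x))%:E))%E).
    apply: ge0_le_integral => //.
    - by move=> x _; rewrite lee_fin powR_ge0.
    - exact: measurable_normc_powR.
    - exact: measurable_funeM.
    - move=> x _; rewrite -EFinM lee_fin.
      have [->|gn] := eqVneq (normc (g x)) 0; first by rewrite powR0 ?gt_eqF // mulr0.
      have g0 : 0 < normc (g x) by rewrite lt_neqAle eq_sym gn normc_ge0.
      have -> : normc (g x) `^ p = normc (g x) `^ (p - 1) * normc (g x).
        by rewrite -[X in _ * X](powRr1 (ltW g0)) -powRD_gt0 // subrK.
      rewrite ler_wpM2r ?normc_ge0 //.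
      by rewrite ge0_ler_powR ?nnegrE ?subr_ge0 ?normc_ge0 // ltW.
  by rewrite (ge0_integralZl mu measurableT mN N0) ?lee_fin ?powR_ge0 // EFinM lee_wpmul2l ?lee_fin ?powR_ge0.
have -> : (B `^ (1 - p^-1) * J `^ p^-1)%:E = ((B `^ (p - 1) * J)%:E `^ p^-1)%E.
  rewrite poweR_EFin powRM ?powR_ge0 // -powRrM mulrBl divff ?gt_eqF // mul1r //.
apply: gt0_ler_poweR; rewrite ?invr_ge0 ?(ltW p0) // ?in_itv /= ?leey ?andbT //.
- by apply: integral_ge0 => x _; rewrite lee_fin powR_ge0.
- by rewrite lee_fin mulr_ge0 ?powR_ge0.
Qed.

(** Gathers what both families share. The size exponent 1/2 - gam p is 1/2 for p >= 2 and 1 - 1/p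
    for p < 2; order i = 0 controls the norm, i = k the modulus. The range 2^(s+3), twice the
    degree, is the one [bernstein] asks for. *)
Definition block_poly (p : \bar R) (s : nat) (phi : int -> C) :=
  [/\ bandlim (2 ^ s.+2) phi,
      forall n, (2 ^ s.+1 <= `|n| <= 2 ^ s.+1 + 2 ^ s)%N -> 0 <= n -> 1 <= normc (phi n) &
      forall i (h eta : R), 0 < eta ->
        (forall n : int, (`|n| <= 2 ^ s.+3)%N -> normc (expi n h - 1) <= eta) ->
        (Tnorm p (Deltak i h (tp (2 ^ s.+2) phi)) <=
          (9 * (2 * eta) ^+ i * (2 ^ s)%:R `^ (2^-1 - gam p))%:E)%E].

Lemma cmeasurable_Deltak_tp i h D (phi : int -> C) : cmeasurable (Deltak i h (tp D phi)).
Proof.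
rewrite (_ : Deltak i h (tp D phi) = tp D (fun n => (expi n h - 1) ^+ i * phi n)).
  exact: cmeasurable_tp.
by apply/funext => x; exact: Deltak_tp.
Qed.

(** Length 2^(s+1) gives sup norm at most sqrt(2^(s+2)) = 2 sqrt(2^s), which dominates every L_p
    norm on a space of mass one; with the 3 of [bernstein] this stays below 9. *)
Lemma block_poly_ge2 (p : \bar R) (s : nat) : (1 <= p)%E -> einv p <= 2^-1 ->
  exists phi, block_poly p s phi.
Proof.
move=> p1 p2; have [q [q' [hq _ hqq]]] := rudin_shapiro s.+1.
have bq := bandlim_block hq.
pose phi n := q (n - (2 ^ s.+1)%:Z).
have E : (2 ^ s.+2 = 2 ^ s.+1 + `|(2 ^ s.+1)%:Z|)%N by rewrite expnS mul2n -addnn.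
have bphi : bandlim (2 ^ s.+2) phi.
  by rewrite E => n nN; apply: bq; move: nN; move: (2 ^ s.+1)%N => N; lia.
have g0 : gam p = 0 by rewrite /gam max_r // subr_le0.
have sup x : normc (tp (2 ^ s.+2) phi x) <= 2 * Num.sqrt (2 ^ s)%:R.
  rewrite -ler_sqr ?nnegrE ?normc_ge0 ?mulr_ge0 ?sqrtr_ge0 // exprMn sqr_sqrtr ?ler0n //.
  rewrite E tp_translate // ComplexField.Normc.normcM normc_expi mul1r.
  have -> : 2 ^+ 2 * (2 ^ s)%:R = (2 ^ s.+2)%:R :> R by rewrite -natrX -natrM -expnD.
  by rewrite -(hqq x) lerDl sqr_ge0.
exists phi; split => //.
- move=> n hn n0; rewrite /phi hq (_ : (_ <= _ < _) = true) //.
  have : (0 < 2 ^ s)%N by rewrite expn_gt0.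
  by move: hn; rewrite expnS; move: (2 ^ s)%N => N; lia.
move=> i h eta eta0 heta; rewrite g0 subr0 powR12_sqrt ?ler0n //.
apply: Tnorm_le_bounded => //; first exact: cmeasurable_Deltak_tp.
move=> x; apply: le_trans (bernstein i x _ bphi sup eta0 _) _.
- by rewrite expn_gt0.
- by move=> n nN; apply: heta; rewrite expnS.
have e0 : 0 <= (2 * eta) ^+ i by rewrite exprn_ge0 // mulr_ge0 // ltW.
have s0 := sqrtr_ge0 ((2 ^ s)%:R : R).
by have := mulr_ge0 e0 s0; move: (_ ^+ i) (Num.sqrt _) => u v uv; lra.
Qed.

(** The differences have L_1 norm of order 1 and sup norm of order 2^s, the latter since 2 * 2^(s+2)
    + 1 <= 9 * 2^s coefficients occur; interpolation gives 2^(s(1 - 1/p)). *)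
Lemma block_poly_lt2 (p : \bar R) (s : nat) : (1 <= p)%E -> 2^-1 < einv p ->
  exists phi, block_poly p s phi.
Proof.
case: p => [p| |//]; last by rewrite /= => _; lra.
rewrite lee_fin /= => p1 p2; have p0 : 0 < p by exact: lt_le_trans p1.
pose a := (2 ^ s.+1)%:Z; pose l := (2 ^ s)%N; have l0 : (0 < l)%N by rewrite expn_gt0.
pose phi n : C := vc R l (n - a).
have E : (2 ^ s.+2 = 2 * l + `|a|)%N by rewrite /a /l /= !expnS; lia.
have eVE : tp (2 ^ s.+2) phi = eV a l by apply/funext => x; rewrite eV_tp E.
exists phi; split.
- by rewrite E => n nN; apply: (@bandlim_vc R l); move: nN; lia.
- move=> n hn n0; rewrite /phi /vc vcr_eq1 ?ComplexField.Normc.normc1 //.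
  by move: hn; rewrite /a /l expnS; move: (2 ^ s)%N => N; lia.
move=> i h eta eta0 heta.
have g0 : 2^-1 - gam p%:E = 1 - p^-1.
  by rewrite /gam /= max_l ?subr_ge0 ?(ltW p2) //; lra.
have hD n : (`|n| <= 2 ^ s.+2)%N -> normc (expi n h - 1) <= eta.
  by move=> nD; apply: heta; apply: leq_trans nD _; rewrite leq_exp2l.
have e0 : 0 < eta ^+ i by rewrite exprn_gt0.
have ei : 0 < (2 * eta) ^+ i by rewrite exprn_gt0 // mulr_gt0.
have eei : eta ^+ i <= (2 * eta) ^+ i.
  by rewrite lerXn2r ?nnegrE ?mulr_ge0 ?(ltW eta0) //; lra.
have L0 : (0 : R) < l%:R by rewrite ltr0n.
have sup x : normc (Deltak i h (tp (2 ^ s.+2) phi) x) <= 9 * (2 * eta) ^+ i * l%:R.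
  rewrite Deltak_tp; apply: le_trans (normc_tp _ _ _) _.
  apply: (@le_trans _ _ (\sum_(n <- zr (2 ^ s.+2)) eta ^+ i)).
    rewrite big_seq [leRHS]big_seq; apply: ler_sum => n; rewrite mem_zr => nD.
    rewrite ComplexField.Normc.normcM -[leRHS]mulr1; apply: ler_pM; rewrite ?normc_ge0 //.
      elim: i {e0 ei eei} => [|i ih]; first by rewrite !expr0 ComplexField.Normc.normc1.
      by rewrite !exprS ComplexField.Normc.normcM; apply: ler_pM; rewrite ?normc_ge0 // hD.
    by rewrite normc_real ger0_norm ?vcr_ge0 // vcr_le1.
  rewrite big_const_seq count_predT size_zr iter_addr_0 -[leLHS]mulr_natl.
  have hn : (2 * 2 ^ s.+2).+1%:R <= 9 * l%:R :> R.
    by rewrite -natrM ler_nat /l !expnS; move: l0; rewrite /l; lia.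
  apply: le_trans (ler_pM _ _ hn eei) _; rewrite ?(ltW e0) //.
  by rewrite le_eqVlt; apply/orP; left; apply/eqP; ring.
have L1 : (\int[mu]_x (normc (Deltak i h (tp (2 ^ s.+2) phi) x))%:E <= (9 * (2 * eta) ^+ i)%:E)%E.
  rewrite eVE; apply: le_trans (integral_Deltak_eV i l0 eta0 _) _; first by rewrite -E.
  by rewrite lee_fin; lra.
have W0 : 0 < 9 * (2 * eta) ^+ i by rewrite mulr_gt0.
have := Tnorm_le_L1_bounded p1 (cmeasurable_Deltak_tp _ _ _ _) (mulr_gt0 W0 L0) sup L1 (ltW W0).
move=> /le_trans; apply; rewrite lee_fin g0.
rewrite -/l; move: (9 * (2 * eta) ^+ i) (l%:R : R) W0 L0 => W L W0 L0.
by rewrite powRM ?(ltW W0) ?(ltW L0) // mulrAC -powRD_gt0 // subrK powRr1 ?(ltW W0).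
Qed.

Lemma exists_block_poly (p : \bar R) (s : nat) : (1 <= p)%E -> exists phi, block_poly p s phi.
Proof.
move=> p1; have [h|h] := leP (einv p) 2^-1; first exact: block_poly_ge2.
exact: block_poly_lt2.
Qed.

End test_functions.

(** * The lower bound and the two-sided estimate *)

Section lower_estimate.
Variable R : realType.
Local Notation C := R[i].
Local Notation normc := ComplexField.Normc.normc.
Local Notation mu := (@torus_measure R).
Local Arguments expi : simpl never.

Lemma Tnorm_scale_le (p : \bar R) (g : R -> C) (H B : R) : (1 <= p)%E -> cmeasurable g ->
  0 < H -> 0 <= B -> (Tnorm p g <= B%:E)%E -> (Tnorm p (fun x => (H%:C%C * g x)%R) <= (H * B)%:E)%E.
Proof.
move=> p1 mg H0 B0 gB.
have nE x : normc (H%:C%C * g x) = H * normc (g x).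
  by rewrite ComplexField.Normc.normcM normc_real gtr0_norm.
case: p p1 gB => [p| |//]; last first.
  move=> _; rewrite !Tnorm_ooE => /ess_supP gB; apply/ess_supP.
  by apply: ae_torusS gB => x; rewrite !lee_fin nE ler_pM2l.
rewrite lee_fin => p1 gB; have p0 : 0 < p by exact: lt_le_trans p1.
have hB := Tnorm_fin_le p0 B0 gB.
have P0 x : setT x -> (0 <= (normc (g x) `^ p)%:E)%E by move=> _; rewrite lee_fin powR_ge0.
rewrite Tnorm_finE.
under eq_integral do rewrite nE powRM ?normc_ge0 ?(ltW H0) // EFinM.
rewrite (ge0_integralZl mu measurableT (measurable_normc_powR p mg) P0) ?lee_fin ?powR_ge0 //.
have -> : (H * B)%:E = (((H `^ p)%:E * (B `^ p)%:E) `^ p^-1)%E.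
  by rewrite -EFinM -powRM ?(ltW H0) // poweR_EFin -powRrM divff ?gt_eqF // powRr1 ?mulr_ge0 ?(ltW H0).
have HB : (0 <= (H `^ p)%:E * (B `^ p)%:E)%E by rewrite -EFinM lee_fin mulr_ge0 ?powR_ge0.
apply: gt0_ler_poweR; rewrite ?invr_ge0 ?(ltW p0) // ?in_itv /= ?leey ?andbT //.
  by rewrite mule_ge0 ?lee_fin ?powR_ge0 // integral_ge0.
by rewrite lee_wpmul2l ?lee_fin ?powR_ge0.
Qed.

(** H inverts the bound of [besov_norm_le] for A = 9 4^k w and D = 2^(s+3), where A itself is
    absorbed into A D^r because D >= 1. *)
Lemma block_poly_besov (p theta : \bar R) (r : R) (k s : nat) (phi : int -> C) (H : R) :
  (1 <= p)%E -> (1 <= theta)%E -> 0 < r -> r < k%:R -> block_poly p s phi ->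
  H = (9 * 4 ^+ k * (2 ^ s)%:R `^ (2^-1 - gam p) * (2 ^ s.+3)%:R `^ r *
       (4 / Num.min r (k%:R - r) + 2))^-1 ->
  besov_class k r p theta (tp (2 ^ s.+2) (fun n => H%:C%C * phi n)).
Proof.
move=> p1 th1 r0 rk [bp _ hphi] HE.
set w := (2 ^ s)%:R `^ (2^-1 - gam p) in hphi HE; set D : R := (2 ^ s.+3)%:R in HE.
set de := Num.min r _ in HE.
have w0 : 0 < w by rewrite powR_gt0 // ltr0n expn_gt0.
have de0 : 0 < de by rewrite lt_min r0 subr_gt0.
have D1 : 1 <= D by rewrite ler1n expn_gt0.
have D0 : 0 < D by exact: lt_le_trans D1.
have k4 : 1 <= 4 ^+ k :> R by rewrite exprn_ege1 // ler1n.
have k40 : 0 < 4 ^+ k :> R by exact: lt_le_trans k4.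
have Dr1 : 1 <= D `^ r by rewrite -(powRr0 D) ler_powR // ltW.
have A0 : 0 < 9 * 4 ^+ k * w by rewrite !mulr_gt0.
have d4 : 0 < 4 / de by rewrite divr_gt0.
have Z0 : 0 < 9 * 4 ^+ k * w * D `^ r * (4 / de + 2).
  by rewrite mulr_gt0 ?addr_gt0 // mulr_gt0 // powR_gt0.
have H0 : 0 < H by rewrite HE invr_gt0.
set f := tp (2 ^ s.+2) phi in hphi.
have tpH : tp (2 ^ s.+2) (fun n => H%:C%C * phi n) = (fun x => (H%:C%C * f x)%R).
  by apply/funext => x; rewrite tpZ.
have DH i h : Deltak i h (fun x => (H%:C%C * f x)%R) = (fun x => H%:C%C * Deltak i h f x).
  apply/funext => x; rewrite -[RHS]addr0 -[in RHS](mul0r (Deltak i h f x)) -Deltak_lin.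
  by congr (Deltak _ _ _ _); apply/funext => y; rewrite mul0r addr0.
have N0 : (Tnorm p (fun x => (H%:C%C * f x)%R) <= (H * (9 * 4 ^+ k * w))%:E)%E.
  apply: Tnorm_scale_le => //; [exact: cmeasurable_tp|exact: ltW|].
  apply: le_trans (hphi 0 0 1 ltr01 _) _.
    by move=> n _; rewrite expi_at0 subrr ComplexField.Normc.normc0.
  by rewrite expr0 mulr1 lee_fin ler_wpM2r ?(ltW w0) // ler_peMr.
rewrite tpH; split.
  split; [|split]; last exact: le_lt_trans N0 (ltry _).
    by move=> x; rewrite /f tp_D2pi.
  by rewrite -tpH; exact: cmeasurable_tp.
have HA0 : 0 < H * (9 * 4 ^+ k * w) by rewrite mulr_gt0.
have omb t : 0 < t -> (omega k p (fun x => (H%:C%C * f x)%R) t <=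
    (H * (9 * 4 ^+ k * w) * Num.min 1 (D * t) ^+ k)%:E)%E.
  move=> t0; apply: ub_ereal_sup => _ [h /= ht <-].
  have m0 : 0 < Num.min 1 (D * t) by rewrite lt_min ltr01 mulr_gt0.
  have e0 : 0 < 2 * Num.min 1 (D * t) by rewrite mulr_gt0.
  rewrite DH -[(H * _ * _)%R]mulrA; apply: Tnorm_scale_le => //.
  - exact: cmeasurable_Deltak_tp.
  - by rewrite mulr_ge0 ?exprn_ge0 ?ltW.
  (* Here eta = 2 min(1, D t): a multiplier of a difference is at most 2, and at most |n| |h| <= D
     t. This doubling and the one in [2 * eta] give 4^k. *)
  apply: le_trans (hphi k h _ e0 _) _; last first.
    have -> : 2 * (2 * Num.min 1 (D * t)) = 4 * Num.min 1 (D * t) by ring.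
    rewrite exprMn lee_fin le_eqVlt; apply/orP; left; apply/eqP; ring.
  move=> n nD; have h2 := normc_expiB1_le2 n h; have h3 := normc_expiB1_le n h.
  have h4 : `|n%:~R * h| <= D * t.
    rewrite normrM; apply: ler_pM => //.
    by rewrite -intr_norm -abszE /D -[leRHS]/((2 ^ s.+3)%:Z%:~R) ler_int lez_nat.
  have Dt0 : 0 < D * t by rewrite mulr_gt0.
  case: (boolP (1 <= D * t)) => [y1|]; first by rewrite min_l // mulr1.
  rewrite -ltNge => /ltW y1; rewrite min_r //; apply: le_trans h3 _; apply: le_trans h4 _; lra.
have ded : de <= r by rewrite ge_min lexx.
have dek : de <= k%:R - r by rewrite ge_min lexx orbT.
apply: le_trans (besov_norm_le th1 de0 ded dek HA0 D0 N0 omb) _.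
rewrite lee_fin.
have -> : H * (9 * 4 ^+ k * w) + H * (9 * 4 ^+ k * w) * D `^ r * (4 / de + 1) =
    H * (9 * 4 ^+ k * w * (1 + D `^ r * (4 / de + 1))) by ring.
rewrite [X in X * _]HE mulrC ler_pdivrMr // mul1r -[leRHS]mulrA.
rewrite ler_wpM2l ?(ltW A0) //.
have -> : D `^ r * (4 / de + 2) = D `^ r + D `^ r * (4 / de + 1) by ring.
by rewrite lerD2r.
Qed.

Lemma lower_bound (p theta : \bar R) (r : R) (k : nat) :
  (1 <= p)%E -> (1 <= theta)%E -> Num.max (einv p) 2^-1 < r -> r < k%:R ->
  exists2 c : R, 0 < c & forall m : nat, (0 < m)%N ->
    ((c * m%:R `^ (- (r - gam p)))%:E <= em_class m (besov_class k r p theta))%E.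
Proof.
move=> p1 th1; rewrite gt_max => /andP[rp r2] rk.
have r0 : 0 < r by apply: lt_trans r2.
have rg : 0 < r - gam p.
  by rewrite subr_gt0 /gam gt_max r0 andbT (lt_trans _ rp) // ltrBlDr ltrDl.
pose de := Num.min r (k%:R - r).
have de0 : 0 < de by rewrite lt_min r0 subr_gt0.
pose c : R := (16 * (9 * 4 ^+ k * 8 `^ r * (4 / de + 2)) * 4 `^ (r - gam p))^-1.
have k40 : 0 < 4 ^+ k :> R by rewrite exprn_gt0.
have Q0 : 0 < 9 * 4 ^+ k * 8 `^ r * (4 / de + 2).
  by rewrite mulr_gt0 ?addr_gt0 ?divr_gt0 // mulr_gt0 ?powR_gt0 // mulr_gt0.
exists c; first by rewrite invr_gt0 mulr_gt0 ?powR_gt0 // mulr_gt0.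
(* 2 m <= 2^s leaves half of the frequencies untouched, while 2^s <= 4 m keeps the right order. *)
move=> m m0; pose s := up_log 2 (2 * m).
have m21 : (1 < 2 * m)%N by move: m0; clear; lia.
have /andP[s1 s2] := up_log_bounds (ltnSn 1) m21.
have {}s1 : (2 ^ s <= 4 * m)%N.
  move: s1; rewrite -/s; case: s {s2} => [|s']; first by rewrite expn0; move: m0; clear; lia.
  by rewrite /= expnS; move: (2 ^ s')%N m0; clear; lia.
have [phi bphi] := exists_block_poly s p1.
pose H : R := (9 * 4 ^+ k * (2 ^ s)%:R `^ (2^-1 - gam p) * (2 ^ s.+3)%:R `^ r * (4 / de + 2))^-1.
have cl := block_poly_besov p1 th1 r0 rk bphi (erefl H).
have [bp hp _] := bphi.
have S0 : (0 : R) < (2 ^ s)%:R by rewrite ltr0n expn_gt0.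
have H0 : 0 < H.
  rewrite invr_gt0 !mulr_gt0 ?powR_gt0 ?addr_gt0 ?divr_gt0 // ltr0n expn_gt0 //.
apply: le_trans (ereal_sup_ubound _); last by eexists; [exact: cl|reflexivity].
apply: le_trans (@em_fun_ge R (2 ^ s.+2) _ s m H _ H0 s2 _); first last.
- move=> n hn n0; rewrite ComplexField.Normc.normcM normc_real gtr0_norm // ler_peMr ?(ltW H0) //.
  exact: hp.
- by move=> n nD; rewrite bp ?mulr0.
rewrite lee_fin.
have M0 : (0 : R) < m%:R by rewrite ltr0n.
(* The powers of 2^s in H and in the square root add up: -(1/2 - gam p) - r + 1/2 = -(r - gam p). *)
have -> : H * Num.sqrt (2 ^ s)%:R / 16 =
    (16 * (9 * 4 ^+ k * 8 `^ r * (4 / de + 2)))^-1 * (2 ^ s)%:R `^ (- (r - gam p)).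
  rewrite /H -powR12_sqrt ?(ltW S0) // (_ : (2 ^ s.+3)%:R = 8 * (2 ^ s)%:R :> R); last first.
    by rewrite -natrM; congr (_%:R); rewrite !expnS !mulnA.
  rewrite powRM ?(ltW S0) //.
  have -> : (2 ^ s)%:R `^ 2^-1 = (2 ^ s)%:R `^ (2^-1 - gam p) * (2 ^ s)%:R `^ r *
      (2 ^ s)%:R `^ (- (r - gam p)) :> R.
    by rewrite -!powRD_gt0 //; congr (_ `^ _); ring.
  have := powR_gt0 (2^-1 - gam p) S0; have := powR_gt0 r S0.
  have : 0 < 8 `^ r :> R by rewrite powR_gt0.
  have : 0 < 4 / de + 2 by rewrite addr_gt0 ?divr_gt0.
  move: k40; move: (4 ^+ k) (4 / de + 2) (8 `^ r : R)
    ((2 ^ s)%:R `^ r : R) ((2 ^ s)%:R `^ (2^-1 - gam p) : R) ((2 ^ s)%:R `^ (- (r - gam p)) : R).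
  move=> x1 x2 x3 x4 x5 x6 y1 y2 y3 y4 y5.
  by field; rewrite !gt_eqF.
rewrite /c; move: (9 * _ * _ * _) Q0 => q q0.
rewrite [in leLHS]invfM -[leLHS]mulrA ler_wpM2l ?invr_ge0 ?mulr_ge0 ?(ltW q0) //.
rewrite -powRN -powRM //.
rewrite !powRN lef_pV2 ?posrE ?powR_gt0 ?mulr_gt0 //.
rewrite ge0_ler_powR ?nnegrE ?(ltW rg) ?(ltW S0) ?mulr_ge0 ?(ltW M0) //.
by rewrite -natrM ler_nat.
Qed.

End lower_estimate.

Theorem theorem3 (R : realType) (p theta : \bar R) (r : R) (k : nat) :
  (1 <= p)%E -> (1 <= theta)%E ->
  Num.max (einv p) 2^-1 < r -> r < k%:R ->
  exists C1 C2 : R, 0 < C1 /\ C1 < C2 /\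
    forall m : nat, (0 < m)%N ->
      (C1%:E * em_class m (besov_class k r p theta)
         <= ((m%:R) `^ (- r + Num.max (einv p - 2^-1) 0))%:E)%E /\
      (((m%:R) `^ (- r + Num.max (einv p - 2^-1) 0))%:E
         <= C2%:E * em_class m (besov_class k r p theta))%E.
Proof.
move=> p1 th1 hr rk.
have [K K0 hK] := upper_bound k p1 th1 hr; have [c c0 hc] := lower_bound p1 th1 hr rk.
have c1 : 0 < c^-1 by rewrite invr_gt0.
have K1 : 0 < K^-1 by rewrite invr_gt0.
(* The summand [K^-1] makes C1 < C2 strict and only weakens the second inequality. *)
exists K^-1, (c^-1 + K^-1); do 2!split => //; first by rewrite ltrDr.
move=> m m0; have := hK m m0; have := hc m m0.
have -> : - r + Num.max (einv p - 2^-1) 0 = - (r - gam p) by rewrite /gam opprB addrC.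
have e0 : 0 <= m%:R `^ (- (r - gam p)) :> R by exact: powR_ge0.
move: (em_class _ _) (m%:R `^ (- (r - gam p)) : R) e0 => E e e0.
(* The upper bound rules out an infinite value of the best approximation, the lower bound a negative
   infinite one. *)
case: E => [E| |//]; last by move=> _; rewrite leye_eq.
rewrite -!EFinM !lee_fin => h1 h2; split.
  by rewrite mulrC ler_pdivrMr // mulrC.
have E0 : 0 <= E by apply: le_trans h1; rewrite mulr_ge0 // ltW.
rewrite mulrDl ler_wpDr ?mulr_ge0 ?(ltW K1) //.
by rewrite mulrC ler_pdivlMr // mulrC.
Qed.
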